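(* Let $n$ and $k$ be positive integers and let $S \subset \{1,\ldots,n\}$ be a symmetric set of residues modulo $n$. Then the function $$A_{S,n,k}(q) = \sum_{\substack{0 < m_1 < \cdots < m_k \\ m_i \in S \pmod n}} \frac{q^{m_1+\cdots+m_k}}{(1-q^{m_1})^2 \cdots (1 - q^{m_k})^2}, \qquad q = e^{2\pi i \tau},\ \tau\in\mathbb{H},$$ is a quasi-modular form of mixed weight at most $2k$ for $\Gamma_1(n)$.
   Context: A set $S \subset \{1,\ldots,n\}$, regarded as a set of residues modulo $n$ (with $n$ representing the residue $0$), is symmetric if for every $\ell \in S$ the residue $-\ell \pmod n$ is also in $S$. In the sum, the $m_i$ run over positive integers whose residue modulo $n$ lies in $S$. $\Gamma_1(n)$ is the group of $\left(\begin{smallmatrix} a&b\\c&d\end{smallmatrix}\right)\in \mathrm{SL}_2(\mathbb{Z})$ with $a\equiv d\equiv 1$ and $c\equiv 0 \pmod n$. Let $\mathbb{H}$ be the upper half-plane. For $\gamma = \left(\begin{smallmatrix} a&b\\c&d\end{smallmatrix}\right)\in \mathrm{SL}_2(\mathbb{Z})$, an integer $k$ and $f:\mathbb{H}\to\mathbb{C}$, put $(f|_k\gamma)(\tau) = (c\tau+d)^{-k} f\left(\frac{a\tau+b}{c\tau+d}\right)$. A nearly-holomorphic modular form of weight $k$ on a subgroup $\Gamma\subseteq \mathrm{SL}_2(\mathbb{Z})$ is a function $f:\mathbb{H}\to\mathbb{C}$ with $f|_k\gamma = f$ for all $\gamma\in\Gamma$ that is expressible as a polynomial in $\frac1y$,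 where $y=\mathrm{Im}(\tau)$, with coefficients holomorphic in $\tau$. A quasi-modular form of weight $k$ for $\Gamma$ is the constant term, with respect to $\frac1y$, of a nearly-holomorphic modular form of weight $k$ on $\Gamma$. A quasi-modular form of mixed weight at most $2k$ for $\Gamma$ is a sum $\sum_{j=0}^{2k} f_j$ where each $f_j$ is a quasi-modular form of weight $j$ for $\Gamma$ (constants are allowed as the weight-$0$ component). *)

(* Defs.v *)
From Stdlib Require Import Reals ZArith List Sorted.
From Coquelicot Require Import Coquelicot.

Definition Cexp (z : C) : C :=
  (exp (Re z) * cos (Im z), exp (Re z) * sin (Im z))%R.

Definition Cpow_Z (z : C) (k : Z) : C :=
  match k with
  | Z0 => RtoC 1
  | Zpos p => Cpow z (Pos.to_nat p)
  | Zneg p => Cinv (Cpow z (Pos.to_nat p))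
  end.

(** The upper half-plane. Functions on it are represented by total functions
    [C -> C]; every condition below constrains their values on [upper] only. *)
Definition upper (tau : C) : Prop := (0 < Im tau)%R.

(** [C_AbsRing] as scalars makes this the complex derivative. *)
Definition holomorphic_upper (f : C -> C) : Prop :=
  forall tau, upper tau -> @ex_derive C_AbsRing C_NormedModule f tau.

(** Generated by the sets of finite, repetition-free lists of elements of [P]
    that contain a given finite list of elements of [P]. *)
Definition finite_parts {I : Type} (P : I -> Prop) (Q : list I -> Prop) : Prop :=
  exists L0 : list I, List.Forall P L0 /\
    forall L : list I, NoDup L -> List.Forall P L -> incl L0 L -> Q L.

Definition Csum_list (l : list C) : C := fold_right Cplus (RtoC 0) l.
Definition Cprod_list (l : list C) : C := fold_right Cmult (RtoC 1) l.

(** The family [f i], [i] ranging over [P], is (unconditionally) summable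
    with sum [s]. *)
Definition is_sum {I : Type} (P : I -> Prop) (f : I -> C) (s : C) : Prop :=
  filterlim (fun L => Csum_list (map f L)) (finite_parts P) (locally s).

Record SL2Z : Type := mkSL2Z {
  ma : Z; mb : Z; mc : Z; md : Z;
  SL2Z_det : (ma * md - mb * mc = 1)%Z
}.

Definition Gamma1 (n : nat) (g : SL2Z) : Prop :=
  (Z.of_nat n | ma g - 1)%Z /\ (Z.of_nat n | md g - 1)%Z /\
  (Z.of_nat n | mc g)%Z.

Definition ZtoC (z : Z) : C := RtoC (IZR z).

Definition automorphy (g : SL2Z) (tau : C) : C :=
  (ZtoC (mc g) * tau + ZtoC (md g))%C.

Definition moebius (g : SL2Z) (tau : C) : C :=
  ((ZtoC (ma g) * tau + ZtoC (mb g)) / automorphy g tau)%C.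

Definition slash (k : Z) (f : C -> C) (g : SL2Z) (tau : C) : C :=
  (Cpow_Z (automorphy g tau) (- k) * f (moebius g tau))%C.

(** [f] is the polynomial [c 0 + c 1 * (1/y) + ... + c p * (1/y)^p]. *)
Definition inv_y_expansion (f : C -> C) (p : nat) (c : nat -> C -> C) : Prop :=
  (forall r, (r <= p)%nat -> holomorphic_upper (c r)) /\
  forall tau, upper tau ->
    f tau = sum_n (fun r => c r tau * Cpow (RtoC (/ Im tau)) r)%C p.

Definition slash_invariant (Gamma : SL2Z -> Prop) (k : Z) (f : C -> C) : Prop :=
  forall g, Gamma g -> forall tau, upper tau -> slash k f g tau = f tau.

Definition nearly_holomorphic_form (Gamma : SL2Z -> Prop) (k : Z) (f : C -> C) :
    Prop :=
  slash_invariant Gamma k f /\ exists p c, inv_y_expansion f p c.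

Definition quasi_modular (Gamma : SL2Z -> Prop) (k : Z) (g : C -> C) : Prop :=
  exists f p c, nearly_holomorphic_form Gamma k f /\ inv_y_expansion f p c /\
    forall tau, upper tau -> g tau = c 0%nat tau.

Definition quasi_modular_mixed (Gamma : SL2Z -> Prop) (K : nat) (g : C -> C) :
    Prop :=
  exists f : nat -> C -> C,
    (forall j, (j <= K)%nat -> quasi_modular Gamma (Z.of_nat j) (f j)) /\
    forall tau, upper tau -> g tau = sum_n (fun j => f j tau) K.

Definition symmetric_residues (n : nat) (S : nat -> Prop) : Prop :=
  forall l, S l -> exists l', S l' /\ Nat.modulo (l + l') n = 0%nat.

Definition residue_in (n : nat) (S : nat -> Prop) (m : nat) : Prop :=
  exists l, S l /\ Nat.modulo m n = Nat.modulo l n.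

Definition index_tuple (S : nat -> Prop) (n k : nat) (m : list nat) : Prop :=
  length m = k /\ StronglySorted lt m /\
  List.Forall (fun mi => (0 < mi)%nat /\ residue_in n S mi) m.

Definition A_term (q : C) (m : list nat) : C :=
  (Cpow q (list_sum m)
   / Cprod_list (map (fun mi => Cpow (RtoC 1 - Cpow q mi) 2) m))%C.

Definition nome (tau : C) : C := Cexp (RtoC (2 * PI) * Ci * tau)%C.

(** [A] is the function [A_{S,n,k}] on the upper half-plane. *)
Definition is_A (S : nat -> Prop) (n k : nat) (A : C -> C) : Prop :=
  forall tau, upper tau ->
    is_sum (index_tuple S n k) (A_term (nome tau)) (A tau).

(* Main.v *)
Require Import Defs.
From Stdlib Require Import Reals ZArith List Sorted.
From Coquelicot Require Import Coquelicot.
From Stdlib Require Import Lra Lia Permutation Classical ClassicalEpsilon.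

(** With [x_m = q^m / (1 - q^m)^2], the function is the [k]-th elementary
symmetric function of the family [x_m], where [m] runs over the positive
integers with residue in [S].  By Newton's identities it is a polynomial,
isobaric when the [j]-th power sum has degree [j], in the power sums
[p_j = sum_m x_m^j].  Quasi-modular forms of mixed weight are closed under
products, with weights adding, so it is enough that [p_j] has mixed weight at
most [2 j]; this is [qsum_qmm], and [esum_qmm] is the resulting induction.

To treat [p_j], write [x_m = qterm (m tau)] with [qterm z = e / (1 - e)^2],
[e = exp (2 pi i z)].  Up to the factor [(2 pi i)^2] this is
[rowsum 2 z = sum_d (z + d)^(-2)] ([rowsum2_eq_qterm], by Herglotz' trick).
Differentiating twice multiplies [rowsum k] by [k (k + 1)] and shifts it to
[rowsum (k + 2)]; on the other side, [D = (2 pi i)^(-1) d/dz] satisfies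
[D^2 x^j = j^2 x^j + (4 j^2 + 2 j) x^(j + 1)].  Hence the powers [x, ..., x^j]
and the row sums of weights [2, 4, ..., 2 j] have the same span ([qpow_span] and
[rowsum_span]).  As [S] is symmetric and the row sums are even, [p_j] becomes,
up to a constant, a combination of the series
[eis (2 i) = sum_m sum_d (m tau + d)^(-2 i)] with [i <= j], where [m] runs over
all integers with residue in [S].

For weight at least 3 this double series converges absolutely, and an element of
[Gamma1 n] permutes its terms ([eis_modular]).  In weight 2 it only converges
by rows.  For a lattice vector [lam], the terms
[lam / w^2 + 1 / (z + lam + w) - 1 / (z + w)] do sum absolutely over the lattice.
Summed by rows, the first part gives [lam] times the Eisenstein series and
the others give differences of cotangents, which telescope over the rows to a
multiple of the jump of [pi cot (pi z)] between [- i oo] and [+ i oo].  With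
[lam = c tau + d] on the lattice of [tau], which corresponds to [lam = 1] on the
lattice of [(a tau + b) / (c tau + d)], this yields
[E (g tau) = j (j E tau + nu c / n)] with [j = c tau + d]
([eis2_transform]).  Adding a suitable multiple of [1 / y] makes [E] invariant of
weight 2, so [E] is quasi-modular ([eis_qm]).

The coefficients are holomorphic because [eis (2 i)] is also a constant plus a
combination of the series [sum_m x_m^j], whose terms decay exponentially and may
be differentiated one by one ([qsum_holomorphic]). *)

Open Scope R_scope.
Open Scope C_scope.

(** * Finite sums over lists *)

Fixpoint Rsum {I} (g : I -> R) (L : list I) : R :=
  match L with nil => 0%R | i :: L => (g i + Rsum g L)%R end.

Fixpoint Csum {I} (f : I -> C) (L : list I) : C :=
  match L with nil => 0 | i :: L => f i + Csum f L end.

Lemma Csum_list_map {I} (f : I -> C) L : Csum_list (map f L) = Csum f L.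
Proof. induction L as [|i L IH]; [reflexivity|]. simpl. f_equal. exact IH. Qed.

Lemma Csum_app {I} (f : I -> C) L L' : Csum f (L ++ L') = Csum f L + Csum f L'.
Proof. induction L as [|i L IH]; simpl; [ring|]. rewrite IH. ring. Qed.

Lemma Rsum_app {I} (f : I -> R) L L' : Rsum f (L ++ L') = (Rsum f L + Rsum f L')%R.
Proof. induction L as [|i L IH]; simpl; [ring|]. rewrite IH. ring. Qed.

Lemma Csum_perm {I} (f : I -> C) L L' : Permutation L L' -> Csum f L = Csum f L'.
Proof. induction 1; simpl; try congruence; ring. Qed.

Lemma Rsum_perm {I} (f : I -> R) L L' : Permutation L L' -> Rsum f L = Rsum f L'.
Proof. induction 1; simpl; try congruence; ring. Qed.

Lemma Csum_map {I J} (h : I -> J) (f : J -> C) L : Csum f (map h L) = Csum (fun i => f (h i)) L.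
Proof. induction L as [|i L IH]; simpl; congruence. Qed.

Lemma Rsum_map {I J} (h : I -> J) (f : J -> R) L : Rsum f (map h L) = Rsum (fun i => f (h i)) L.
Proof. induction L as [|i L IH]; simpl; congruence. Qed.

Lemma Csum_ext {I} (f g : I -> C) L : (forall i, In i L -> f i = g i) -> Csum f L = Csum g L.
Proof.
  induction L as [|i L IH]; simpl; intros H; [reflexivity|].
  rewrite H, IH; auto.
Qed.

Lemma Csum_plus {I} (f g : I -> C) L : Csum (fun i => f i + g i) L = Csum f L + Csum g L.
Proof. induction L as [|i L IH]; simpl; [ring|]. rewrite IH. ring. Qed.

Lemma Csum_scal {I} c (f : I -> C) L : Csum (fun i => c * f i) L = c * Csum f L.
Proof. induction L as [|i L IH]; simpl; [ring|]. rewrite IH. ring. Qed.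

Lemma Rsum_scal {I} c (f : I -> R) L : Rsum (fun i => c * f i)%R L = (c * Rsum f L)%R.
Proof. induction L as [|i L IH]; simpl; [ring|]. rewrite IH. ring. Qed.

Lemma Rsum_le {I} (f g : I -> R) L : (forall i, In i L -> f i <= g i) -> Rsum f L <= Rsum g L.
Proof.
  induction L as [|i L IH]; simpl; intros H; [lra|].
  apply Rplus_le_compat; auto.
Qed.

Lemma Rsum_pos {I} (f : I -> R) L : (forall i, In i L -> 0 <= f i) -> 0 <= Rsum f L.
Proof.
  induction L as [|i L IH]; simpl; intros H; [lra|].
  apply Rplus_le_le_0_compat; auto.
Qed.

Lemma Csum_mod {I} (f : I -> C) L : Cmod (Csum f L) <= Rsum (fun i => Cmod (f i)) L.
Proof.
  induction L as [|i L IH]; simpl; [rewrite Cmod_0; lra|].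
  eapply Rle_trans; [apply Cmod_triangle|]. lra.
Qed.

Lemma Csum_prod {I J} (f : I * J -> C) (A : list I) (B : list J) :
  Csum f (list_prod A B) = Csum (fun i => Csum (fun j => f (i, j)) B) A.
Proof.
  induction A as [|i A IH]; simpl; [reflexivity|].
  rewrite Csum_app, Csum_map, IH. reflexivity.
Qed.

Lemma Rsum_prod {I J} (f : I * J -> R) (A : list I) (B : list J) :
  Rsum f (list_prod A B) = Rsum (fun i => Rsum (fun j => f (i, j)) B) A.
Proof.
  induction A as [|i A IH]; simpl; [reflexivity|].
  rewrite Rsum_app, Rsum_map, IH. reflexivity.
Qed.

Lemma NoDup_extract {I} (L0 L : list I) :
  NoDup L0 -> incl L0 L -> exists R, Permutation L (L0 ++ R).
Proof.
  revert L. induction L0 as [|a L0 IH]; intros L H0 Hi.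
  - exists L. apply Permutation_refl.
  - inversion H0; subst.
    destruct (in_split a L) as [A [B HL]]; [apply Hi; left; reflexivity|]. subst L.
    destruct (IH (A ++ B)) as [R HR]; auto.
    + intros b Hb. specialize (Hi b (or_intror Hb)).
      apply in_app_or in Hi. apply in_or_app. destruct Hi as [|[->|]]; tauto.
    + exists R. simpl. apply Permutation_sym. etransitivity;
      [apply perm_skip, Permutation_sym, HR|]. apply Permutation_middle.
Qed.

Definition eqdec {I : Type} : forall a b : I, {a = b} + {a <> b} :=
  fun a b => excluded_middle_informative (a = b).

Lemma Forall_nodup {I} (P : I -> Prop) L : List.Forall P L -> List.Forall P (nodup eqdec L).
Proof. rewrite !Forall_forall. intros H x Hx. apply H. eapply nodup_In, Hx. Qed.

Lemma incl_nodup {I} (L : list I) : incl L (nodup eqdec L).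
Proof. intros x Hx. apply nodup_In, Hx. Qed.

(** * Unconditional sums *)

(** The epsilon form of [is_sum], with the modulus in place of the product
neighbourhoods of [C]. *)
Definition has_sum {I} (P : I -> Prop) (f : I -> C) (s : C) : Prop :=
  forall eps : R, 0 < eps -> exists L0, List.Forall P L0 /\
    forall L, NoDup L -> List.Forall P L -> incl L0 L -> Cmod (Csum f L - s) < eps.

Lemma locally_Cmod (s : C) (Q : C -> Prop) :
  locally s Q <-> exists eps : R, 0 < eps /\ forall y, Cmod (y - s) < eps -> Q y.
Proof.
  split.
  - intros [e He]. exists e. split; [apply cond_pos|]. intros y Hy. apply He.
    apply C_NormedModule_mixin_compat1. exact Hy.
  - intros [e [He H]].
    assert (H2 : 0 < e / 2) by lra.
    exists (mkposreal _ H2). intros y Hy. apply H.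
    apply C_NormedModule_mixin_compat2 in Hy. simpl in Hy.
    eapply Rlt_le_trans; [exact Hy|].
    assert (sqrt 2 <= 2); [|nra].
    rewrite <- (sqrt_Rsqr 2) at 2 by lra. apply sqrt_le_1_alt. unfold Rsqr. lra.
Qed.

Lemma is_sum_has_sum {I} (P : I -> Prop) f s : is_sum P f s <-> has_sum P f s.
Proof.
  split.
  - intros H eps He.
    assert (HL : locally s (fun y => (Cmod (y - s) < eps))).
    { apply locally_Cmod. exists eps. split; auto. }
    destruct (H _ HL) as [L0 [H0 H1]]. exists L0. split; [exact H0|].
    intros L H2 H3 H4. specialize (H1 L H2 H3 H4). rewrite Csum_list_map in H1. exact H1.
  - intros H Q HQ. apply locally_Cmod in HQ. destruct HQ as [e [He HQ]].
    destruct (H e He) as [L0 [H0 H1]]. exists L0. split; [exact H0|].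
    intros L H2 H3 H4. rewrite Csum_list_map. apply HQ. auto.
Qed.

Lemma has_sum_ext {I} (P : I -> Prop) f g s :
  (forall i, P i -> f i = g i) -> has_sum P f s -> has_sum P g s.
Proof.
  intros E H eps He. destruct (H eps He) as [L0 [H0 H1]]. exists L0. split; [exact H0|].
  intros L H2 H3 H4. rewrite <- (Csum_ext f g); auto.
  intros i Hi. apply E. rewrite Forall_forall in H3. auto.
Qed.

Lemma Ceq_eps a b : (forall eps : R, 0 < eps -> Cmod (a - b) < eps) -> a = b.
Proof.
  intros H. assert (E : Cmod (a - b) = 0%R).
  { destruct (Cmod_ge_0 (a - b)) as [L|L]; [|auto]. specialize (H _ L). lra. }
  apply Cmod_eq_0 in E. replace a with ((a - b) + b) by ring. rewrite E. ring.
Qed.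

Lemma Cmod_diff_triangle u a b : Cmod (a - b) <= Cmod (u - a) + Cmod (u - b).
Proof.
  replace (a - b) with (-(u - a) + (u - b)) by ring.
  eapply Rle_trans; [apply Cmod_triangle|]. rewrite Cmod_opp. lra.
Qed.

Lemma has_sum_unique {I} (P : I -> Prop) f s t : has_sum P f s -> has_sum P f t -> s = t.
Proof.
  intros Hs Ht. apply Ceq_eps. intros eps He.
  destruct (Hs (eps / 2)%R ltac:(lra)) as [A [HA HA']].
  destruct (Ht (eps / 2)%R ltac:(lra)) as [B [HB HB']].
  set (L := nodup eqdec (A ++ B)).
  assert (N1 : NoDup L) by apply NoDup_nodup.
  assert (N2 : List.Forall P L) by (apply Forall_nodup, Forall_app; auto).
  assert (IA : incl A L) by (intros a Ha; apply nodup_In, in_or_app; auto).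
  assert (IB : incl B L) by (intros a Ha; apply nodup_In, in_or_app; auto).
  specialize (HA' L N1 N2 IA). specialize (HB' L N1 N2 IB).
  pose proof (Cmod_diff_triangle (Csum f L) s t). lra.
Qed.

Lemma has_sum_plus {I} (P : I -> Prop) f g s t :
  has_sum P f s -> has_sum P g t -> has_sum P (fun i => f i + g i) (s + t).
Proof.
  intros Hs Ht eps He.
  destruct (Hs (eps / 2)%R ltac:(lra)) as [A [HA HA']].
  destruct (Ht (eps / 2)%R ltac:(lra)) as [B [HB HB']].
  exists (A ++ B). split; [apply Forall_app; auto|].
  intros L H1 H2 H3. rewrite Csum_plus.
  specialize (HA' L H1 H2 (fun a Ha => H3 a (in_or_app _ _ _ (or_introl Ha)))).
  specialize (HB' L H1 H2 (fun a Ha => H3 a (in_or_app _ _ _ (or_intror Ha)))).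
  replace (Csum f L + Csum g L - (s + t)) with ((Csum f L - s) + (Csum g L - t)) by ring.
  eapply Rle_lt_trans; [apply Cmod_triangle|]. lra.
Qed.

Lemma has_sum_scal {I} (P : I -> Prop) c f s :
  has_sum P f s -> has_sum P (fun i => c * f i) (c * s).
Proof.
  intros Hs eps He. pose proof (Cmod_ge_0 c) as Hc.
  destruct (Hs (eps / (1 + Cmod c))%R) as [A [HA HA']].
  { apply Rdiv_lt_0_compat; lra. }
  exists A. split; [exact HA|]. intros L H1 H2 H3. rewrite Csum_scal.
  specialize (HA' L H1 H2 H3).
  replace (c * Csum f L - c * s) with (c * (Csum f L - s)) by ring. rewrite Cmod_mult.
  apply (Rmult_lt_compat_r (1 + Cmod c)) in HA'; [|lra].
  replace (eps / (1 + Cmod c) * (1 + Cmod c))%R with eps in HA' by (field; lra).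
  pose proof (Cmod_ge_0 (Csum f L - s)). lra.
Qed.

Lemma has_sum_minus {I} (P : I -> Prop) f g s t :
  has_sum P f s -> has_sum P g t -> has_sum P (fun i => f i - g i) (s - t).
Proof.
  intros Hs Ht. replace (s - t) with (s + (-(1)) * t) by ring.
  apply (has_sum_ext P (fun i => f i + (-(1)) * g i)); [intros; ring|].
  apply has_sum_plus; [exact Hs|]. apply has_sum_scal, Ht.
Qed.

Lemma has_sum_0 {I} (P : I -> Prop) (f : I -> C) : (forall i, P i -> f i = 0) -> has_sum P f 0.
Proof.
  intros E. apply (has_sum_ext P (fun _ => 0)); [intros i Hi; symmetry; auto|].
  intros eps He. exists nil. split; [constructor|]. intros L _ _ _.
  assert (Csum (fun _ : I => 0) L = 0) as ->.
  { induction L as [|i L IH]; simpl; [reflexivity|]. rewrite IH. ring. }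
  replace (0 - 0) with (RtoC 0) by ring. rewrite Cmod_0. exact He.
Qed.

Lemma has_sum_reindex {I J} (P : I -> Prop) (Q : J -> Prop) (h : I -> J) (f : J -> C) s :
  (forall i, P i -> Q (h i)) ->
  (forall i i', P i -> P i' -> h i = h i' -> i = i') ->
  (forall j, Q j -> exists i, P i /\ h i = j) ->
  has_sum P (fun i => f (h i)) s <-> has_sum Q f s.
Proof.
  intros HPQ Hinj Hsurj.
  assert (lift : forall L, List.Forall Q L -> exists L', List.Forall P L' /\ map h L' = L).
  { induction L as [|j L IH]; intros HL; [exists nil; split; constructor|].
    inversion HL as [|? ? Hj0 HL0]; subst. destruct IH as [L' [H3 H4]]; auto.
    destruct (Hsurj j Hj0) as [i [Hi Hj]]. exists (i :: L'). split; [constructor; auto|].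
    simpl. congruence. }
  assert (pushF : forall L, List.Forall P L -> List.Forall Q (map h L)).
  { intros L HL. rewrite Forall_forall in *. intros j Hj. apply in_map_iff in Hj.
    destruct Hj as [i [<- Hi]]. auto. }
  split; intros H eps He; destruct (H eps He) as [L0 [H0 H1]].
  - exists (map h L0). split; [auto|]. intros L H2 H3 H4.
    destruct (lift L H3) as [L' [H5 <-]]. rewrite Csum_map. apply H1; auto.
    + eapply NoDup_map_inv, H2.
    + intros i Hi. assert (Hin : In (h i) (map h L')) by (apply H4, in_map, Hi).
      apply in_map_iff in Hin. destruct Hin as [i' [E Hi']].
      rewrite Forall_forall in *. rewrite (Hinj i i'); auto.
  - destruct (lift L0 H0) as [L0' [H5 H6]]. subst L0. exists L0'. split; [exact H5|].
    intros L H2 H3 H4. rewrite <- Csum_map. apply H1; auto.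
    + rewrite Forall_forall in H3. clear H4. revert H3. induction H2 as [|x L Hx H2 IH2]; intros H3; simpl; [constructor|].
      constructor.
      * intros Hin. apply in_map_iff in Hin. destruct Hin as [y [E Hy]].
        apply Hx. rewrite <- (Hinj y x); auto; apply H3; simpl; auto.
      * apply IH2. intros; apply H3; simpl; auto.
    + intros j Hj. apply in_map_iff in Hj. destruct Hj as [i [<- Hi]]. apply in_map. auto.
Qed.

Lemma has_sum_pred_ext {I} (P Q : I -> Prop) f s :
  (forall i, P i <-> Q i) -> has_sum P f s -> has_sum Q f s.
Proof.
  intros E. apply (has_sum_reindex P Q (fun i => i)); firstorder.
Qed.

Lemma has_sum_union {I} (P Q : I -> Prop) f s t :
  (forall i, P i -> Q i -> False) ->
  has_sum P f s -> has_sum Q f t -> has_sum (fun i => P i \/ Q i) f (s + t).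
Proof.
  intros D Hs Ht eps He.
  destruct (Hs (eps / 2)%R ltac:(lra)) as [A [HA HA']].
  destruct (Ht (eps / 2)%R ltac:(lra)) as [B [HB HB']].
  exists (A ++ B). split.
  { apply Forall_app. split; eapply Forall_impl; try eassumption; simpl; auto. }
  intros L H1 H2 H3.
  set (p := fun i => if excluded_middle_informative (P i) then true else false).
  assert (E : Csum f L = Csum f (filter p L) + Csum f (filter (fun i => negb (p i)) L)).
  { clear. induction L as [|i L IH]; simpl; [ring|]. destruct (p i); simpl; rewrite IH; ring. }
  rewrite Forall_forall in *.
  assert (C1 : Cmod (Csum f (filter p L) - s) < eps / 2).
  { apply HA'.
    - apply NoDup_filter, H1.
    - apply Forall_forall. intros i Hi. apply filter_In in Hi. destruct Hi as [_ Hi].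
      unfold p in Hi. destruct (excluded_middle_informative (P i)); congruence.
    - intros i Hi. apply filter_In. split; [apply H3, in_or_app; auto|].
      unfold p. destruct (excluded_middle_informative (P i)); auto; exfalso; auto. }
  assert (C2 : Cmod (Csum f (filter (fun i => negb (p i)) L) - t) < eps / 2).
  { apply HB'.
    - apply NoDup_filter, H1.
    - apply Forall_forall. intros i Hi. apply filter_In in Hi. destruct Hi as [Hi' Hi].
      unfold p in Hi. destruct (excluded_middle_informative (P i)); simpl in Hi; try congruence.
      destruct (H2 i Hi'); tauto.
    - intros i Hi. apply filter_In. split; [apply H3, in_or_app; auto|].
      unfold p. destruct (excluded_middle_informative (P i)); simpl; auto; exfalso; eauto. }
  rewrite E. match goal with |- (Cmod ?z < _) => replace z with
    ((Csum f (filter p L) - s) + (Csum f (filter (fun i => negb (p i)) L) - t)) by ring end.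
  eapply Rle_lt_trans; [apply Cmod_triangle|]. lra.
Qed.

Lemma has_sum_single {I} (a : I) f : has_sum (fun i => i = a) f (f a).
Proof.
  intros eps He. exists (a :: nil). split; [constructor; auto|].
  intros L H1 H2 H3.
  assert (L = a :: nil) as ->.
  { rewrite Forall_forall in H2. destruct L as [|b L]; [destruct (H3 a); left; auto|].
    pose proof (H2 b (or_introl eq_refl)). subst b. destruct L as [|b L]; [reflexivity|].
    pose proof (H2 b (or_intror (or_introl eq_refl))). subst b. inversion H1; subst.
    exfalso. apply H4. left; auto. }
  simpl. replace (f a + 0 - f a) with (RtoC 0) by ring. rewrite Cmod_0. exact He.
Qed.

(** The common finite set of columns needed for Fubini. *)
Lemma has_sum_finitely_many {I J} (Q : J -> Prop) (f : I -> J -> C) (g : I -> C) (LI : list I) (J0 : list J) eps :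
  0 < eps -> List.Forall Q J0 -> (forall i, In i LI -> has_sum Q (f i) (g i)) ->
  exists LJ, NoDup LJ /\ List.Forall Q LJ /\ incl J0 LJ /\
    forall i, In i LI -> Cmod (Csum (f i) LJ - g i) < eps.
Proof.
  intros He HJ0 H.
  assert (exists L1, List.Forall Q L1 /\ forall LJ, NoDup LJ -> List.Forall Q LJ -> incl L1 LJ ->
     forall i, In i LI -> Cmod (Csum (f i) LJ - g i) < eps) as [L1 [H1 H2]].
  { induction LI as [|a LI IH].
    - exists nil. split; [constructor|]. intros ? ? ? ? ? [].
    - destruct IH as [L1 [H1 H2]]; [intros; apply H; right; auto|].
      destruct (H a (or_introl eq_refl) eps He) as [L2 [H3 H4]].
      exists (L1 ++ L2). split; [apply Forall_app; auto|].
      intros LJ H5 H6 H7 i [<-|Hi].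
      + apply H4; auto. intros x Hx. apply H7, in_or_app. auto.
      + apply H2; auto. intros x Hx. apply H7, in_or_app. auto. }
  exists (nodup eqdec (J0 ++ L1)).
  assert (NoDup (nodup eqdec (J0 ++ L1))) by apply NoDup_nodup.
  assert (List.Forall Q (nodup eqdec (J0 ++ L1))) by (apply Forall_nodup, Forall_app; auto).
  repeat split; auto.
  - intros x Hx. apply nodup_In, in_or_app; auto.
  - apply H2; auto. intros x Hx. apply nodup_In, in_or_app; auto.
Qed.

Lemma NoDup_list_prod {I J} (A : list I) (B : list J) :
  NoDup A -> NoDup B -> NoDup (list_prod A B).
Proof.
  intros HA HB. induction HA as [|a A Ha HA IH]; simpl; [constructor|].
  apply NoDup_app; auto.
  - apply FinFun.Injective_map_NoDup; auto. intros x y E. congruence.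
  - intros [x y] Hx Hy. apply in_map_iff in Hx. destruct Hx as [z [E _]].
    apply in_prod_iff in Hy. inversion E; subst. tauto.
Qed.

(** A rectangle with prescribed rows, and enough columns for all these rows to be
close to their sums, also exhausts the double sum. *)
Lemma has_sum_fubini {I J} (P : I -> Prop) (Q : J -> Prop) (f : I * J -> C) (g : I -> C) s :
  has_sum (fun p => P (fst p) /\ Q (snd p)) f s ->
  (forall i, P i -> has_sum Q (fun j => f (i, j)) (g i)) ->
  has_sum P g s.
Proof.
  intros H Hg eps He.
  destruct (H (eps / 2)%R ltac:(lra)) as [L0 [H0 H1]].
  exists (map fst L0). split.
  { rewrite Forall_forall in *. intros i Hi. apply in_map_iff in Hi.
    destruct Hi as [p [<- Hp]]. apply H0, Hp. }
  intros L H2 H3 H4.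
  set (d := (eps / 2 / (1 + INR (length L)))%R).
  assert (Hlen : 0 <= INR (length L)) by apply pos_INR.
  assert (Hd : 0 < d) by (apply Rdiv_lt_0_compat; lra).
  destruct (has_sum_finitely_many Q (fun i j => f (i, j)) g L (map snd L0) d Hd)
    as [LJ [K1 [K2 [K3 K4]]]].
  { rewrite Forall_forall in *. intros i Hi. apply in_map_iff in Hi.
    destruct Hi as [p [<- Hp]]. apply H0, Hp. }
  { intros i Hi. apply Hg. rewrite Forall_forall in H3. auto. }
  assert (E : Cmod (Csum f (list_prod L LJ) - s) < eps / 2).
  { apply H1.
    - apply NoDup_list_prod; auto.
    - rewrite Forall_forall in *. intros [i j] Hij. apply in_prod_iff in Hij. simpl. firstorder.
    - intros [i j] Hij. apply in_prod_iff. split.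
      + apply H4. apply (in_map fst) in Hij. exact Hij.
      + apply K3. apply (in_map snd) in Hij. exact Hij. }
  rewrite Csum_prod in E.
  assert (D : Cmod (Csum g L - Csum (fun i => Csum (fun j => f (i, j)) LJ) L) <= INR (length L) * d).
  { clear E H3 H4 H2. clearbody d. clear Hlen.
    induction L as [|i L IH].
    - simpl. replace (0 - 0) with (RtoC 0) by ring. rewrite Cmod_0. lra.
    - change (length (i :: L)) with (S (length L)). rewrite S_INR. simpl Csum.
      match goal with |- (Cmod ?z <= _) => replace z with
       ((Csum g L - Csum (fun i => Csum (fun j => f (i, j)) LJ) L) + -(Csum (fun j => f (i,j)) LJ - g i)) by ring end.
      eapply Rle_trans; [apply Cmod_triangle|]. rewrite Cmod_opp.
      specialize (K4 i (or_introl eq_refl)) as K5.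
      specialize (IH (fun i Hi => K4 i (or_intror Hi))). lra. }
  assert (INR (length L) * d < eps / 2).
  { unfold d. apply (Rmult_lt_reg_r (1 + INR (length L))); [lra|].
    field_simplify; [|lra]. nra. }
  replace (Csum g L - s) with ((Csum g L - Csum (fun i => Csum (fun j => f (i, j)) LJ) L)
    + (Csum (fun i => Csum (fun j => f (i, j)) LJ) L - s)) by ring.
  eapply Rle_lt_trans; [apply Cmod_triangle|]. lra.
Qed.

(** * Absolutely summable families *)

Definition sums_below {I} (P : I -> Prop) (g : I -> R) (B : R) : Prop :=
  forall L, NoDup L -> List.Forall P L -> Rsum g L <= B.

Lemma sums_below_le {I} (P : I -> Prop) g g' B :
  (forall i, P i -> g i <= g' i) -> sums_below P g' B -> sums_below P g B.
Proof.
  intros H HB L H1 H2. eapply Rle_trans; [|apply HB; eauto].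
  apply Rsum_le. rewrite Forall_forall in H2. auto.
Qed.

Lemma sums_below_scal {I} (P : I -> Prop) g B c :
  0 <= c -> sums_below P g B -> sums_below P (fun i => c * g i)%R (c * B).
Proof. intros Hc H L H1 H2. rewrite Rsum_scal. apply Rmult_le_compat_l; auto. Qed.

(** Beyond a finite set that nearly attains the supremum of the absolute partial sums,
further terms contribute little, so the partial sums form a Cauchy filter. *)
Lemma summable_has_sum {I} (P : I -> Prop) f B :
  sums_below P (fun i => Cmod (f i)) B -> exists s, has_sum P f s.
Proof.
  intros HB.
  set (E := fun r => exists L, NoDup L /\ List.Forall P L /\ r = Rsum (fun i => Cmod (f i)) L).
  destruct (completeness E) as [M [HM1 HM2]].
  { exists B. intros r [L [H1 [H2 ->]]]. auto. }
  { exists 0%R. exists nil. repeat split; constructor. }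
  assert (T : forall eps, 0 < eps -> exists L0, NoDup L0 /\ List.Forall P L0 /\
     forall L, NoDup L -> List.Forall P L -> incl L0 L -> Cmod (Csum f L - Csum f L0) < eps).
  { intros eps He.
    destruct (classic (exists L0, NoDup L0 /\ List.Forall P L0 /\ (M - eps < Rsum (fun i => Cmod (f i)) L0)))
      as [[L0 [H1 [H2 H3]]]|N].
    - exists L0. repeat split; auto. intros L H4 H5 H6.
      destruct (NoDup_extract L0 L H1 H6) as [R HR].
      rewrite (Csum_perm f _ _ HR), Csum_app.
      replace (Csum f L0 + Csum f R - Csum f L0) with (Csum f R) by ring.
      eapply Rle_lt_trans; [apply Csum_mod|].
      assert (Rsum (fun i => Cmod (f i)) L <= M) by (apply HM1; exists L; auto).
      rewrite (Rsum_perm _ _ _ HR), Rsum_app in H. lra.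
    - exfalso. assert (M <= M - eps); [|lra]. apply HM2. intros r [L [H1 [H2 ->]]].
      apply Rnot_lt_le. intros H3. apply N. eauto. }
  set (F := fun L : list I => Csum f L).
  assert (FF : ProperFilter (finite_parts P)).
  { constructor.
    - intros Q [L0 [H0 H1]]. exists (nodup eqdec L0). apply H1.
      apply NoDup_nodup. apply Forall_nodup, H0. apply incl_nodup.
    - constructor.
      + exists nil. split; [constructor|]. auto.
      + intros Q1 Q2 [A [HA HA']] [B' [HB' HB'']]. exists (A ++ B'). split; [apply Forall_app; auto|].
        intros L H1 H2 H3. split; [apply HA'|apply HB'']; auto; intros x Hx; apply H3, in_or_app; auto.
      + intros Q1 Q2 H [A [HA HA']]. exists A. split; auto. }
  destruct (proj1 (@filterlim_locally_cauchy (list I) C_R_CompleteNormedModule (finite_parts P) FF F)) as [s Hs].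
  - intros eps. destruct (T (eps / 2)%R) as [L0 [H1 [H2 H3]]]; [apply is_pos_div_2|].
    exists (fun L => (Cmod (Csum f L - Csum f L0) < eps / 2)). split.
    + exists L0. split; auto.
    + intros u v Hu Hv. apply C_NormedModule_mixin_compat1. unfold F.
      change (Cmod (Csum f v - Csum f u) < eps).
      replace (Csum f v - Csum f u) with ((Csum f v - Csum f L0) + -(Csum f u - Csum f L0)) by ring.
      eapply Rle_lt_trans; [apply Cmod_triangle|]. rewrite Cmod_opp. lra.
  - exists s. apply is_sum_has_sum. unfold is_sum.
    eapply filterlim_ext; [|exact Hs]. intros L. symmetry. apply Csum_list_map.
Qed.

Lemma has_sum_bound {I} (P : I -> Prop) f s B :
  has_sum P f s -> sums_below P (fun i => Cmod (f i)) B -> Cmod s <= B.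
Proof.
  intros H HB. apply le_epsilon. intros eps He.
  destruct (H eps He) as [L0 [H0 H1]].
  set (L := nodup eqdec L0).
  assert (N1 : NoDup L) by apply NoDup_nodup.
  assert (N2 : List.Forall P L) by (apply Forall_nodup; auto).
  specialize (H1 L N1 N2 (incl_nodup L0)). specialize (HB L N1 N2).
  pose proof (Csum_mod f L).
  replace s with (Csum f L + -(Csum f L - s)) by ring.
  eapply Rle_trans; [apply Cmod_triangle|]. rewrite Cmod_opp. lra.
Qed.

(** * Limits of sequences *)

Definition Clim (u : nat -> C) (s : C) : Prop :=
  forall eps, 0 < eps -> exists N, forall n, (N <= n)%nat -> Cmod (u n - s) < eps.

(** Turns an unconditional sum into a limit of explicit finite sums, to which
telescoping and Newton's identities apply. *)
Lemma has_sum_exhaust {I} (P : I -> Prop) f s (LL : nat -> list I) :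
  has_sum P f s -> (forall N, NoDup (LL N) /\ List.Forall P (LL N)) ->
  (forall i, P i -> exists N, forall M, (N <= M)%nat -> In i (LL M)) ->
  Clim (fun N => Csum f (LL N)) s.
Proof.
  intros H HL HE eps He. destruct (H eps He) as [L0 [H0 H1]].
  assert (exists N, forall M, (N <= M)%nat -> incl L0 (LL M)) as [N HN].
  { clear H1. induction H0 as [|i L0 Hi H0 IH].
    - exists O. intros M _ x [].
    - destruct IH as [N HN]. destruct (HE i Hi) as [N' HN'].
      exists (max N N'). intros M HM x [<-|Hx].
      + apply HN'. lia.
      + apply (HN M); [lia|auto]. }
  exists N. intros M HM. apply H1; try apply HL. auto.
Qed.

Lemma Clim_unique u s t : Clim u s -> Clim u t -> s = t.
Proof.
  intros Hs Ht. apply Ceq_eps. intros eps He.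
  destruct (Hs (eps / 2)%R ltac:(lra)) as [A HA]. destruct (Ht (eps / 2)%R ltac:(lra)) as [B HB].
  specialize (HA (max A B) ltac:(lia)). specialize (HB (max A B) ltac:(lia)).
  pose proof (Cmod_diff_triangle (u (max A B)) s t). lra.
Qed.

Lemma Clim_ext u v s : (forall n, u n = v n) -> Clim u s -> Clim v s.
Proof. intros E H eps He. destruct (H eps He) as [N HN]. exists N. intros. rewrite <- E. auto. Qed.

Lemma Clim_const c : Clim (fun _ => c) c.
Proof. intros eps He. exists O. intros. replace (c - c) with (RtoC 0) by ring. rewrite Cmod_0. auto. Qed.

Lemma Clim_plus u v s t : Clim u s -> Clim v t -> Clim (fun n => u n + v n) (s + t).
Proof.
  intros Hs Ht eps He.
  destruct (Hs (eps/2)%R ltac:(lra)) as [A HA]. destruct (Ht (eps/2)%R ltac:(lra)) as [B HB].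
  exists (max A B). intros n Hn. specialize (HA n ltac:(lia)). specialize (HB n ltac:(lia)).
  replace (u n + v n - (s + t)) with ((u n - s) + (v n - t)) by ring.
  eapply Rle_lt_trans; [apply Cmod_triangle|]. lra.
Qed.

Lemma Clim_scal u s c : Clim u s -> Clim (fun n => c * u n) (c * s).
Proof.
  intros Hs eps He. pose proof (Cmod_ge_0 c) as Hc.
  destruct (Hs (eps / (1 + Cmod c))%R) as [A HA]; [apply Rdiv_lt_0_compat; lra|].
  exists A. intros n Hn. specialize (HA n Hn).
  replace (c * u n - c * s) with (c * (u n - s)) by ring. rewrite Cmod_mult.
  apply (Rmult_lt_compat_r (1 + Cmod c)) in HA; [|lra].
  replace (eps / (1 + Cmod c) * (1 + Cmod c))%R with eps in HA by (field; lra).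
  pose proof (Cmod_ge_0 (u n - s)). lra.
Qed.

Lemma Clim_minus u v s t : Clim u s -> Clim v t -> Clim (fun n => u n - v n) (s - t).
Proof.
  intros Hs Ht. replace (s - t) with (s + (-(1)) * t) by ring.
  apply (Clim_ext (fun n => u n + (-(1)) * v n)); [intros; ring|].
  apply Clim_plus; auto. apply Clim_scal; auto.
Qed.

Lemma Clim_mult u v s t : Clim u s -> Clim v t -> Clim (fun n => u n * v n) (s * t).
Proof.
  intros Hs Ht.
  assert (H0 : Clim (fun n => (u n - s) * (v n - t)) 0).
  { intros eps He.
    destruct (Hs 1%R ltac:(lra)) as [A HA]. destruct (Ht eps He) as [B HB].
    exists (max A B). intros n Hn. specialize (HA n ltac:(lia)). specialize (HB n ltac:(lia)).
    replace ((u n - s) * (v n - t) - 0) with ((u n - s) * (v n - t)) by ring. rewrite Cmod_mult.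
    pose proof (Cmod_ge_0 (u n - s)). pose proof (Cmod_ge_0 (v n - t)). nra. }
  replace (s * t) with (0 + (s * t + t * s) - s * t) by ring.
  apply (Clim_ext (fun n => (u n - s) * (v n - t) + (s * v n + t * u n) - s * t)); [intros; ring|].
  apply Clim_minus; [|apply Clim_const]. apply Clim_plus; auto.
  apply Clim_plus; apply Clim_scal; auto.
Qed.

Lemma Clim_shift u s k : Clim u s -> Clim (fun n => u (n + k)%nat) s.
Proof. intros H eps He. destruct (H eps He) as [N HN]. exists N. intros. apply HN. lia. Qed.

(** * Summable weights on the integers and on pairs of integers *)

(** The exponent [3/2] is chosen so that the product [wt m * wt d] is summable over
pairs and still dominates [max (1 + |m|) (1 + |d|) ^ (-3)]. *)
Definition wt (m : Z) : R := (/ ((1 + IZR (Z.abs m)) * sqrt (1 + IZR (Z.abs m))))%R.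

(** The integers of the interval from [- N] to [N - 1]; with this half-open shape the
sum of [F (m + 1) - F m] is [F N - F (- N)]. *)
Definition zlist (N : nat) : list Z :=
  map Z.of_nat (seq 0 N) ++ map (fun k => (- Z.of_nat (S k))%Z) (seq 0 N).

Lemma In_zlist N m : In m (zlist N) <-> (- Z.of_nat N <= m < Z.of_nat N)%Z.
Proof.
  unfold zlist. rewrite in_app_iff, !in_map_iff. split.
  - intros [[k [<- Hk]]|[k [<- Hk]]]; apply in_seq in Hk; lia.
  - intros H. destruct (Z_lt_le_dec m 0).
    + right. exists (Z.to_nat (- m - 1)). rewrite in_seq. lia.
    + left. exists (Z.to_nat m). rewrite in_seq. lia.
Qed.

Lemma NoDup_zlist N : NoDup (zlist N).
Proof.
  unfold zlist. apply NoDup_app.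
  - apply FinFun.Injective_map_NoDup; [|apply seq_NoDup]. intros x y. lia.
  - apply FinFun.Injective_map_NoDup; [|apply seq_NoDup]. intros x y. lia.
  - intros m H1 H2. apply in_map_iff in H1, H2. destruct H1 as [? [? _]], H2 as [? [? _]]. lia.
Qed.

Lemma zlist_covers (L : list Z) : exists N, incl L (zlist N).
Proof.
  induction L as [|m L [N HN]]; [exists O; intros ? []|].
  exists (max N (S (Z.to_nat (Z.abs m)))). intros x [<-|Hx]; apply In_zlist; [lia|].
  apply HN, In_zlist in Hx. lia.
Qed.

Lemma IZR_abs_ge_0 m : 0 <= IZR (Z.abs m).
Proof. apply (IZR_le 0). lia. Qed.

Lemma wt_pos m : 0 < wt m.
Proof.
  unfold wt. pose proof (IZR_abs_ge_0 m). apply Rinv_0_lt_compat, Rmult_lt_0_compat; [lra|].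
  apply sqrt_lt_R0. lra.
Qed.

(** Induction, comparing [(n + 1)^(-3/2)] with the decrease of [2 / sqrt n]. *)
Lemma wt_nat_sum N : (1 <= N)%nat ->
  Rsum (fun k => wt (Z.of_nat k)) (seq 0 N) <= 3 - 2 / sqrt (INR N).
Proof.
  induction N as [|N IH]; [lia|]. intros _.
  destruct N as [|N].
  - simpl. unfold wt. simpl. rewrite !Rplus_0_r, sqrt_1. lra.
  - rewrite seq_S, Rsum_app. specialize (IH ltac:(lia)).
    cbn [Rsum]. rewrite Rplus_0_r. change (0 + S N)%nat with (S N).
    unfold wt at 2. rewrite Z.abs_eq by lia. rewrite <- INR_IZR_INZ.
    rewrite (S_INR (S N)). set (n := INR (S N)) in *.
    assert (Hn : 0 < n) by (apply lt_0_INR; lia).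
    rewrite (Rplus_comm 1 n).
    assert (Ha : 0 < sqrt n) by (apply sqrt_lt_R0; lra).
    assert (Hb : 0 < sqrt (n + 1)) by (apply sqrt_lt_R0; lra).
    assert (Haa : (sqrt n * sqrt n = n)%R) by (apply sqrt_sqrt; lra).
    assert (Hbb : (sqrt (n + 1) * sqrt (n + 1) = n + 1)%R) by (apply sqrt_sqrt; lra).
    assert (Hab : sqrt n <= sqrt (n + 1)) by (apply sqrt_le_1_alt; lra).
    set (a := sqrt n) in *. set (b := sqrt (n + 1)) in *.
    assert (E : (2 / a - 2 / b = 2 / (a * b * (a + b)))%R).
    { assert (H1 : ((b - a) * (a + b) = 1)%R) by nra.
      field_simplify_eq; [|repeat split; nra]. nra. }
    assert (F : / ((n + 1) * b) <= 2 / (a * b * (a + b))).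
    { rewrite <- Hbb. apply (Rmult_le_reg_r ((b * b * b) * (a * b * (a + b)))).
      { repeat apply Rmult_lt_0_compat; lra. }
      field_simplify; [|nra|nra].
      assert (0 <= b * (b * b - a * a)) by (apply Rmult_le_pos; nra).
      assert (0 <= b * b * (b - a)) by (apply Rmult_le_pos; nra).
      assert (0 < b * b) by nra. nra. }
    lra.
Qed.

Lemma Rsum_incl {I} (g : I -> R) (L L' : list I) :
  (forall i, 0 <= g i) -> NoDup L -> incl L L' -> Rsum g L <= Rsum g L'.
Proof.
  intros Hg HN Hi. destruct (NoDup_extract L L' HN Hi) as [R HR].
  rewrite (Rsum_perm g _ _ HR), Rsum_app.
  pose proof (Rsum_pos g R (fun i _ => Hg i)). lra.
Qed.

Lemma wt_zlist N : Rsum wt (zlist N) <= 6.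
Proof.
  assert (H3 : Rsum (fun k => wt (Z.of_nat k)) (seq 0 N) <= 3).
  { destruct N as [|N]; [simpl; lra|].
    pose proof (wt_nat_sum (S N) ltac:(lia)).
    assert (0 < 2 / sqrt (INR (S N))); [|lra].
    apply Rdiv_lt_0_compat; [lra|]. apply sqrt_lt_R0, lt_0_INR. lia. }
  unfold zlist. rewrite Rsum_app, !Rsum_map.
  assert (Rsum (fun k => wt (- Z.of_nat (S k))) (seq 0 N) <=
          Rsum (fun k => wt (Z.of_nat k)) (seq 0 N)); [|lra].
  apply Rsum_le. intros k _. unfold wt.
  assert (H : 1 + IZR (Z.abs (Z.of_nat k)) <= 1 + IZR (Z.abs (- Z.of_nat (S k)))).
  { apply Rplus_le_compat_l, IZR_le. lia. }
  pose proof (IZR_abs_ge_0 (Z.of_nat k)).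
  apply Rinv_le_contravar.
  - apply Rmult_lt_0_compat; [lra|]. apply sqrt_lt_R0. lra.
  - apply Rmult_le_compat; [lra|apply sqrt_pos|exact H|]. apply sqrt_le_1_alt, H.
Qed.

Lemma wt_summable P : sums_below P wt 6.
Proof.
  intros L HL _. destruct (zlist_covers L) as [N HN].
  eapply Rle_trans; [|apply (wt_zlist N)]. apply Rsum_incl; auto.
  intros i. apply Rlt_le, wt_pos.
Qed.

Definition wt2 (p : Z * Z) : R := (wt (fst p) * wt (snd p))%R.

Lemma wt2_summable P : sums_below P wt2 36.
Proof.
  intros L HL _.
  destruct (zlist_covers (map fst L)) as [N HN]. destruct (zlist_covers (map snd L)) as [M HM].
  assert (Rsum wt2 L <= Rsum wt2 (list_prod (zlist N) (zlist M))).
  { apply Rsum_incl; auto.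
    - intros i. unfold wt2. pose proof (wt_pos (fst i)). pose proof (wt_pos (snd i)). nra.
    - intros [m d] Hmd. apply in_prod_iff. split; [apply HN|apply HM].
      + apply (in_map fst) in Hmd. exact Hmd.
      + apply (in_map snd) in Hmd. exact Hmd. }
  rewrite Rsum_prod in H. unfold wt2 in H at 2. simpl in H.
  assert (E : Rsum (fun i => Rsum (fun j => (wt i * wt j)%R) (zlist M)) (zlist N)
     = (Rsum wt (zlist M) * Rsum wt (zlist N))%R).
  { rewrite <- Rsum_scal. clear. induction (zlist N) as [|m l IH]; simpl; [reflexivity|].
    rewrite IH, Rsum_scal. ring. }
  rewrite E in H.
  pose proof (wt_zlist M). pose proof (wt_zlist N).
  assert (0 <= Rsum wt (zlist M)) by (apply Rsum_pos; intros; apply Rlt_le, wt_pos).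
  assert (0 <= Rsum wt (zlist N)) by (apply Rsum_pos; intros; apply Rlt_le, wt_pos).
  nra.
Qed.

Lemma sqrt_le_self D : 1 <= D -> sqrt D <= D.
Proof.
  intros H. rewrite <- (sqrt_Rsqr D) at 2 by lra. apply sqrt_le_1_alt. unfold Rsqr. nra.
Qed.

(** All size estimates take this form, with one constant [K] for a whole family of
translates or lattice points. *)
Definition big1 (K : R) (d : Z) (a : C) : Prop := (1 + IZR (Z.abs d) <= K * Cmod a).

Definition big (K : R) (m d : Z) (a : C) : Prop := big1 K m a /\ big1 K d a.

Lemma big1_nz K d a : big1 K d a -> a <> 0.
Proof.
  intros H E. unfold big1 in H. subst a. rewrite Cmod_0 in H.
  pose proof (IZR_abs_ge_0 d). lra.
Qed.

Lemma big1_mono K K' d a : K <= K' -> big1 K d a -> big1 K' d a.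
Proof. unfold big1. intros HK H. pose proof (Cmod_ge_0 a). nra. Qed.

Lemma big_mono K K' m d a : K <= K' -> big K m d a -> big K' m d a.
Proof. intros HK [H H']. split; eapply big1_mono; eauto. Qed.

Lemma wt_big1 K d a b : big1 K d a -> big1 K d b -> / Cmod a * / Cmod b <= K ^ 2 * wt d.
Proof.
  intros Ha Hb. pose proof (big1_nz _ _ _ Ha) as Na. pose proof (big1_nz _ _ _ Hb) as Nb.
  unfold big1 in *. unfold wt. pose proof (IZR_abs_ge_0 d).
  apply Cmod_gt_0 in Na, Nb.
  set (D := (1 + IZR (Z.abs d))%R) in *. set (A := Cmod a) in *. set (B := Cmod b) in *.
  assert (HD : 1 <= D) by (unfold D; lra).
  assert (HS : 0 < sqrt D) by (apply sqrt_lt_R0; lra).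
  pose proof (sqrt_le_self D HD) as HS2.
  rewrite <- Rinv_mult.
  apply (Rmult_le_reg_r (A * B * (D * sqrt D))); [repeat apply Rmult_lt_0_compat; lra|].
  field_simplify; [|lra|lra].
  assert (D * D <= K * A * (K * B)) by (apply Rmult_le_compat; lra). nra.
Qed.

(** The geometric mean of [1 + |m|] and [1 + |d|] is at most their maximum. *)
Lemma wt_big K m d a b c : big K m d a -> big K m d b -> big K m d c ->
  / Cmod a * / Cmod b * / Cmod c <= K ^ 3 * (wt m * wt d).
Proof.
  intros [Ha Ha'] [Hb Hb'] [Hc Hc'].
  pose proof (big1_nz _ _ _ Ha) as Na. pose proof (big1_nz _ _ _ Hb) as Nb.
  pose proof (big1_nz _ _ _ Hc) as Nc.
  unfold big1 in *. unfold wt. pose proof (IZR_abs_ge_0 d). pose proof (IZR_abs_ge_0 m).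
  apply Cmod_gt_0 in Na, Nb, Nc.
  set (D := (1 + IZR (Z.abs d))%R) in *. set (M := (1 + IZR (Z.abs m))%R) in *.
  set (A := Cmod a) in *. set (B := Cmod b) in *. set (E := Cmod c) in *.
  assert (HD : 1 <= D) by (unfold D; lra). assert (HM : 1 <= M) by (unfold M; lra).
  assert (HS : 0 < sqrt D) by (apply sqrt_lt_R0; lra).
  assert (HT : 0 < sqrt M) by (apply sqrt_lt_R0; lra).
  assert (HK : 0 < K * E) by lra.
  assert (HST : sqrt M * sqrt D <= K * E).
  { rewrite <- sqrt_mult by lra. rewrite <- (sqrt_Rsqr (K * E)) by lra.
    apply sqrt_le_1_alt. unfold Rsqr. apply Rmult_le_compat; lra. }
  rewrite <- !Rinv_mult.
  apply (Rmult_le_reg_r (A * B * E * ((M * sqrt M) * (D * sqrt D)))); [repeat apply Rmult_lt_0_compat; lra|].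
  field_simplify; [|lra|lra].
  assert (M * D <= K * A * (K * B)) by (apply Rmult_le_compat; lra).
  assert (M * D * (sqrt M * sqrt D) <= K * A * (K * B) * (K * E)) by (apply Rmult_le_compat; nra).
  nra.
Qed.

(** * Complex derivatives with quadratic remainder *)

(** Unlike plain differentiability, this passes to sums: quadratic remainders with
summable constants add up to a quadratic remainder. *)
Definition qder (f : C -> C) (z l : C) : Prop :=
  exists K d : R, 0 <= K /\ (0 < d) /\ forall h, Cmod h <= d ->
    (Cmod (f (z + h) - f z - h * l) <= K * Cmod h ^ 2).

Lemma qder_ex_derive f z l : qder f z l -> @ex_derive C_AbsRing C_NormedModule f z.
Proof.
  intros [K [d [HK [Hd H]]]]. exists l. split.
  - apply (is_linear_scal_l (K := C_AbsRing) (V := C_NormedModule)).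
  - intros y Hy eps.
    assert (y = z) as ->.
    { symmetry. apply (is_filter_lim_locally_unique (K:=C_AbsRing) (V:=AbsRing_NormedModule C_AbsRing)). exact Hy. }
    apply (locally_le_locally_norm (K := C_AbsRing) (V := AbsRing_NormedModule C_AbsRing)).
    pose proof (cond_pos eps) as He.
    assert (Hr : 0 < Rmin d (eps / (K + 1))).
    { apply Rmin_glb_lt; [exact Hd|]. apply Rdiv_lt_0_compat; lra. }
    exists (mkposreal _ Hr). intros w Hw. unfold ball_norm in Hw. simpl in Hw.
    change (Cmod (w - z) < Rmin d (eps / (K + 1))) in Hw.
    change (Cmod (f w - f z - (w - z) * l) <= eps * Cmod (w - z)).
    assert (H1 : Cmod (w - z) <= d) by (eapply Rle_trans; [apply Rlt_le, Hw|apply Rmin_l]).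
    specialize (H _ H1). replace (z + (w - z)) with (w : C) in H by (apply injective_projections; simpl; ring).
    eapply Rle_trans; [exact H|]. pose proof (Cmod_ge_0 (w - z)).
    assert (H2 : Cmod (w - z) <= eps / (K + 1)) by (eapply Rle_trans; [apply Rlt_le, Hw|apply Rmin_r]).
    assert (H3 : K * Cmod (w - z) <= eps).
    { apply Rle_trans with ((K + 1) * Cmod (w - z))%R; [nra|].
      apply (Rmult_le_compat_l (K + 1)) in H2; [|lra].
      replace ((K + 1) * (eps / (K + 1)))%R with (pos eps) in H2 by (field; lra). exact H2. }
    nra.
Qed.

Lemma qder_ext f g z l e : 0 < e ->
  (forall h, Cmod h <= e -> f (z + h) = g (z + h)) -> qder f z l -> qder g z l.
Proof.
  intros He E [K [d [HK [Hd H]]]]. exists K, (Rmin d e). split; [exact HK|]. split.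
  - apply Rmin_glb_lt; auto.
  - intros h Hh. rewrite <- E.
    + replace (g z) with (f z). apply H. eapply Rle_trans; [exact Hh|apply Rmin_l].
      replace z with (z + 0) by ring. apply E. rewrite Cmod_0. lra.
    + eapply Rle_trans; [exact Hh|apply Rmin_r].
Qed.

Lemma qder_eq f z l l' : qder f z l -> l = l' -> qder f z l'.
Proof. intros H <-. exact H. Qed.

Lemma qder_const c z : qder (fun _ => c) z 0.
Proof.
  exists 0%R, 1%R. split; [lra|]. split; [lra|]. intros h _.
  replace (c - c - h * 0) with (RtoC 0) by ring. rewrite Cmod_0. lra.
Qed.

Lemma qder_id z : qder (fun z => z) z 1.
Proof.
  exists 0%R, 1%R. split; [lra|]. split; [lra|]. intros h _.
  replace (z + h - z - h * 1) with (RtoC 0) by ring. rewrite Cmod_0. lra.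
Qed.

Lemma qder_plus f g z l m : qder f z l -> qder g z m -> qder (fun z => f z + g z) z (l + m).
Proof.
  intros [K [d [HK [Hd H]]]] [K' [d' [HK' [Hd' H']]]].
  exists (K + K')%R, (Rmin d d'). split; [lra|]. split; [apply Rmin_glb_lt; auto|].
  intros h Hh.
  specialize (H h (Rle_trans _ _ _ Hh (Rmin_l _ _))).
  specialize (H' h (Rle_trans _ _ _ Hh (Rmin_r _ _))).
  replace (f (z + h) + g (z + h) - (f z + g z) - h * (l + m))
    with ((f (z + h) - f z - h * l) + (g (z + h) - g z - h * m)) by ring.
  eapply Rle_trans; [apply Cmod_triangle|]. lra.
Qed.

Lemma qder_cont f z l : qder f z l -> exists K d : R, 0 <= K /\ (0 < d) /\
  forall h, Cmod h <= d -> Cmod (f (z + h) - f z) <= K * Cmod h.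
Proof.
  intros [K [d [HK [Hd H]]]]. exists (K * d + Cmod l)%R, d.
  pose proof (Cmod_ge_0 l). split; [nra|]. split; [exact Hd|].
  intros h Hh. specialize (H h Hh).
  replace (f (z + h) - f z) with ((f (z + h) - f z - h * l) + h * l) by ring.
  eapply Rle_trans; [apply Cmod_triangle|]. rewrite Cmod_mult.
  pose proof (Cmod_ge_0 h).
  assert (K * Cmod h ^ 2 <= K * d * Cmod h).
  { simpl. rewrite Rmult_1_r, <- Rmult_assoc. apply Rmult_le_compat_r; [lra|]. nra. }
  lra.
Qed.

Lemma qder_mult f g z l m :
  qder f z l -> qder g z m -> qder (fun z => f z * g z) z (l * g z + f z * m).
Proof.
  intros Hf Hg. destruct (qder_cont _ _ _ Hf) as [A [a [HA [Ha HA']]]].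
  destruct (qder_cont _ _ _ Hg) as [B [b [HB [Hb HB']]]].
  destruct Hf as [K [d [HK [Hd H]]]]. destruct Hg as [K' [d' [HK' [Hd' H']]]].
  pose proof (Cmod_ge_0 (f z)) as P1. pose proof (Cmod_ge_0 (g z)) as P2.
  exists (K * Cmod (g z) + Cmod (f z) * K' + A * B)%R, (Rmin (Rmin a b) (Rmin d d')).
  split; [|split].
  - apply Rplus_le_le_0_compat; [apply Rplus_le_le_0_compat|]; apply Rmult_le_pos; auto.
  - repeat apply Rmin_glb_lt; auto.
  - intros h Hh.
    pose proof (Rle_trans _ _ _ Hh (Rmin_l _ _)) as Hab.
    pose proof (Rle_trans _ _ _ Hh (Rmin_r _ _)) as Hdd.
    specialize (HA' h (Rle_trans _ _ _ Hab (Rmin_l _ _))).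
    specialize (HB' h (Rle_trans _ _ _ Hab (Rmin_r _ _))).
    specialize (H h (Rle_trans _ _ _ Hdd (Rmin_l _ _))).
    specialize (H' h (Rle_trans _ _ _ Hdd (Rmin_r _ _))).
    replace (f (z + h) * g (z + h) - f z * g z - h * (l * g z + f z * m)) with
      ((f (z + h) - f z - h * l) * g z + f z * (g (z + h) - g z - h * m)
       + (f (z + h) - f z) * (g (z + h) - g z)) by ring.
    eapply Rle_trans; [apply Cmod_triangle|].
    eapply Rle_trans; [apply Rplus_le_compat_r, Cmod_triangle|]. rewrite !Cmod_mult.
    pose proof (Cmod_ge_0 h). pose proof (Cmod_ge_0 (f (z + h) - f z)).
    pose proof (Cmod_ge_0 (g (z + h) - g z)).
    assert (Cmod (f (z + h) - f z) * Cmod (g (z + h) - g z) <= A * Cmod h * (B * Cmod h))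
      by (apply Rmult_le_compat; auto).
    apply (Rmult_le_compat_r _ _ _ P2) in H. apply (Rmult_le_compat_l _ _ _ P1) in H'. lra.
Qed.

Lemma qder_scal c f z l : qder f z l -> qder (fun z => c * f z) z (c * l).
Proof.
  intros H. apply (qder_eq _ _ (0 * f z + c * l)); [|ring].
  apply (qder_mult (fun _ => c) f); [apply qder_const|exact H].
Qed.

Lemma qder_minus f g z l m : qder f z l -> qder g z m -> qder (fun z => f z - g z) z (l - m).
Proof.
  intros H H'. apply (qder_ext (fun z => f z + (-(1)) * g z) _ _ _ 1%R); [lra|intros; ring|].
  apply (qder_eq _ _ (l + (-(1)) * m)); [|ring].
  apply (qder_plus f (fun z => (-(1)) * g z)); [exact H|apply qder_scal, H'].
Qed.

Lemma qder_affine f a b z l : qder f (a * z + b) l -> qder (fun z => f (a * z + b)) z (a * l).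
Proof.
  intros [K [d [HK [Hd H]]]]. pose proof (Cmod_ge_0 a) as Ha.
  exists (K * Cmod a ^ 2)%R, (d / (1 + Cmod a))%R. split; [|split].
  - apply Rmult_le_pos; auto. apply pow_le, Ha.
  - apply Rdiv_lt_0_compat; lra.
  - intros h Hh. assert (H1 : Cmod (a * h) <= d).
    { rewrite Cmod_mult. apply (Rmult_le_compat_l (1 + Cmod a)) in Hh; [|lra].
      replace ((1 + Cmod a) * (d / (1 + Cmod a)))%R with d in Hh by (field; lra).
      pose proof (Cmod_ge_0 h). nra. }
    specialize (H _ H1). rewrite Cmod_mult in H.
    replace (a * (z + h) + b) with (a * z + b + a * h) by ring.
    replace (h * (a * l)) with (a * h * l) by ring.
    eapply Rle_trans; [exact H|]. right. ring.
Qed.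

Lemma qder_dilate f a z l : qder f (a * z) l -> qder (fun z => f (a * z)) z (a * l).
Proof.
  intros H. apply (qder_ext (fun z => f (a * z + 0)) _ _ _ 1%R); [lra| |].
  - intros h _. f_equal. ring.
  - apply qder_affine. rewrite Cplus_0_r. exact H.
Qed.

Lemma qder_translate f b z l : qder f (z + b) l -> qder (fun z => f (z + b)) z l.
Proof.
  intros H. apply (qder_eq _ _ (1 * l)); [|ring].
  apply (qder_ext (fun z => f (1 * z + b)) _ _ _ 1%R); [lra| |].
  - intros h _. f_equal. ring.
  - apply qder_affine. rewrite Cmult_1_l. exact H.
Qed.

Lemma Cinv_0 : / (RtoC 0) = 0.
Proof. unfold Cinv, RtoC. simpl. unfold Rdiv. f_equal; ring. Qed.

Lemma Cmod_inv' z : Cmod (/ z) = (/ Cmod z)%R.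
Proof.
  destruct (excluded_middle_informative (z = 0)) as [->|H]; [|apply Cmod_inv, H].
  rewrite Cinv_0, Cmod_0, Rinv_0. reflexivity.
Qed.

Lemma Cmod_sub_le a b : Cmod a - Cmod b <= Cmod (a + b).
Proof.
  assert (Cmod a <= Cmod (a + b) + Cmod b); [|lra].
  replace a with ((a + b) + -b) at 1 by ring.
  eapply Rle_trans; [apply Cmod_triangle|]. rewrite Cmod_opp. lra.
Qed.

Lemma qder_inv f z l : qder f z l -> f z <> 0 ->
  qder (fun z => / f z) z (- l / (f z * f z)).
Proof.
  intros Hf Hz. destruct (qder_cont _ _ _ Hf) as [A [a [HA [Ha HA']]]].
  destruct Hf as [K [d [HK [Hd H]]]].
  pose proof (proj1 (Cmod_gt_0 _) Hz) as Hp. set (F := Cmod (f z)) in *.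
  pose proof (Cmod_ge_0 l) as Hl.
  exists ((A * (A * 1) * 2 + K * F) / (F * F * F))%R, (Rmin (Rmin a d) (F / (2 * (A + 1)))).
  split; [|split].
  - apply Rdiv_le_0_compat; [|repeat apply Rmult_lt_0_compat; auto].
    assert (0 <= K * F) by (apply Rmult_le_pos; lra). nra.
  - repeat apply Rmin_glb_lt; auto. apply Rdiv_lt_0_compat; lra.
  - intros h Hh.
    pose proof (Rle_trans _ _ _ Hh (Rmin_l _ _)) as Had.
    pose proof (Rle_trans _ _ _ Hh (Rmin_r _ _)) as HF.
    specialize (HA' h (Rle_trans _ _ _ Had (Rmin_l _ _))).
    specialize (H h (Rle_trans _ _ _ Had (Rmin_r _ _))).
    pose proof (Cmod_ge_0 h) as Hh0.
    assert (HG : F / 2 <= Cmod (f (z + h))).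
    { replace (f (z + h)) with (f z + (f (z + h) - f z)) by ring.
      eapply Rle_trans; [|apply Cmod_sub_le].
      assert (A * Cmod h <= F / 2); [|fold F; lra].
      apply (Rmult_le_compat_l (A + 1)) in HF; [|lra].
      replace ((A + 1) * (F / (2 * (A + 1))))%R with (F / 2)%R in HF by (field; lra). nra. }
    assert (Hw : f (z + h) <> 0) by (apply Cmod_gt_0; lra).
    replace (/ f (z + h) - / f z - h * (- l / (f z * f z))) with
      (((f (z + h) - f z) * (f (z + h) - f z) / f (z + h) - (f (z + h) - f z - h * l)) / (f z * f z))
      by (field; auto).
    unfold Cdiv at 1. rewrite Cmod_mult, Cmod_inv', Cmod_mult. fold F.
    assert (B1 : (Cmod ((f (z + h) - f z) * (f (z + h) - f z) / f (z + h) - (f (z + h) - f z - h * l))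
      <= (A * A * 2 / F + K) * Cmod h ^ 2)).
    { unfold Cminus at 1. eapply Rle_trans; [apply Cmod_triangle|]. rewrite Cmod_opp.
      unfold Cdiv. rewrite !Cmod_mult, Cmod_inv'.
      assert (B2 : Cmod (f (z + h) - f z) * Cmod (f (z + h) - f z) <= A * Cmod h * (A * Cmod h))
        by (apply Rmult_le_compat; auto using Cmod_ge_0).
      assert (B3 : / Cmod (f (z + h)) <= / (F / 2)) by (apply Rinv_le_contravar; lra).
      assert (B4 : (Cmod (f (z + h) - f z) * Cmod (f (z + h) - f z) * / Cmod (f (z + h))
         <= A * Cmod h * (A * Cmod h) * / (F / 2))).
      { apply Rmult_le_compat; auto.
        - apply Rmult_le_pos; apply Cmod_ge_0.
        - left. apply Rinv_0_lt_compat. lra. }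
      replace (A * Cmod h * (A * Cmod h) * / (F / 2))%R with (A * A * 2 / F * Cmod h ^ 2)%R in B4 by (field; lra).
      lra. }
    apply (Rmult_le_compat_r (/ (F * F))) in B1; [|left; apply Rinv_0_lt_compat; nra].
    eapply Rle_trans; [exact B1|]. right. field. lra.
Qed.

Definition invpow (k : nat) (w : C) : C := Cpow (/ w) k.

Lemma qder_invpow k (w : C) : w <> 0 -> qder (invpow k) w (- INR k * invpow (S k) w).
Proof.
  intros Hw. induction k as [|k IH].
  - unfold invpow. simpl. eapply qder_eq; [apply qder_const|]. simpl. ring.
  - apply (qder_eq _ _ ((- (1) / (w * w)) * invpow k w + / w * (- INR k * invpow (S k) w))).
    + apply (qder_mult (fun w => / w) (invpow k)); [|exact IH].
      apply (qder_inv (fun w => w)); [apply qder_id|exact Hw].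
    + rewrite S_INR, RtoC_plus. unfold invpow. simpl. field. exact Hw.
Qed.

Lemma qder_pow f z l k : qder f z l ->
  qder (fun z => Cpow (f z) (S k)) z (INR (S k) * (Cpow (f z) k * l)).
Proof.
  intros H. induction k as [|k IH].
  - simpl. apply (qder_ext f _ _ _ 1%R); [lra|intros; ring|]. eapply qder_eq; [exact H|]. ring.
  - apply (qder_eq _ _ (l * Cpow (f z) (S k) + f z * (INR (S k) * (Cpow (f z) k * l)))).
    + apply (qder_mult f (fun z => Cpow (f z) (S k))); auto.
    + rewrite (S_INR (S k)), RtoC_plus. simpl. ring.
Qed.

Lemma qder_unique f z l l' : qder f z l -> qder f z l' -> l = l'.
Proof.
  intros [K [d [HK [Hd H]]]] [K' [d' [HK' [Hd' H']]]].
  destruct (Req_dec (Cmod (l - l')) 0) as [E|E].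
  { apply Cmod_eq_0 in E. replace l with ((l - l') + l') by ring. rewrite E. ring. }
  exfalso. pose proof (Cmod_ge_0 (l - l')) as Hp.
  set (D := Cmod (l - l')) in *.
  (* A real increment so small that two quadratic remainders stay below [t * D]. *)
  set (t := Rmin (Rmin d d') (D / (2 * (K + K' + 1)))).
  assert (Ht : 0 < t).
  { unfold t. repeat apply Rmin_glb_lt; auto. apply Rdiv_lt_0_compat; lra. }
  assert (Hm : Cmod (RtoC t) = t) by (rewrite Cmod_R; apply Rabs_pos_eq; lra).
  specialize (H (RtoC t)). specialize (H' (RtoC t)). rewrite Hm in H, H'.
  specialize (H (Rle_trans _ _ _ (Rmin_l _ _) (Rmin_l _ _))).
  specialize (H' (Rle_trans _ _ _ (Rmin_l _ _) (Rmin_r _ _))).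
  assert (H1 : t * D <= (K + K') * t ^ 2).
  { rewrite <- Hm at 1. unfold D. rewrite <- Cmod_mult.
    replace (t * (l - l')) with (-(f (z + t) - f z - t * l) + (f (z + t) - f z - t * l')) by ring.
    eapply Rle_trans; [apply Cmod_triangle|]. rewrite Cmod_opp. lra. }
  assert (H2 : t <= D / (2 * (K + K' + 1))) by apply Rmin_r.
  apply (Rmult_le_compat_l (2 * (K + K' + 1))) in H2; [|lra].
  replace (2 * (K + K' + 1) * (D / (2 * (K + K' + 1))))%R with D in H2 by (field; lra).
  assert (D <= (K + K') * t); nra.
Qed.

(** * The exponential *)

Lemma Cexp_plus a b : Cexp (a + b) = Cexp a * Cexp b.
Proof.
  destruct a as [a1 a2], b as [b1 b2]. unfold Cexp, Cmult, Cplus, Re, Im; simpl.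
  rewrite exp_plus, cos_plus, sin_plus. f_equal; ring.
Qed.

Lemma Cexp_0 : Cexp 0 = 1.
Proof. unfold Cexp, RtoC, Re, Im; simpl. rewrite exp_0, cos_0, sin_0. f_equal; ring. Qed.

Lemma Cmod_Cexp z : Cmod (Cexp z) = exp (Re z).
Proof.
  unfold Cexp, Cmod. simpl.
  replace (exp (Re z) * cos (Im z) * (exp (Re z) * cos (Im z) * 1) +
    exp (Re z) * sin (Im z) * (exp (Re z) * sin (Im z) * 1))%R
    with (Rsqr (exp (Re z)) * (Rsqr (sin (Im z)) + Rsqr (cos (Im z))))%R by (unfold Rsqr; ring).
  rewrite sin2_cos2, Rmult_1_r. apply sqrt_Rsqr. left. apply exp_pos.
Qed.

Lemma Cexp_nz z : Cexp z <> 0.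
Proof. apply Cmod_gt_0. rewrite Cmod_Cexp. apply exp_pos. Qed.

Lemma Cexp_nat z m : Cexp (INR m * z) = Cpow (Cexp z) m.
Proof.
  induction m as [|m IH].
  - simpl. rewrite Cmult_0_l. apply Cexp_0.
  - rewrite S_INR, RtoC_plus. simpl Cpow. rewrite <- IH, <- Cexp_plus. f_equal. ring.
Qed.

Lemma Rabs_sin_le b : Rabs (sin b) <= Rabs b.
Proof.
  assert (P : forall b, 0 <= b -> Rabs (sin b) <= b).
  { clear. intros b Hb. destruct (Req_dec b 0) as [->|E]; [rewrite sin_0, Rabs_R0; lra|].
    destruct (Rle_lt_dec b 1) as [L|L].
    - rewrite Rabs_pos_eq; [left; apply sin_lt_x; lra|]. apply sin_ge_0; [lra|].
      pose proof PI2_1. pose proof PI2_Rlt_PI. lra.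
    - apply Rle_trans with 1%R; [|lra]. apply Rabs_le. pose proof (SIN_bound b). lra. }
  destruct (Rle_lt_dec 0 b) as [H|H].
  - rewrite (Rabs_pos_eq b) by lra. auto.
  - rewrite <- (Rabs_Ropp b), (Rabs_pos_eq (- b)) by lra.
    rewrite <- Rabs_Ropp, <- sin_neg. apply P. lra.
Qed.

Lemma Rabs_cos_le b : Rabs (cos b - 1) <= b ^ 2.
Proof.
  replace (cos b) with (cos (2 * (b / 2))) by (f_equal; lra). rewrite cos_2a_sin.
  replace (1 - 2 * sin (b / 2) * sin (b / 2) - 1)%R with (- (2 * (sin (b / 2) * sin (b / 2))))%R by ring.
  rewrite Rabs_Ropp, !Rabs_mult, (Rabs_pos_eq 2) by lra.
  pose proof (Rabs_sin_le (b / 2)). pose proof (Rabs_pos (sin (b / 2))).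
  assert (Rabs (sin (b / 2)) * Rabs (sin (b / 2)) <= Rabs (b / 2) * Rabs (b / 2)) by (apply Rmult_le_compat; auto).
  rewrite <- (Rabs_mult (b / 2)), (Rabs_pos_eq (b / 2 * (b / 2))) in H1 by nra. nra.
Qed.

Lemma Rabs_sin_le2 b : Rabs b <= 1 -> Rabs (sin b - b) <= b ^ 2.
Proof.
  assert (P : forall b, 0 <= b <= 1 -> Rabs (sin b - b) <= b ^ 2).
  { clear. intros b Hb. destruct (Req_dec b 0) as [->|E].
    { rewrite sin_0. replace (0 - 0)%R with 0%R by ring. rewrite Rabs_R0. lra. }
    destruct (MVT_cor2 (fun x => sin x - x)%R (fun x => cos x - 1)%R 0 b) as [c [Hc Hc']]; [lra| |].
    { intros c _. apply derivable_pt_lim_minus; [apply derivable_pt_lim_sin|apply derivable_pt_lim_id]. }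
    rewrite sin_0 in Hc. replace (sin b - b)%R with ((cos c - 1) * (b - 0))%R by lra.
    rewrite Rabs_mult. pose proof (Rabs_cos_le c).
    rewrite (Rabs_pos_eq (b - 0)) by lra.
    apply Rle_trans with (c ^ 2 * b)%R; [|nra]. rewrite Rminus_0_r. apply Rmult_le_compat_r; lra. }
  intros H. destruct (Rle_lt_dec 0 b) as [L|L].
  - apply P. rewrite Rabs_pos_eq in H; lra.
  - rewrite Rabs_left in H by lra. replace (b ^ 2)%R with ((- b) ^ 2)%R by ring.
    replace (sin b - b)%R with (- (sin (- b) - - b))%R by (rewrite sin_neg; ring).
    rewrite Rabs_Ropp. apply P. lra.
Qed.

Lemma exp_le2 a : Rabs a <= 1 / 2 -> 0 <= exp a - 1 - a <= 2 * a ^ 2.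
Proof.
  intros H. apply Rabs_le_between in H. pose proof (exp_ineq1_le a). pose proof (exp_ineq1_le (- a)) as H1.
  split; [lra|]. rewrite exp_Ropp in H1. pose proof (exp_pos a) as Hp.
  apply (Rmult_le_compat_r (exp a)) in H1; [|lra]. rewrite Rinv_l in H1 by lra.
  assert (exp a <= 1 + a + 2 * a ^ 2); [|lra].
  apply (Rmult_le_reg_r (1 + - a)); [lra|].
  assert (0 <= a ^ 2 * (1 - 2 * a)) by (apply Rmult_le_pos; nra). nra.
Qed.

Lemma Cmod_le_abs z : Cmod z <= Rabs (Re z) + Rabs (Im z).
Proof.
  destruct z as [a b]. unfold Re, Im; simpl fst; simpl snd.
  replace (a, b) with (RtoC a + RtoC b * Ci).
  - eapply Rle_trans; [apply Cmod_triangle|]. rewrite Cmod_mult, !Cmod_R, Cmod_Ci. lra.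
  - unfold RtoC, Ci, Cplus, Cmult; simpl. f_equal; ring.
Qed.

Lemma im_le_Cmod z : Rabs (Im z) <= Cmod z.
Proof. pose proof (Rmax_Cmod z). pose proof (Rmax_r (Rabs (fst z)) (Rabs (snd z))). unfold Im. lra. Qed.

Lemma Cexp_second_order h : Cmod h <= 1 / 2 -> Cmod (Cexp h - 1 - h) <= 10 * Cmod h ^ 2.
Proof.
  intros H. pose proof (re_le_Cmod h) as HR. pose proof (im_le_Cmod h) as HI.
  pose proof (Cmod2_alt h) as E.
  eapply Rle_trans; [apply Cmod_le_abs|].
  destruct h as [a b]. unfold Cexp, Re, Im in *. simpl fst in *. simpl snd in *.
  destruct (exp_le2 a) as [E1 E2]; [lra|]. pose proof (Rabs_cos_le b) as Cb.
  pose proof (Rabs_sin_le b) as Sb. pose proof (Rabs_sin_le2 b ltac:(lra)) as Sb2.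
  rewrite E. replace ((1 - 1)%R) with 0%R by ring.
  replace (exp a * cos b + - (1) + - a)%R with ((exp a - 1 - a) * cos b + (1 + a) * (cos b - 1))%R by ring.
  replace (exp a * sin b + - 0 + - b)%R with ((exp a - 1 - a) * sin b + a * sin b + (sin b - b))%R by ring.
  pose proof (Rabs_pos a). pose proof (Rabs_pos b).
  assert (Aa : (Rabs a * Rabs a = a ^ 2)%R) by (rewrite <- Rabs_mult, Rabs_pos_eq; nra).
  assert (Bb : (Rabs b * Rabs b = b ^ 2)%R) by (rewrite <- Rabs_mult, Rabs_pos_eq; nra).
  assert (T1 : Rabs ((exp a - 1 - a) * cos b) <= 2 * a ^ 2).
  { rewrite Rabs_mult, (Rabs_pos_eq (exp a - 1 - a)) by lra.
    assert (Rabs (cos b) <= 1) by (apply Rabs_le; pose proof (COS_bound b); lra).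
    pose proof (Rabs_pos (cos b)). nra. }
  assert (T2 : Rabs ((1 + a) * (cos b - 1)) <= 2 * b ^ 2).
  { rewrite Rabs_mult. apply Rmult_le_compat; auto using Rabs_pos.
    eapply Rle_trans; [apply Rabs_triang|]. rewrite Rabs_R1. lra. }
  assert (T3 : Rabs ((exp a - 1 - a) * sin b) <= 2 * a ^ 2).
  { rewrite Rabs_mult, (Rabs_pos_eq (exp a - 1 - a)) by lra.
    pose proof (Rabs_pos (sin b)). nra. }
  assert (T4 : Rabs (a * sin b) <= a ^ 2 + b ^ 2).
  { rewrite Rabs_mult. pose proof (Rabs_pos (sin b)).
    apply Rle_trans with (Rabs a * Rabs b)%R; [apply Rmult_le_compat_l; lra|]. nra. }
  eapply Rle_trans; [apply Rplus_le_compat; [apply Rabs_triang|eapply Rle_trans;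
    [apply Rabs_triang|apply Rplus_le_compat_r, Rabs_triang]]|]. nra.
Qed.

Lemma qder_Cexp z : qder Cexp z (Cexp z).
Proof.
  exists (10 * Cmod (Cexp z))%R, (1 / 2)%R. pose proof (Cmod_ge_0 (Cexp z)).
  split; [lra|]. split; [lra|]. intros h Hh. rewrite Cexp_plus.
  replace (Cexp z * Cexp h - Cexp z - h * Cexp z) with (Cexp z * (Cexp h - 1 - h)) by ring.
  rewrite Cmod_mult. pose proof (Cexp_second_order h Hh). nra.
Qed.

(** * Mean value inequality and termwise differentiation *)

Lemma qder_line (f : C -> C) z h l v t : qder f (z + RtoC t * h) l ->
  derivable_pt_lim (fun t => Re (v * f (z + RtoC t * h))) t (Re (v * (h * l))).
Proof.
  intros [K [d [HK [Hd H]]]] eps He.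
  pose proof (Cmod_ge_0 h) as Hh. pose proof (Cmod_ge_0 v) as Hv.
  set (M := (Cmod v * (K * Cmod h ^ 2) + 1)%R).
  assert (HM : 0 < M).
  { assert (0 <= Cmod v * (K * Cmod h ^ 2)); [|unfold M; lra].
    apply Rmult_le_pos; auto. apply Rmult_le_pos; auto. apply pow_le; auto. }
  assert (Hr : 0 < Rmin (d / (1 + Cmod h)) (eps / M)).
  { apply Rmin_glb_lt; apply Rdiv_lt_0_compat; lra. }
  exists (mkposreal _ Hr). intros s Hs Hsr. simpl in Hsr.
  pose proof (Rlt_le_trans _ _ _ Hsr (Rmin_l _ _)) as Hs1.
  pose proof (Rlt_le_trans _ _ _ Hsr (Rmin_r _ _)) as Hs2.
  assert (Hsp : 0 < Rabs s) by (apply Rabs_pos_lt; auto).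
  assert (H1 : Cmod (RtoC s * h) <= d).
  { rewrite Cmod_mult, Cmod_R.
    apply (Rmult_lt_compat_r (1 + Cmod h)) in Hs1; [|lra].
    replace (d / (1 + Cmod h) * (1 + Cmod h))%R with d in Hs1 by (field; lra). nra. }
  specialize (H _ H1). rewrite Cmod_mult, Cmod_R in H.
  assert (E : Rminus (Rdiv (Rminus (Re (v * f (z + RtoC (t + s) * h))) (Re (v * f (z + RtoC t * h)))) s) (Re (v * (h * l)))
    = Rdiv (Re (v * (f (z + RtoC t * h + RtoC s * h) - f (z + RtoC t * h) - RtoC s * h * l))) s).
  { replace (z + RtoC (t + s) * h) with (z + RtoC t * h + RtoC s * h) by (rewrite RtoC_plus; ring).
    generalize (f (z + RtoC t * h + RtoC s * h)). generalize (f (z + RtoC t * h)). intros [p1 p2] [q1 q2].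
    destruct v as [v1 v2], l as [l1 l2], h as [h1 h2]. unfold Re. simpl. field. exact Hs. }
  rewrite E. clear E. unfold Rdiv. rewrite Rabs_mult, Rabs_inv.
  apply (Rmult_lt_reg_r (Rabs s)); [exact Hsp|].
  rewrite Rmult_assoc, Rinv_l, Rmult_1_r by lra.
  eapply Rle_lt_trans; [apply re_le_Cmod|]. rewrite Cmod_mult.
  apply (Rmult_le_compat_l _ _ _ Hv) in H. eapply Rle_lt_trans; [exact H|].
  assert (Hs3 : Rabs s * M < eps).
  { apply (Rmult_lt_compat_r M) in Hs2; [|lra].
    replace (eps / M * M)%R with eps in Hs2 by (field; lra). exact Hs2. }
  apply Rle_lt_trans with ((Cmod v * (K * Cmod h ^ 2)) * Rabs s * Rabs s)%R; [right; ring|].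
  apply Rmult_lt_compat_r; [exact Hsp|]. unfold M in Hs3. lra.
Qed.

(** The real mean value theorem, applied to the component of [f] in the direction of
its total increment. *)
Lemma mean_value (f f1 : C -> C) z h K :
  (forall t, 0 <= t <= 1 -> qder f (z + RtoC t * h) (f1 (z + RtoC t * h))) ->
  (forall t, 0 <= t <= 1 -> Cmod (f1 (z + RtoC t * h)) <= K) ->
  Cmod (f (z + h) - f z) <= K * Cmod h.
Proof.
  intros Hf HK. set (v := f (z + h) - f z).
  destruct (MVT_cor2 (fun t => Re (Cconj v * f (z + RtoC t * h)))
    (fun t => Re (Cconj v * (h * f1 (z + RtoC t * h)))) 0 1) as [c [Hc Hc']]; [lra| |].
  { intros c Hc. apply qder_line. auto. }
  rewrite Rminus_0_r, Rmult_1_r in Hc.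
  replace (z + 1 * h) with (z + h) in Hc by ring. replace (z + 0 * h) with z in Hc by ring.
  assert (E : Rminus (Re (Cconj v * f (z + h))) (Re (Cconj v * f z)) = (Cmod v ^ 2)%R).
  { rewrite Cmod2_alt. unfold v. destruct (f (z + h)) as [p q], (f z) as [r s]. unfold Re, Im. simpl. ring. }
  rewrite E in Hc.
  assert (H1 : Re (Cconj v * (h * f1 (z + RtoC c * h))) <= Cmod v * (Cmod h * K)).
  { eapply Rle_trans; [apply Rle_abs|]. eapply Rle_trans; [apply re_le_Cmod|].
    rewrite !Cmod_mult, Cmod_conj. apply Rmult_le_compat_l; [apply Cmod_ge_0|].
    apply Rmult_le_compat_l; [apply Cmod_ge_0|]. apply HK. lra. }
  rewrite <- Hc in H1.
  assert (0 <= K) by (eapply Rle_trans; [apply Cmod_ge_0|apply (HK 0%R); lra]).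
  pose proof (Cmod_ge_0 v). pose proof (Cmod_ge_0 h).
  destruct (Req_dec (Cmod v) 0) as [->|N]; [nra|].
  apply (Rmult_le_reg_l (Cmod v)); [lra|]. simpl in H1. lra.
Qed.

Lemma zero_derivative (f : C -> C) z h :
  (forall t, 0 <= t <= 1 -> qder f (z + RtoC t * h) 0) -> f (z + h) = f z.
Proof.
  intros H. pose proof (mean_value f (fun _ => 0) z h 0 H) as M.
  assert (E : Cmod (f (z + h) - f z) = 0%R).
  { apply Rle_antisym; [|apply Cmod_ge_0].
    replace 0%R with (0 * Cmod h)%R by ring. apply M. intros. rewrite Cmod_0. lra. }
  apply Cmod_eq_0 in E. replace (f (z + h)) with (f (z + h) - f z + f z) by ring. rewrite E. ring.
Qed.

(** The mean value inequality for [w |-> f w - f1 z * w]. *)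
Lemma taylor2 (f f1 f2 : C -> C) z h K :
  (forall t, 0 <= t <= 1 -> qder f (z + RtoC t * h) (f1 (z + RtoC t * h))) ->
  (forall t, 0 <= t <= 1 -> qder f1 (z + RtoC t * h) (f2 (z + RtoC t * h))) ->
  (forall t, 0 <= t <= 1 -> Cmod (f2 (z + RtoC t * h)) <= K) ->
  Cmod (f (z + h) - f z - h * f1 z) <= K * Cmod h ^ 2.
Proof.
  intros H1 H2 HK.
  assert (0 <= K) by (eapply Rle_trans; [apply Cmod_ge_0|apply (HK 0%R); lra]).
  pose proof (Cmod_ge_0 h).
  replace (f (z + h) - f z - h * f1 z) with ((fun w => f w - f1 z * w) (z + h) - (fun w => f w - f1 z * w) z) by (simpl; ring).
  apply Rle_trans with ((K * Cmod h) * Cmod h)%R; [|right; ring].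
  apply (mean_value (fun w => f w - f1 z * w) (fun w => f1 w - f1 z * 1)).
  - intros t Ht. apply qder_minus; [auto|]. apply qder_scal, qder_id.
  - intros t Ht. replace (f1 z * 1) with (f1 z) by ring.
    eapply Rle_trans; [apply (mean_value f1 f2 z (RtoC t * h) K)|].
    + intros s Hs. replace (RtoC s * (RtoC t * h)) with (RtoC (s * t) * h) by (rewrite RtoC_mult; ring).
      apply H2. nra.
    + intros s Hs. replace (RtoC s * (RtoC t * h)) with (RtoC (s * t) * h) by (rewrite RtoC_mult; ring).
      apply HK. nra.
    + apply Rmult_le_compat_l; [auto|]. rewrite Cmod_mult, Cmod_R, Rabs_pos_eq by lra. nra.
Qed.

(** Bounding the second derivatives on a disc by a summable family controls all the
quadratic remainders at once. *)
Lemma qder_sum {I} (P : I -> Prop) (f f1 f2 : I -> C -> C) (g : I -> R) (B d : R) z F F1 :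
  0 < d -> sums_below P g B -> 0 <= B ->
  (forall h, Cmod h <= d -> has_sum P (fun i => f i (z + h)) (F (z + h))) ->
  has_sum P (fun i => f1 i z) F1 ->
  (forall i h, P i -> Cmod h <= d -> qder (f i) (z + h) (f1 i (z + h)) /\ qder (f1 i) (z + h) (f2 i (z + h)) /\ Cmod (f2 i (z + h)) <= g i) ->
  qder F z F1.
Proof.
  intros Hd HB HB0 HF HF1 H. exists B, d. split; [exact HB0|]. split; [exact Hd|]. intros h Hh.
  assert (S0 : has_sum P (fun i => f i z) (F z)).
  { assert (H0 : Cmod 0 <= d) by (rewrite Cmod_0; lra).
    specialize (HF _ H0). replace (z + 0) with z in HF by ring. exact HF. }
  pose proof (has_sum_minus _ _ _ _ _ (has_sum_minus _ _ _ _ _ (HF h Hh) S0) (has_sum_scal _ h _ _ HF1)) as S.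
  rewrite Rmult_comm. apply (has_sum_bound _ _ _ _ S).
  apply (sums_below_le _ _ (fun i => (Cmod h ^ 2 * g i)%R)).
  - intros i Hi. rewrite Rmult_comm.
    assert (Ht : forall t, 0 <= t <= 1 -> Cmod (RtoC t * h) <= d).
    { intros t Ht. rewrite Cmod_mult, Cmod_R, Rabs_pos_eq by lra. pose proof (Cmod_ge_0 h). nra. }
    apply (taylor2 (f i) (f1 i) (f2 i)); intros t Ht'; apply H; auto.
  - apply sums_below_scal; [|exact HB]. apply pow_le, Cmod_ge_0.
Qed.

(** * The row sums of inverse powers *)

Definition Sum {I} (P : I -> Prop) (f : I -> C) : C := epsilon (inhabits (RtoC 0)) (has_sum P f).

Lemma Sum_spec {I} (P : I -> Prop) f : (exists s, has_sum P f s) -> has_sum P f (Sum P f).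
Proof. apply epsilon_spec. Qed.

Lemma Sum_eq {I} (P : I -> Prop) f s : has_sum P f s -> Sum P f = s.
Proof. intros H. apply (has_sum_unique P f); [|exact H]. apply Sum_spec. eauto. Qed.

Definition allZ : Z -> Prop := fun _ => True.

(** Since [/ 0 = 0], the term with [z + d = 0], if there is one, drops out for [k > 0]. *)
Definition rowsum (k : nat) (z : C) : C := Sum allZ (fun d => invpow k (z + IZR d)).

Lemma invpow_0 k : invpow (S k) 0 = 0.
Proof. unfold invpow. simpl. rewrite Cinv_0. ring. Qed.

Lemma Cmod_invpow k w : Cmod (invpow k w) = ((/ Cmod w) ^ k)%R.
Proof. unfold invpow. rewrite Cmod_pow, Cmod_inv'. reflexivity. Qed.

Lemma big1_K K d w : big1 K d w -> 0 <= / Cmod w <= K /\ 0 < K.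
Proof.
  intros H. pose proof (big1_nz _ _ _ H) as N. apply Cmod_gt_0 in N.
  unfold big1 in H. pose proof (IZR_abs_ge_0 d).
  assert (HK : 0 < K) by (destruct (Rle_lt_dec K 0); [nra|auto]).
  split; [|exact HK]. split; [left; apply Rinv_0_lt_compat, N|].
  apply (Rmult_le_reg_r (Cmod w)); [exact N|]. rewrite Rinv_l by lra. lra.
Qed.

Lemma invpow_big1 k K d w : big1 K d w -> Cmod (invpow (2 + k) w) <= K ^ (2 + k) * wt d.
Proof.
  intros H. pose proof (wt_big1 K d w w H H) as W. destruct (big1_K _ _ _ H) as [B HK].
  rewrite Cmod_invpow, !pow_add.
  assert ((/ Cmod w) ^ k <= K ^ k) by (apply pow_incr; lra).
  assert (0 <= (/ Cmod w) ^ k) by (apply pow_le; lra).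
  apply Rle_trans with ((K ^ 2 * wt d) * K ^ k)%R; [|right; ring].
  apply Rmult_le_compat; auto. apply pow_le; lra. simpl. lra.
Qed.

Lemma invpow_big k K m d w : big K m d w -> Cmod (invpow (3 + k) w) <= K ^ (3 + k) * wt2 (m, d).
Proof.
  intros H. pose proof (wt_big K m d w w w H H H) as W. destruct (big1_K _ _ _ (proj1 H)) as [B HK].
  rewrite Cmod_invpow, !pow_add. unfold wt2. simpl fst. simpl snd.
  assert ((/ Cmod w) ^ k <= K ^ k) by (apply pow_incr; lra).
  assert (0 <= (/ Cmod w) ^ k) by (apply pow_le; lra).
  apply Rle_trans with ((K ^ 3 * (wt m * wt d)) * K ^ k)%R; [|right; ring].
  apply Rmult_le_compat; auto. apply pow_le; lra. simpl. lra.
Qed.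

Lemma le_scaled a e w : 0 < e -> e <= w -> 0 <= a -> a <= a / e * w.
Proof.
  intros He Hw Ha. unfold Rdiv. rewrite Rmult_assoc. rewrite <- (Rmult_1_r a) at 1.
  apply Rmult_le_compat_l; [lra|]. apply (Rmult_le_reg_l e); [lra|].
  rewrite <- Rmult_assoc, Rinv_r by lra. lra.
Qed.

Lemma big1_off_axis y0 X w d : 0 < y0 -> y0 <= Rabs (Im w) -> Rabs (Re w) <= X ->
  big1 (1 + (1 + X) / y0) d (w + IZR d).
Proof.
  intros H0 Hy HX. unfold big1.
  assert (H1 : y0 <= Cmod (w + IZR d)).
  { eapply Rle_trans; [exact Hy|]. pose proof (im_le_Cmod (w + IZR d)).
    replace (Im (w + IZR d)) with (Im w) in H by (destruct w; simpl; ring). exact H. }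
  assert (H2 : IZR (Z.abs d) <= Cmod (w + IZR d) + X).
  { rewrite abs_IZR. pose proof (re_le_Cmod (w + IZR d)).
    replace (Re (w + IZR d)) with (Re w + IZR d)%R in H by (destruct w; simpl; ring).
    replace (IZR d) with ((Re w + IZR d) - Re w)%R at 1 by ring.
    eapply Rle_trans; [apply Rabs_triang|]. rewrite Rabs_Ropp. lra. }
  pose proof (Rabs_pos (Re w)).
  pose proof (le_scaled (1 + X) y0 _ H0 H1 ltac:(lra)).
  lra.
Qed.

Lemma big1_int d : d <> 0%Z -> big1 2 d (0 + IZR d).
Proof.
  intros H. unfold big1. rewrite Cplus_0_l, Cmod_R, <- abs_IZR.
  assert (1 <= IZR (Z.abs d)) by (apply (IZR_le 1); lia). lra.
Qed.

Lemma rowsum_has_sum_gen k z K : 0 < K -> (forall d, z + IZR d <> 0 -> big1 K d (z + IZR d)) ->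
  has_sum allZ (fun d => invpow (2 + k) (z + IZR d)) (rowsum (2 + k) z).
Proof.
  intros HK H. apply Sum_spec. apply summable_has_sum with (B := (K ^ (2 + k) * 6)%R).
  apply (sums_below_le _ _ (fun d => K ^ (2 + k) * wt d)%R).
  - intros d _. destruct (excluded_middle_informative (z + IZR d = 0)) as [E|E].
    + change (2 + k)%nat with (S (S k)). rewrite E, invpow_0, Cmod_0. pose proof (wt_pos d). apply Rmult_le_pos; [|lra].
      apply pow_le; lra.
    + apply invpow_big1, H, E.
  - apply sums_below_scal; [apply pow_le; lra|]. apply wt_summable.
Qed.

Lemma rowsum_has_sum k z : Im z <> 0%R -> has_sum allZ (fun d => invpow (2 + k) (z + IZR d)) (rowsum (2 + k) z).
Proof.
  intros H. apply Rabs_pos_lt in H. pose proof (Rabs_pos (Re z)).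
  apply rowsum_has_sum_gen with (K := (1 + (1 + Rabs (Re z)) / Rabs (Im z))%R).
  - assert (0 <= (1 + Rabs (Re z)) / Rabs (Im z)); [|lra]. apply Rdiv_le_0_compat; lra.
  - intros d _. apply big1_off_axis; auto; lra.
Qed.

Lemma rowsum_has_sum_0 k : has_sum allZ (fun d => invpow (2 + k) (0 + IZR d)) (rowsum (2 + k) 0).
Proof.
  apply rowsum_has_sum_gen with (K := 2%R); [lra|]. intros d H. apply big1_int.
  intros ->. apply H. apply injective_projections; simpl; ring.
Qed.

Lemma has_sum_Zshift f c t : has_sum allZ (fun d => f (d + c)%Z) t <-> has_sum allZ f t.
Proof.
  apply (has_sum_reindex allZ allZ (fun d => (d + c)%Z)); unfold allZ; auto.
  - intros; lia.
  - intros j _. exists (j - c)%Z. split; [auto|lia].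
Qed.

Lemma has_sum_Zopp f t : has_sum allZ (fun d => f (- d)%Z) t <-> has_sum allZ f t.
Proof.
  apply (has_sum_reindex allZ allZ (fun d => (- d)%Z)); unfold allZ; auto.
  - intros; lia.
  - intros j _. exists (- j)%Z. split; [auto|lia].
Qed.

Lemma rowsum_periodic k z c : Im z <> 0%R -> rowsum (2 + k) (z + IZR c) = rowsum (2 + k) z.
Proof.
  intros H. apply Sum_eq.
  apply (has_sum_ext _ (fun d => (fun d => invpow (2 + k) (z + IZR d)) (d + c)%Z)).
  - intros d _. cbv beta. rewrite plus_IZR, RtoC_plus. f_equal. ring.
  - apply (has_sum_Zshift (fun d => invpow (2 + k) (z + IZR d))). apply rowsum_has_sum, H.
Qed.

Lemma Cinv_opp z : / (- z) = - / z.
Proof.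
  destruct (excluded_middle_informative (z = 0)) as [->|H].
  - replace (- 0) with (RtoC 0) by ring. rewrite Cinv_0. ring.
  - field. exact H.
Qed.

Lemma invpow_even i w : invpow (2 * i) (- w) = invpow (2 * i) w.
Proof.
  unfold invpow. rewrite Cinv_opp, !Cpow_mult_r. f_equal. simpl. ring.
Qed.

Lemma rowsum_even i z : Im z <> 0%R -> rowsum (2 * S i) (- z) = rowsum (2 * S i) z.
Proof.
  intros H. replace (2 * S i)%nat with (2 + 2 * i)%nat by lia. apply Sum_eq.
  apply (has_sum_ext _ (fun d => (fun d => invpow (2 + 2 * i) (z + IZR d)) (- d)%Z)).
  - intros d _. cbv beta. replace (2 + 2 * i)%nat with (2 * S i)%nat by lia.
    rewrite <- invpow_even. f_equal. rewrite opp_IZR, RtoC_opp. ring.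
  - apply (has_sum_Zopp (fun d => invpow (2 + 2 * i) (z + IZR d))). apply rowsum_has_sum, H.
Qed.

Lemma Re_plus z h : Re (z + h) = (Re z + Re h)%R. Proof. reflexivity. Qed.

Lemma Im_half z : Im (z / 2) = (Im z / 2)%R.
Proof. destruct z; unfold Im; simpl. field. Qed.

Lemma Im_plus z h : Im (z + h) = (Im z + Im h)%R. Proof. reflexivity. Qed.

Lemma ball_upper z h : 0 < Im z -> Cmod h <= Im z / 2 ->
  Im z / 2 <= Im (z + h) /\ Rabs (Re (z + h)) <= Rabs (Re z) + Im z.
Proof.
  intros Hz Hh. pose proof (re_le_Cmod h). pose proof (im_le_Cmod h) as Hi.
  apply Rabs_le_between in Hi. rewrite Re_plus, Im_plus. split; [lra|].
  eapply Rle_trans; [apply Rabs_triang|]. lra.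
Qed.

Lemma Cmod_RtoC_nonneg r : 0 <= r -> Cmod (RtoC r) = r.
Proof. intros. rewrite Cmod_R. apply Rabs_pos_eq. auto. Qed.

Lemma ball_big1 z : 0 < Im z -> exists K, 0 <= K /\
  forall h d, Cmod h <= Im z / 2 -> big1 K d (z + h + IZR d).
Proof.
  intros Hz. exists (1 + (1 + (Rabs (Re z) + Im z)) / (Im z / 2))%R. split.
  - pose proof (Rabs_pos (Re z)).
    assert (0 <= (1 + (Rabs (Re z) + Im z)) / (Im z / 2)); [|lra]. apply Rdiv_le_0_compat; lra.
  - intros h d Hh. destruct (ball_upper z h Hz Hh) as [H1 H2].
    apply big1_off_axis; auto; try lra. rewrite Rabs_pos_eq; lra.
Qed.

Lemma qder_invpow_translate j b w : w + b <> 0 ->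
  qder (fun w => invpow j (w + b)) w (- INR j * invpow (S j) (w + b)).
Proof. intros N. apply qder_translate, qder_invpow, N. Qed.

Lemma qder_rowsum k z : 0 < Im z -> qder (rowsum (2 + k)) z (- INR (2 + k) * rowsum (3 + k) z).
Proof.
  intros Hz. destruct (ball_big1 z Hz) as [K [HK0 HK]].
  set (c := (INR (2 + k) * INR (3 + k))%R).
  assert (Hc : 0 <= c) by (apply Rmult_le_pos; apply pos_INR).
  assert (HKc : 0 <= c * K ^ (4 + k)) by (apply Rmult_le_pos; auto; apply pow_le; auto).
  apply (qder_sum allZ (fun d w => invpow (2 + k) (w + IZR d)) (fun d w => - INR (2 + k) * invpow (3 + k) (w + IZR d))
    (fun d w => - INR (2 + k) * (- INR (3 + k) * invpow (4 + k) (w + IZR d)))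
    (fun d => c * K ^ (4 + k) * wt d)%R (c * K ^ (4 + k) * 6) (Im z / 2)).
  - lra.
  - apply sums_below_scal; [exact HKc|apply wt_summable].
  - lra.
  - intros h Hh. apply rowsum_has_sum. pose proof (ball_upper z h Hz Hh). lra.
  - apply has_sum_scal. apply (rowsum_has_sum (S k)). lra.
  - intros d h _ Hh. specialize (HK h d Hh). pose proof (big1_nz _ _ _ HK) as N.
    split; [apply qder_invpow_translate, N|]. split; [apply qder_scal, qder_invpow_translate, N|].
    pose proof (invpow_big1 (2 + k) K d _ HK) as W.
    rewrite !Cmod_mult, !Cmod_opp, (Cmod_RtoC_nonneg (INR (2 + k))), (Cmod_RtoC_nonneg (INR (3 + k))) by apply pos_INR.
    apply Rle_trans with (c * Cmod (invpow (4 + k) (z + h + IZR d)))%R; [right; unfold c; ring|].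
    rewrite Rmult_assoc. apply Rmult_le_compat_l; auto.
Qed.

(** * The nome *)

Definition two_pi_i : C := RtoC (2 * PI) * Ci.

Lemma nome_eq z : nome z = Cexp (two_pi_i * z). Proof. reflexivity. Qed.

Lemma nome_plus a b : nome (a + b) = nome a * nome b.
Proof. rewrite !nome_eq, <- Cexp_plus. f_equal. ring. Qed.

Lemma nome_1 : nome 1 = 1.
Proof.
  rewrite nome_eq. unfold two_pi_i, Cexp, Ci, RtoC, Re, Im; simpl.
  replace ((2 * PI * 0 - 0 * 1) * 1 - (2 * PI * 1 + 0 * 0) * 0)%R with 0%R by ring.
  replace ((2 * PI * 0 - 0 * 1) * 0 + (2 * PI * 1 + 0 * 0) * 1)%R with (2 * PI)%R by ring.
  rewrite exp_0, cos_2PI, sin_2PI. f_equal; ring.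
Qed.

Lemma nome_half : nome (RtoC (1 / 2)) = - (1).
Proof.
  rewrite nome_eq. unfold two_pi_i, Cexp, Ci, RtoC, Re, Im; simpl.
  replace ((2 * PI * 0 - 0 * 1) * (1 / 2) - (2 * PI * 1 + 0 * 0) * 0)%R with 0%R by ring.
  replace ((2 * PI * 0 - 0 * 1) * 0 + (2 * PI * 1 + 0 * 0) * (1 / 2))%R with PI by field.
  rewrite exp_0, cos_PI, sin_PI. unfold Copp; simpl. f_equal; ring.
Qed.

Lemma nome_nat z n : nome (z + INR n) = nome z.
Proof.
  induction n as [|n IH]; [simpl; f_equal; ring|].
  rewrite S_INR, RtoC_plus. replace (z + (INR n + 1)) with (z + INR n + 1) by ring.
  rewrite nome_plus, IH, nome_1. ring.
Qed.

Lemma nome_Z z n : nome (z + IZR n) = nome z.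
Proof.
  destruct (Z_le_gt_dec 0 n) as [H|H].
  - rewrite <- (Z2Nat.id n H), <- INR_IZR_INZ. apply nome_nat.
  - rewrite <- (nome_nat (z + IZR n) (Z.to_nat (- n))). f_equal.
    rewrite INR_IZR_INZ, Z2Nat.id by lia. rewrite opp_IZR, RtoC_opp. ring.
Qed.

Lemma Re_two_pi_i z : Re (two_pi_i * z) = (- (2 * PI * Im z))%R.
Proof. destruct z; unfold two_pi_i, Ci, RtoC, Re, Im; simpl. ring. Qed.

Lemma Im_two_pi_i z : Im (two_pi_i * z) = (2 * PI * Re z)%R.
Proof. destruct z; unfold two_pi_i, Ci, RtoC, Re, Im; simpl. ring. Qed.

Lemma Cmod_nome z : Cmod (nome z) = exp (- (2 * PI * Im z)).
Proof.
  rewrite nome_eq, Cmod_Cexp, Re_two_pi_i. reflexivity.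
Qed.

Lemma nome_lt_1 z : 0 < Im z -> Cmod (nome z) < 1.
Proof.
  intros H. rewrite Cmod_nome, <- exp_0. apply exp_increasing. pose proof PI_RGT_0. nra.
Qed.

Lemma one_minus_nz q : Cmod q < 1 -> 1 - q <> 0.
Proof.
  intros H E. assert (q = 1) as -> by (replace q with (1 - (1 - q)) by ring; rewrite E; ring).
  rewrite Cmod_1 in H. lra.
Qed.

Lemma one_minus_nome z : 0 < Im z -> 1 - nome z <> 0.
Proof. intros. apply one_minus_nz, nome_lt_1, H. Qed.

Definition qterm (z : C) : C := nome z / ((1 - nome z) * (1 - nome z)).

(** * The partial fraction expansion of the squared cosecant *)

Lemma RtoC_half : RtoC (1 / 2) = 1 / 2.
Proof. apply RtoC_div. lra. Qed.

Lemma Cexp_third_order u : Cmod u <= 1 / 2 ->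
  Cmod (Cexp u - 1 - u - u * u / 2) <= 10 * Cmod u ^ 3.
Proof.
  intros H.
  set (F := fun w => Cexp w - 1 - w - RtoC (1 / 2) * (w * w)).
  replace (Cexp u - 1 - u - u * u / 2) with (F (0 + u) - F 0).
  2:{ unfold F. rewrite Cexp_0, Cplus_0_l, RtoC_half. field. }
  apply Rle_trans with ((10 * Cmod u ^ 2) * Cmod u)%R; [|right; ring].
  apply (mean_value F (fun w => Cexp w - 0 - 1 - RtoC (1 / 2) * (1 * w + w * 1))).
  - intros t _. unfold F. apply qder_minus; [apply qder_minus; [apply qder_minus|]|].
    + apply qder_Cexp.
    + apply qder_const.
    + apply qder_id.
    + apply qder_scal, (qder_mult (fun w => w) (fun w => w)); apply qder_id.
  - intros t Ht. rewrite Cplus_0_l. pose proof (Cmod_ge_0 u).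
    assert (E : Cmod (t * u) <= Cmod u) by (rewrite Cmod_mult, Cmod_R, Rabs_pos_eq by lra; nra).
    pose proof (Cmod_ge_0 (t * u)).
    replace (Cexp (t * u) - 0 - 1 - RtoC (1 / 2) * (1 * (t * u) + t * u * 1)) with (Cexp (t * u) - 1 - t * u)
      by (rewrite RtoC_half; field).
    eapply Rle_trans; [apply Cexp_second_order; lra|]. apply Rmult_le_compat_l; [lra|].
    apply pow_incr. lra.
Qed.

Lemma Cmod_sub_le' a b : Cmod b - Cmod (a - b) <= Cmod a.
Proof.
  replace a with (b + (a - b)) at 2 by ring. apply Cmod_sub_le.
Qed.

Definition csc_defect (u : C) : C := Cexp u / ((1 - Cexp u) * (1 - Cexp u)) - 1 / (u * u).

(** The numerator [u^2 e^u - (e^u - 1)^2] of the difference vanishes to order four at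
[0], as does its denominator. *)
Lemma csc_near (u : C) : u <> 0 -> Cmod u <= 1 / 20 -> Cmod (csc_defect u) <= 200.
Proof.
  intros H0 H. unfold csc_defect.
  pose proof (Cexp_third_order u ltac:(lra)) as T3.
  pose proof (Cexp_second_order u ltac:(lra)) as T2.
  set (rho := Cexp u - 1 - u - u * u / 2) in *.
  assert (Hu : 0 < Cmod u) by (apply Cmod_gt_0, H0).
  assert (Hv : Cmod u / 2 <= Cmod (Cexp u - 1)).
  { pose proof (Cmod_sub_le' (Cexp u - 1) u). nra. }
  assert (N : Cexp u - 1 <> 0) by (apply Cmod_gt_0; lra).
  assert (N' : 1 - Cexp u <> 0).
  { intros E. apply N. replace (Cexp u - 1) with (- (1 - Cexp u)) by ring. rewrite E. ring. }
  replace (Cexp u / ((1 - Cexp u) * (1 - Cexp u)) - 1 / (u * u)) with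
    ((u * u * (u * u) / 4 - 2 * u * rho - rho * rho) * / ((u * (Cexp u - 1)) * (u * (Cexp u - 1)))).
  2:{ unfold rho. field. repeat split; auto. }
  rewrite Cmod_mult, Cmod_inv', !Cmod_mult.
  set (a := Cmod u) in *. set (v := Cmod (Cexp u - 1)) in *.
  assert (B : Cmod (u * u * (u * u) / 4 - 2 * u * rho - rho * rho) <= 50 * a ^ 4).
  { unfold Cminus. eapply Rle_trans; [apply Cmod_triangle|].
    eapply Rle_trans; [apply Rplus_le_compat_r, Cmod_triangle|].
    rewrite !Cmod_opp. unfold Cdiv. rewrite !Cmod_mult, Cmod_inv', !(Cmod_RtoC_nonneg) by lra. fold a.
    pose proof (Cmod_ge_0 rho).
    assert (a * Cmod rho <= a * (10 * a ^ 3)) by (apply Rmult_le_compat_l; lra).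
    assert (Cmod rho * Cmod rho <= (10 * a ^ 3) * (10 * a ^ 3)) by (apply Rmult_le_compat; lra).
    assert (0 <= a ^ 4) by (apply pow_le; lra).
    assert (a ^ 2 <= 1 / 400) by nra.
    assert (a ^ 4 * a ^ 2 <= a ^ 4 * (1 / 400)) by (apply Rmult_le_compat_l; lra).
    nra. }
  assert (D : (a * (a / 2)) * (a * (a / 2)) <= a * v * (a * v)).
  { assert (a * (a / 2) <= a * v) by (apply Rmult_le_compat_l; lra).
    apply Rmult_le_compat; nra. }
  assert (P : 0 < (a * (a / 2)) * (a * (a / 2))) by (repeat apply Rmult_lt_0_compat; lra).
  apply Rle_trans with (50 * a ^ 4 * / ((a * (a / 2)) * (a * (a / 2))))%R.
  - apply Rmult_le_compat; [apply Cmod_ge_0| |exact B|].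
    + left. apply Rinv_0_lt_compat. lra.
    + apply Rinv_le_contravar; auto.
  - right. field. lra.
Qed.

(** In the strip [|Re z| <= 1/2] the nome is close to [1] only near [z = 0]: elsewhere
its modulus is bounded away from [1] or its argument away from [0]. *)
Lemma one_minus_exp_far : exists c, 0 < c /\ forall z, 0 < Im z -> Rabs (Re z) <= 1 / 2 ->
  1 / 20 <= Cmod (two_pi_i * z) -> c <= Cmod (1 - nome z).
Proof.
  assert (E1 : exp (- (1 / 40)) < 1) by (pose proof (exp_increasing (- (1 / 40)) 0 ltac:(lra)) as Q; rewrite exp_0 in Q; exact Q).
  assert (Hpi : 3 < PI) by (pose proof PI2_3_2; lra).
  assert (S1 : 0 < sin (1 / 40)) by (apply sin_gt_0; lra).
  (* When [|2 pi i z| >= 1 / 20], its real or its imaginary part is at least [1 / 40]. *)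
  exists (Rmin (1 - exp (- (1 / 40))) (sin (1 / 40))). split; [apply Rmin_glb_lt; lra|].
  intros z Hz Hx Hc.
  destruct (Rle_lt_dec (1 / 40) (2 * PI * Im z)) as [L|L].
  - eapply Rle_trans; [apply Rmin_l|].
    assert (Cmod (nome z) <= exp (- (1 / 40))).
    { rewrite Cmod_nome. destruct L as [L|L]; [left; apply exp_increasing; lra|]. rewrite L. lra. }
    pose proof (Cmod_sub_le 1 (- nome z)). rewrite Cmod_1, Cmod_opp in H0.
    unfold Cminus. lra.
  - eapply Rle_trans; [apply Rmin_r|].
    assert (Hr : 1 / 40 <= Rabs (2 * PI * Re z)).
    { pose proof (Cmod_le_abs (two_pi_i * z)) as A.
      rewrite Re_two_pi_i, Im_two_pi_i, Rabs_Ropp, (Rabs_pos_eq (2 * PI * Im z)) in A by nra. lra. }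
    set (th := (2 * PI * Re z)%R) in *. set (r := exp (- (2 * PI * Im z))).
    assert (Hth : Rabs th <= PI).
    { unfold th. rewrite Rabs_mult, Rabs_pos_eq by lra. nra. }
    assert (En : 1 - nome z = ((1 - r * cos th)%R, (- (r * sin th))%R)).
    { rewrite nome_eq. unfold Cexp. rewrite Re_two_pi_i, Im_two_pi_i. fold r th. unfold Cminus, Cplus, Copp, RtoC. simpl. f_equal; ring. }
    rewrite En. pose proof (exp_pos (- (2 * PI * Im z))) as Hrp. fold r in Hrp.
    set (w := ((1 - r * cos th)%R, (- (r * sin th))%R) : C).
    assert (Hsq : (Cmod w ^ 2)%R = ((r - cos th) ^ 2 + sin th ^ 2)%R).
    { rewrite Cmod2_alt. unfold w, Re, Im; simpl fst; simpl snd.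
      pose proof (sin2_cos2 th) as Q. unfold Rsqr in Q. nra. }
    pose proof (Cmod_ge_0 w) as Hw.
    assert (Hcos : cos th = cos (Rabs th)).
    { unfold Rabs. destruct (Rcase_abs th); [rewrite cos_neg|]; auto. }
    assert (Hsin : (sin th ^ 2 = sin (Rabs th) ^ 2)%R).
    { unfold Rabs. destruct (Rcase_abs th); [rewrite sin_neg|]; ring. }
    assert (Hs1 : sin (1 / 40) <= 1) by (pose proof (SIN_bound (1 / 40)); lra).
    destruct (Rle_lt_dec (Rabs th) (PI / 2)) as [Q|Q].
    + assert (sin (1 / 40) <= sin (Rabs th)) by (apply sin_incr_1; lra).
      rewrite Hsin in Hsq.
      apply Rsqr_incr_0_var; auto. unfold Rsqr.
      apply Rle_trans with (sin (Rabs th) * sin (Rabs th))%R; [apply Rmult_le_compat; lra|].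
      pose proof (pow2_ge_0 (r - cos th)). lra.
    + assert (cos th <= 0) by (rewrite Hcos; apply cos_le_0; lra).
      pose proof (re_le_Cmod w) as A. unfold w at 1, Re in A; simpl fst in A.
      pose proof (Rle_abs (1 - r * cos th)). nra.
Qed.

Lemma csc_bounded : exists M, forall z, 0 < Im z -> Rabs (Re z) <= 1 / 2 ->
  Cmod (csc_defect (two_pi_i * z)) <= M.
Proof.
  destruct one_minus_exp_far as [c [Hc Hfar]].
  exists (200 + (/ (c * c) + 400))%R. intros z Hz Hx.
  assert (Hcc : 0 < / (c * c)) by (apply Rinv_0_lt_compat; nra).
  destruct (Rle_lt_dec (1 / 20) (Cmod (two_pi_i * z))) as [L|L].
  - specialize (Hfar z Hz Hx L). unfold csc_defect. rewrite <- nome_eq.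
    unfold Cminus at 1. eapply Rle_trans; [apply Cmod_triangle|]. rewrite Cmod_opp.
    unfold Cdiv. rewrite !Cmod_mult, !Cmod_inv', !Cmod_mult, Cmod_1.
    pose proof (nome_lt_1 z Hz). pose proof (Cmod_ge_0 (nome z)).
    assert (A1 : / (Cmod (1 - nome z) * Cmod (1 - nome z)) <= / (c * c)).
    { apply Rinv_le_contravar; [nra|]. apply Rmult_le_compat; lra. }
    assert (A1' : 0 < / (Cmod (1 - nome z) * Cmod (1 - nome z))) by (apply Rinv_0_lt_compat; nra).
    assert (A2 : / (Cmod (two_pi_i * z) * Cmod (two_pi_i * z)) <= 400).
    { replace 400%R with (/ ((1 / 20) * (1 / 20)))%R by field. apply Rinv_le_contravar; [lra|].
      apply Rmult_le_compat; lra. }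
    rewrite Cmod_mult in A2. nra.
  - apply Rle_trans with 200%R; [|lra]. apply csc_near; [|lra].
    intros E. pose proof PI_RGT_0.
    assert (Re (two_pi_i * z) = 0%R) by (rewrite E; reflexivity).
    rewrite Re_two_pi_i in H0. nra.
Qed.

Lemma rowsum2_pole z : 0 < Im z -> Rabs (Re z) <= 1 / 2 -> Cmod (rowsum 2 z - invpow 2 z) <= 96.
Proof.
  intros Hz Hx. set (P := fun d : Z => d <> 0%Z).
  assert (B : sums_below P (fun d => Cmod (invpow 2 (z + IZR d))) 96).
  { apply (sums_below_le _ _ (fun d => 4 ^ (2 + 0) * wt d)%R).
    - intros d Hd. apply (invpow_big1 0). unfold big1.
      pose proof (re_le_Cmod (z + IZR d)) as A. rewrite Re_plus in A.
      change (Re (RtoC (IZR d))) with (IZR d) in A.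
      assert (1 <= IZR (Z.abs d)) by (apply (IZR_le 1); unfold P in Hd; lia).
      rewrite abs_IZR in *.
      assert (Rabs (IZR d) <= Rabs (Re z + IZR d) + Rabs (Re z)); [|lra].
      replace (IZR d) with ((Re z + IZR d) + - Re z)%R at 1 by ring.
      eapply Rle_trans; [apply Rabs_triang|]. rewrite Rabs_Ropp. lra.
    - replace 96%R with (4 ^ (2 + 0) * 6)%R by (simpl; ring). apply sums_below_scal; [simpl; lra|].
      apply wt_summable. }
  destruct (summable_has_sum _ _ _ B) as [t Ht].
  assert (E : rowsum 2 z = invpow 2 z + t).
  { apply Sum_eq. replace (invpow 2 z) with (invpow 2 (z + IZR 0)) by (f_equal; simpl; ring).
    apply (has_sum_pred_ext (fun d => d = 0%Z \/ P d)).
    { intros d. unfold P, allZ. lia. }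
    apply has_sum_union; [unfold P; intros; lia| |exact Ht].
    apply (has_sum_single 0%Z (fun d => invpow 2 (z + IZR d))). }
  rewrite E. replace (invpow 2 z + t - invpow 2 z) with t by ring.
  eapply has_sum_bound; eauto.
Qed.

Lemma two_pi_i_nz : two_pi_i <> 0.
Proof.
  unfold two_pi_i, RtoC, Ci. pose proof PI_RGT_0. intros E. apply (f_equal snd) in E. simpl in E. lra.
Qed.

Definition defect (z : C) : C := rowsum 2 z - two_pi_i * two_pi_i * qterm z.

Lemma defect_periodic z n : 0 < Im z -> defect (z + IZR n) = defect z.
Proof.
  intros H. unfold defect, qterm. rewrite nome_Z, (rowsum_periodic 0) by lra. reflexivity.
Qed.

(** The double poles of both terms at the integers cancel, and by periodicity it
is enough to look at [|Re z| <= 1/2]. *)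
Lemma defect_bounded : exists M, forall z, 0 < Im z -> Cmod (defect z) <= M.
Proof.
  destruct csc_bounded as [M HM].
  exists (96 + Cmod (two_pi_i * two_pi_i) * M)%R.
  assert (Hstrip : forall z, 0 < Im z -> Rabs (Re z) <= 1 / 2 -> Cmod (defect z) <= 96 + Cmod (two_pi_i * two_pi_i) * M).
  { intros z Hz Hx. specialize (HM z Hz Hx). pose proof (rowsum2_pole z Hz Hx).
    assert (Nz : z <> 0) by (intros ->; simpl in Hz; lra).
    unfold defect. replace (rowsum 2 z - two_pi_i * two_pi_i * qterm z) with
      ((rowsum 2 z - invpow 2 z) - two_pi_i * two_pi_i * csc_defect (two_pi_i * z)).
    2:{ unfold csc_defect, qterm, invpow. rewrite <- nome_eq. simpl. field.
        repeat split; auto using two_pi_i_nz, one_minus_nome. }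
    unfold Cminus at 1. eapply Rle_trans; [apply Cmod_triangle|]. rewrite Cmod_opp, (Cmod_mult (two_pi_i * two_pi_i)).
    pose proof (Cmod_ge_0 (two_pi_i * two_pi_i)). nra. }
  intros z Hz. set (n := up (Re z - 1 / 2)).
  destruct (archimed (Re z - 1 / 2)) as [A1 A2]. fold n in A1, A2.
  replace z with (z + IZR (- n) + IZR n) by (rewrite opp_IZR, RtoC_opp; ring).
  assert (Hi : Im (z + IZR (- n)) = Im z) by (rewrite Im_plus; simpl; ring).
  rewrite defect_periodic by (rewrite Hi; exact Hz).
  apply Hstrip; [rewrite Hi; exact Hz|].
  rewrite Re_plus. change (Re (RtoC (IZR (- n)))) with (IZR (- n)). rewrite opp_IZR.
  apply Rabs_le. lra.
Qed.

(** The two sums run over the even and the odd integers. *)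
Lemma rowsum2_double z : 0 < Im z -> rowsum 2 (z / 2) + rowsum 2 ((z + 1) / 2) = 4 * rowsum 2 z.
Proof.
  intros Hz.
  assert (I1 : Im (z / 2) <> 0%R) by (rewrite Im_half; lra).
  assert (I2 : Im ((z + 1) / 2) <> 0%R) by (rewrite Im_half, Im_plus; simpl; lra).
  pose proof (rowsum_has_sum 0 _ I1) as S1. pose proof (rowsum_has_sum 0 _ I2) as S2.
  change (2 + 0)%nat with 2%nat in *.
  assert (Hp : forall w, invpow 2 (w / 2) = 4 * invpow 2 w).
  { intros w. unfold invpow. destruct (excluded_middle_informative (w = 0)) as [->|Hw].
    - replace (0 / 2) with (RtoC 0) by (field). rewrite Cinv_0. simpl. ring.
    - simpl. field. exact Hw. }
  set (f := fun d => 4 * invpow 2 (z + IZR d)).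
  assert (T1 : has_sum (fun d => Z.Even d) f (rowsum 2 (z / 2))).
  { apply (has_sum_reindex allZ (fun d => Z.Even d) (fun d => (2 * d)%Z)).
    - intros d _. exists d. lia.
    - intros; lia.
    - intros j [d ->]. exists d. split; [exact I|lia].
    - refine (has_sum_ext _ _ _ _ _ S1). intros d _. unfold f. rewrite mult_IZR, RtoC_mult, <- Hp.
      f_equal. field. }
  assert (T2 : has_sum (fun d => Z.Odd d) f (rowsum 2 ((z + 1) / 2))).
  { apply (has_sum_reindex allZ (fun d => Z.Odd d) (fun d => (2 * d + 1)%Z)).
    - intros d _. exists d. lia.
    - intros; lia.
    - intros j [d ->]. exists d. split; [exact I|lia].
    - refine (has_sum_ext _ _ _ _ _ S2). intros d _. unfold f. rewrite plus_IZR, mult_IZR, RtoC_plus, RtoC_mult, <- Hp.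
      f_equal. field. }
  apply (has_sum_unique allZ f).
  - apply (has_sum_pred_ext (fun d => Z.Even d \/ Z.Odd d)).
    { intros d. unfold allZ. split; auto. intros _. apply Z.Even_or_Odd. }
    apply has_sum_union; auto. intros d. apply Z.Even_Odd_False.
  - apply has_sum_scal. apply (rowsum_has_sum 0). lra.
Qed.

Lemma qterm_double z : 0 < Im z -> qterm (z / 2) + qterm ((z + 1) / 2) = 4 * qterm z.
Proof.
  intros Hz.
  assert (E1 : nome z = nome (z / 2) * nome (z / 2)).
  { rewrite <- nome_plus. f_equal. field. }
  assert (E2 : nome ((z + 1) / 2) = - nome (z / 2)).
  { replace ((z + 1) / 2) with (z / 2 + RtoC (1 / 2)) by (rewrite RtoC_half; field).
    rewrite nome_plus, nome_half. ring. }
  assert (L : Cmod (nome (z / 2)) < 1) by (apply nome_lt_1; rewrite Im_half; lra).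
  unfold qterm. rewrite E2, E1. set (e := nome (z / 2)) in *.
  pose proof (one_minus_nz e L) as N1.
  assert (N2 : 1 + e <> 0).
  { replace (1 + e) with (1 - - e) by ring. apply one_minus_nz. rewrite Cmod_opp. exact L. }
  assert (N3 : 1 - e * e <> 0).
  { replace (1 - e * e) with ((1 - e) * (1 + e)) by ring. apply Cmult_neq_0; auto. }
  assert (N4 : 1 - - e <> 0) by (replace (1 - - e) with (1 + e) by ring; auto).
  field. auto.
Qed.

(** Herglotz' trick: the difference [g] of the two sides satisfies
[g (z / 2) + g ((z + 1) / 2) = 4 g z], so its supremum [m] satisfies [m <= m / 2]. *)
Lemma rowsum2_eq_qterm z : 0 < Im z -> rowsum 2 z = two_pi_i * two_pi_i * qterm z.
Proof.
  destruct defect_bounded as [M HM].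
  set (E := fun r => exists z, 0 < Im z /\ r = Cmod (defect z)).
  destruct (completeness E) as [m [Hm1 Hm2]].
  { exists M. intros r [w [Hw ->]]. auto. }
  { exists (Cmod (defect Ci)), Ci. split; [simpl; lra|reflexivity]. }
  assert (Hle : m <= m / 2).
  { apply Hm2. intros r [w [Hw ->]].
    assert (Eq : 4 * defect w = defect (w / 2) + defect ((w + 1) / 2)).
    { unfold defect. replace (4 * (rowsum 2 w - two_pi_i * two_pi_i * qterm w)) with (4 * rowsum 2 w - two_pi_i * two_pi_i * (4 * qterm w)) by ring.
      rewrite <- rowsum2_double, <- qterm_double by exact Hw. ring. }
    pose proof (Im_half w) as I1.
    assert (I2 : Im ((w + 1) / 2) = (Im w / 2)%R) by (rewrite Im_half, Im_plus; simpl; lra).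
    assert (B1 : Cmod (defect (w / 2)) <= m) by (apply Hm1; exists (w / 2); split; [lra|reflexivity]).
    assert (B2 : Cmod (defect ((w + 1) / 2)) <= m) by (apply Hm1; exists ((w + 1) / 2); split; [lra|reflexivity]).
    apply (f_equal Cmod) in Eq. rewrite Cmod_mult, Cmod_RtoC_nonneg in Eq by lra.
    pose proof (Cmod_triangle (defect (w / 2)) (defect ((w + 1) / 2))). lra. }
  intros Hz. assert (B : Cmod (defect z) <= m) by (apply Hm1; exists z; auto).
  assert (E0 : defect z = 0).
  { apply Cmod_eq_0. pose proof (Cmod_ge_0 (defect z)). lra. }
  unfold defect in E0. replace (rowsum 2 z) with (rowsum 2 z - two_pi_i * two_pi_i * qterm z + two_pi_i * two_pi_i * qterm z) by ring.
  rewrite E0. ring.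
Qed.

(** * Row sums and powers span the same functions *)

Definition qpow (j : nat) (z : C) : C := Cpow (qterm z) j.

(** The logarithmic derivative of [qterm], up to [two_pi_i]. As its square is
[1 + 4 * qterm z] and its derivative a multiple of [qterm], second derivatives of
powers of [qterm] are polynomials in [qterm]. *)
Definition qratio (z : C) : C := (1 + nome z) / (1 - nome z).

Lemma qder_nome z : qder nome z (two_pi_i * nome z).
Proof. apply (qder_dilate Cexp two_pi_i), qder_Cexp. Qed.

Lemma qder_one_minus_nome z : qder (fun z => 1 - nome z) z (- (two_pi_i * nome z)).
Proof.
  apply (qder_eq _ _ (0 - two_pi_i * nome z)); [|ring].
  apply (qder_minus (fun _ => 1) nome); [apply qder_const|apply qder_nome].
Qed.

Lemma qder_qratio z : 0 < Im z -> qder qratio z (two_pi_i * (2 * qterm z)).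
Proof.
  intros H. pose proof (one_minus_nome z H) as N.
  apply (qder_eq _ _ ((0 + two_pi_i * nome z) * / (1 - nome z) +
    (1 + nome z) * (- - (two_pi_i * nome z) / ((1 - nome z) * (1 - nome z))))).
  - apply (qder_mult (fun z => 1 + nome z) (fun z => / (1 - nome z))).
    + apply (qder_plus (fun _ => 1) nome); [apply qder_const|apply qder_nome].
    + apply (qder_inv (fun z => 1 - nome z)); [apply qder_one_minus_nome|exact N].
  - unfold qterm. field. exact N.
Qed.

Lemma qratio_sq z : 0 < Im z -> qratio z * qratio z = 1 + 4 * qterm z.
Proof. intros H. pose proof (one_minus_nome z H) as N. unfold qratio, qterm. field. exact N. Qed.

Lemma qder_qterm z : 0 < Im z -> qder qterm z (two_pi_i * (qterm z * qratio z)).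
Proof.
  intros H. pose proof (one_minus_nome z H) as N.
  pose proof (qder_inv _ _ _ (qder_one_minus_nome z) N) as Q. cbv beta in Q.
  pose proof (qder_mult _ _ _ _ _ Q Q) as Q2.
  pose proof (qder_mult _ _ _ _ _ (qder_nome z) Q2) as Q3. cbv beta in Q3.
  eapply qder_eq; [eapply (qder_ext _ qterm _ _ (Im z / 2)%R); [| |exact Q3]|].
  - lra.
  - intros h Hh. pose proof (ball_upper z h H Hh). unfold qterm. cbv beta. field.
    apply one_minus_nome. lra.
  - unfold qratio, qterm. field. exact N.
Qed.

Definition dqpow (j : nat) (z : C) : C := INR j * (qpow j z * qratio z).

Definition ddqpow (j : nat) (z : C) : C :=
  INR j * INR j * qpow j z + (4 * (INR j * INR j) + 2 * INR j) * qpow (S j) z.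

Lemma qder_qpow j z : 0 < Im z -> qder (qpow (S j)) z (two_pi_i * dqpow (S j) z).
Proof.
  intros H. eapply qder_eq; [apply (qder_pow qterm _ _ j (qder_qterm z H))|].
  unfold dqpow, qpow. simpl Cpow. ring.
Qed.

Lemma qder_dqpow j z : 0 < Im z -> qder (dqpow (S j)) z (two_pi_i * ddqpow (S j) z).
Proof.
  intros H.
  apply (qder_eq _ _ (INR (S j) * ((two_pi_i * dqpow (S j) z) * qratio z + qpow (S j) z * (two_pi_i * (2 * qterm z))))).
  - apply qder_scal. apply (qder_mult (qpow (S j)) qratio); [apply qder_qpow, H|apply qder_qratio, H].
  - unfold ddqpow, dqpow. set (J := INR (S j)).
    replace (qpow (S (S j)) z) with (qterm z * qpow (S j) z) by reflexivity.
    transitivity (two_pi_i * (J * J * qpow (S j) z * (qratio z * qratio z) + 2 * J * qterm z * qpow (S j) z)); [ring|].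
    rewrite qratio_sq by exact H. ring.
Qed.

Definition second_der (f f2 : C -> C) : Prop := exists f1, forall z, 0 < Im z ->
  qder f z (f1 z) /\ qder f1 z (f2 z).

Lemma second_der_unique f g f2 g2 :
  (forall z, 0 < Im z -> f z = g z) -> second_der f f2 -> second_der g g2 ->
  forall z, 0 < Im z -> f2 z = g2 z.
Proof.
  intros E [f1 Hf] [g1 Hg].
  assert (U : forall (a b a1 b1 : C -> C), (forall z, 0 < Im z -> a z = b z) ->
     (forall z, 0 < Im z -> qder a z (a1 z)) -> (forall z, 0 < Im z -> qder b z (b1 z)) ->
     forall z, 0 < Im z -> a1 z = b1 z).
  { intros a b a1 b1 Eab Ha Hb z Hz. apply (qder_unique a z); [auto|].
    apply (qder_ext b _ _ _ (Im z / 2)%R); [lra| |auto].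
    intros h Hh. symmetry. apply Eab. pose proof (ball_upper z h Hz Hh). lra. }
  apply (U f1 g1).
  - apply (U f g); auto; intros; [apply Hf|apply Hg]; auto.
  - intros; apply Hf; auto.
  - intros; apply Hg; auto.
Qed.

Lemma second_der_lin (c : nat -> C) (g g2 : nat -> C -> C) L :
  (forall i, In i L -> second_der (g i) (g2 i)) ->
  second_der (fun z => Csum (fun i => c i * g i z) L) (fun z => Csum (fun i => c i * g2 i z) L).
Proof.
  induction L as [|i L IH]; intros H.
  - exists (fun _ => 0). intros z _. simpl. split; apply qder_const.
  - destruct IH as [u Hu]; [intros; apply H; right; auto|].
    destruct (H i (or_introl eq_refl)) as [v Hv].
    exists (fun z => c i * v z + u z). intros z Hz. specialize (Hu z Hz). specialize (Hv z Hz).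
    simpl. split.
    + apply (qder_plus (fun z => c i * g i z)); [apply qder_scal|]; tauto.
    + apply (qder_plus (fun z => c i * v z)); [apply qder_scal|]; tauto.
Qed.

Lemma second_der_rowsum k : second_der (rowsum (2 + k)) (fun z => INR (2 + k) * INR (3 + k) * rowsum (4 + k) z).
Proof.
  exists (fun z => - INR (2 + k) * rowsum (3 + k) z). intros z Hz. split; [apply qder_rowsum, Hz|].
  apply (qder_eq _ _ (- INR (2 + k) * (- INR (3 + k) * rowsum (4 + k) z))); [|ring].
  apply qder_scal. apply (qder_rowsum (S k)), Hz.
Qed.

Lemma second_der_qpow j : second_der (qpow (S j)) (fun z => two_pi_i * two_pi_i * ddqpow (S j) z).
Proof.
  exists (fun z => two_pi_i * dqpow (S j) z). intros z Hz. split; [apply qder_qpow, Hz|].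
  apply (qder_eq _ _ (two_pi_i * (two_pi_i * ddqpow (S j) z))); [|ring].
  apply qder_scal, qder_dqpow, Hz.
Qed.

Definition span (g : nat -> C -> C) (K : nat) (f : C -> C) : Prop :=
  exists c : nat -> C, forall z, 0 < Im z -> f z = Csum (fun i => c i * g i z) (seq 0 K).

Lemma span_ext g K f f' : (forall z, 0 < Im z -> f z = f' z) -> span g K f -> span g K f'.
Proof. intros E [c H]. exists c. intros. rewrite <- E; auto. Qed.

Lemma span_plus g K f f' : span g K f -> span g K f' -> span g K (fun z => f z + f' z).
Proof.
  intros [c H] [c' H']. exists (fun i => c i + c' i). intros z Hz. rewrite H, H' by auto.
  rewrite <- Csum_plus. apply Csum_ext. intros; ring.
Qed.

Lemma span_scal g K a f : span g K f -> span g K (fun z => a * f z).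
Proof.
  intros [c H]. exists (fun i => a * c i). intros z Hz. rewrite H by auto.
  rewrite <- Csum_scal. apply Csum_ext. intros; ring.
Qed.

Lemma Csum_indicator i K (g : nat -> C) : (i < K)%nat ->
  Csum (fun j => RtoC (if Nat.eq_dec j i then 1 else 0) * g j) (seq 0 K) = g i.
Proof.
  assert (Z0 : forall L, ~ In i L -> Csum (fun j => RtoC (if Nat.eq_dec j i then 1 else 0) * g j) L = 0).
  { induction L as [|a L IH]; intros H; [reflexivity|]. simpl.
    destruct (Nat.eq_dec a i) as [->|]; [exfalso; apply H; left; auto|].
    rewrite IH; [ring|]. intros Hi; apply H; right; auto. }
  intros H.
  assert (In i (seq 0 K)) by (apply in_seq; lia). pose proof (seq_NoDup K 0).
  revert H0 H1. generalize (seq 0 K). induction l as [|a L IH]; intros Hi HN; [destruct Hi|].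
  inversion HN; subst. simpl. destruct (Nat.eq_dec a i) as [->|Ne].
  - rewrite Z0 by auto. ring.
  - rewrite IH; auto; [ring|]. destruct Hi; [congruence|auto].
Qed.

Lemma span_gen g K i : (i < K)%nat -> span g K (g i).
Proof.
  intros H. exists (fun j => RtoC (if Nat.eq_dec j i then 1 else 0)). intros z _.
  symmetry. apply (Csum_indicator i K (fun j => g j z) H).
Qed.

Lemma span_Csum {I} g K (f : I -> C -> C) L : (forall i, In i L -> span g K (f i)) ->
  span g K (fun z => Csum (fun i => f i z) L).
Proof.
  induction L as [|i L IH]; intros H.
  - exists (fun _ => 0). intros z _. simpl. induction (seq 0 K) as [|a l IH]; simpl; [reflexivity|].
    rewrite <- IH. ring.
  - apply (span_plus g K (f i)); [apply H; left; auto|]. apply IH. intros; apply H; right; auto.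
Qed.

Lemma span_mono g K K' f : (K <= K')%nat -> span g K f -> span g K' f.
Proof.
  intros HK [c H].
  apply (span_ext _ _ (fun z => Csum (fun i => c i * g i z) (seq 0 K))); [intros; symmetry; auto|].
  apply (span_Csum g K' (fun i z => c i * g i z)). intros i Hi. apply in_seq in Hi.
  apply (span_scal g K' (c i) (g i)). apply span_gen. lia.
Qed.

Lemma RtoC_pos_nz r : 0 < r -> RtoC r <> 0.
Proof. intros H E. apply RtoC_inj in E. lra. Qed.

Lemma INR_S_nz k : RtoC (INR (S k)) <> 0.
Proof. apply RtoC_pos_nz, lt_0_INR. lia. Qed.

Definition evenrow (i : nat) : C -> C := rowsum (2 + 2 * i).

(** Solve [D^2 x^j = j^2 x^j + (4 j^2 + 2 j) x^(j + 1)] for [x^(j + 1)], and use that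
[D^2] maps a row sum of weight [k] to a multiple of one of weight [k + 2]. *)
Lemma qpow_span j : span evenrow (S j) (qpow (S j)).
Proof.
  induction j as [|j IH].
  - apply (span_ext _ _ (fun z => / (two_pi_i * two_pi_i) * evenrow 0 z)).
    + intros z Hz. unfold evenrow. change (2 + 2 * 0)%nat with 2%nat. rewrite rowsum2_eq_qterm by auto.
      unfold qpow. simpl. field. apply two_pi_i_nz.
    + apply span_scal, span_gen. lia.
  - destruct IH as [c Hc].
    pose proof (second_der_unique _ _ _ _ Hc (second_der_qpow j)
      (second_der_lin c evenrow _ (seq 0 (S j)) (fun i _ => second_der_rowsum (2 * i)))) as E.
    cbv beta in E. set (J := RtoC (INR (S j))) in *.
    assert (NJ : 4 * (J * J) + 2 * J <> 0).
    { unfold J. rewrite <- !RtoC_mult, <- RtoC_plus. apply RtoC_pos_nz.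
      assert (0 < INR (S j)) by (apply lt_0_INR; lia). nra. }
    apply (span_ext _ _ (fun z => / (4 * (J * J) + 2 * J) * (/ (two_pi_i * two_pi_i) *
       Csum (fun i => c i * (INR (2 + 2 * i) * INR (3 + 2 * i) * evenrow (S i) z)) (seq 0 (S j))
       + (- (J * J)) * qpow (S j) z))).
    + intros z Hz. specialize (E z Hz).
      replace (Csum (fun i => c i * (INR (2 + 2 * i) * INR (3 + 2 * i) * evenrow (S i) z)) (seq 0 (S j)))
        with (two_pi_i * two_pi_i * ddqpow (S j) z).
      * unfold ddqpow. fold J. field. split; [apply two_pi_i_nz|exact NJ].
      * rewrite E. apply Csum_ext. intros i _. unfold evenrow. do 3 f_equal. lia.
    + apply span_scal, span_plus; apply span_scal.
      * apply (span_Csum evenrow (S (S j)) (fun i z => c i * (INR (2 + 2 * i) * INR (3 + 2 * i) * evenrow (S i) z))).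
        intros i Hi. apply in_seq in Hi. apply span_scal, span_scal, span_gen. lia.
      * apply (span_mono _ (S j)); [lia|]. exists c. exact Hc.
Qed.

(** The converse direction, used to transfer the exponential decay and the holomorphy
of power sums to Eisenstein series. *)
Lemma rowsum_span i : span (fun j => qpow (S j)) (S i) (evenrow i).
Proof.
  induction i as [|i IH].
  - apply (span_ext _ _ (fun z => two_pi_i * two_pi_i * qpow 1 z)).
    + intros z Hz. unfold evenrow. change (2 + 2 * 0)%nat with 2%nat. rewrite rowsum2_eq_qterm by auto.
      unfold qpow. simpl. ring.
    + apply span_scal. apply (span_gen (fun j => qpow (S j)) 1 0). lia.
  - destruct IH as [c Hc].
    pose proof (second_der_unique _ _ _ _ Hc (second_der_rowsum (2 * i))
      (second_der_lin c (fun j => qpow (S j)) _ (seq 0 (S i)) (fun j _ => second_der_qpow j))) as E.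
    cbv beta in E.
    apply (span_ext _ _ (fun z => / (INR (2 + 2 * i) * INR (3 + 2 * i)) *
       Csum (fun j => c j * (two_pi_i * two_pi_i * ddqpow (S j) z)) (seq 0 (S i)))).
    + intros z Hz. rewrite <- (E z Hz). unfold evenrow.
      replace (2 + 2 * S i)%nat with (4 + 2 * i)%nat by lia. field.
      split; apply INR_S_nz.
    + apply span_scal. apply (span_Csum _ (S (S i)) (fun j z => c j * (two_pi_i * two_pi_i * ddqpow (S j) z))).
      intros j Hj. apply in_seq in Hj. apply span_scal, span_scal. unfold ddqpow.
      apply (span_plus _ _ (fun z => INR (S j) * INR (S j) * qpow (S j) z)); apply span_scal.
      * apply (span_gen (fun j => qpow (S j)) (S (S i)) j). lia.
      * apply (span_gen (fun j => qpow (S j)) (S (S i)) (S j)). lia.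
Qed.

(** * Power sums over positive integers are holomorphic *)

Lemma wt_nat_summable (P : nat -> Prop) : sums_below P (fun m => wt (Z.of_nat m)) 6.
Proof.
  intros L HL _. rewrite <- Rsum_map. apply (wt_summable allZ).
  - apply FinFun.Injective_map_NoDup; [|exact HL]. intros a b. lia.
  - apply Forall_forall. unfold allZ. auto.
Qed.

Lemma inv_sq_wt m : (0 < m)%nat -> / INR m ^ 2 <= 4 * wt (Z.of_nat m).
Proof.
  intros Hm. assert (H1 : 1 <= INR m) by (apply (le_INR 1); lia).
  unfold wt. rewrite Z.abs_eq by lia. rewrite <- INR_IZR_INZ.
  set (a := INR m) in *.
  assert (HS2 : sqrt (1 + a) <= 1 + a) by (apply sqrt_le_self; lra).
  assert (HS : 0 < sqrt (1 + a)) by (apply sqrt_lt_R0; lra).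
  apply (Rmult_le_reg_r (a ^ 2 * ((1 + a) * sqrt (1 + a)))).
  { apply Rmult_lt_0_compat; [nra|]. nra. }
  replace (/ a ^ 2 * (a ^ 2 * ((1 + a) * sqrt (1 + a))))%R with ((1 + a) * sqrt (1 + a))%R by (field; lra).
  replace (4 * / ((1 + a) * sqrt (1 + a)) * (a ^ 2 * ((1 + a) * sqrt (1 + a))))%R with (4 * a ^ 2)%R by (field; lra).
  apply Rle_trans with ((1 + a) * (1 + a))%R; [apply Rmult_le_compat_l; lra|]. nra.
Qed.

(** From [exp (t / 4) >= t / 4]. *)
Lemma exp_neg_bound t : 0 < t -> exp (- t) <= 256 * / t ^ 4.
Proof.
  intros H. rewrite exp_Ropp.
  replace (256 * / t ^ 4)%R with (/ ((t / 4) ^ 4))%R by (field; lra).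
  assert (0 < (t / 4) ^ 4) by (apply pow_lt; lra).
  apply Rinv_le_contravar; [auto|].
  replace (exp t) with (exp (t / 4) ^ 4)%R.
  - apply pow_incr. pose proof (exp_ineq1_le (t / 4)). lra.
  - replace t with (t / 4 + (t / 4 + (t / 4 + t / 4)))%R at 2 by field.
    rewrite !exp_plus. ring.
Qed.

Lemma Im_nat_mult m z : Im (INR m * z) = (INR m * Im z)%R.
Proof. destruct z; unfold Im; simpl. ring. Qed.

Lemma Im_R_mult (r : R) z : Im (r * z) = (r * Im z)%R.
Proof. destruct z; unfold Im; simpl. ring. Qed.

(** Of the exponential decay in [m] only the order [m^(-4)] is kept: two derivatives in
[tau] cost a factor [m^2], and [m^(-2)] is still summable. *)
Lemma qterm_decay y0 : 0 < y0 -> exists X, 1 <= X /\ forall z m, y0 <= Im z -> (0 < m)%nat ->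
  Cmod (qterm (INR m * z)) <= X * / INR m ^ 4 /\ Cmod (qratio (INR m * z)) <= X.
Proof.
  intros H0. pose proof PI_RGT_0. set (al := (2 * PI * y0)%R).
  assert (Ha : 0 < al) by (unfold al; nra).
  assert (E1 : exp (- al) < 1) by (pose proof (exp_increasing (- al) 0 ltac:(lra)) as Q; rewrite exp_0 in Q; exact Q).
  set (D := (1 - exp (- al))%R). assert (HD : 0 < D) by (unfold D; lra).
  assert (HA : 0 < / al ^ 4) by (apply Rinv_0_lt_compat, pow_lt; auto).
  assert (HDD : 0 < / (D * D)) by (apply Rinv_0_lt_compat; nra).
  assert (HD1 : 0 < / D) by (apply Rinv_0_lt_compat; auto).
  exists (1 + 256 * / al ^ 4 * / (D * D) + 2 * / D)%R. split.
  { assert (0 < 256 * / al ^ 4 * / (D * D)) by (repeat apply Rmult_lt_0_compat; lra). lra. }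
  intros z m Hz Hm. assert (H1 : 1 <= INR m) by (apply (le_INR 1); lia).
  assert (Hi : al * INR m <= 2 * PI * Im (INR m * z)).
  { rewrite Im_nat_mult. unfold al.
    apply Rle_trans with (2 * PI * INR m * y0)%R; [right; ring|].
    rewrite <- Rmult_assoc. apply Rmult_le_compat_l; [nra|lra]. }
  set (w := INR m * z) in *.
  assert (Hn : Cmod (nome w) <= exp (- (al * INR m))).
  { rewrite Cmod_nome. destruct Hi as [Hi|Hi]; [left; apply exp_increasing; lra|rewrite Hi; lra]. }
  assert (Hn1 : exp (- (al * INR m)) <= exp (- al)).
  { destruct H1 as [H1|H1]; [left; apply exp_increasing; nra|rewrite <- H1, Rmult_1_r; lra]. }
  assert (HDn : D <= Cmod (1 - nome w)).
  { pose proof (Cmod_sub_le 1 (- nome w)) as Q. rewrite Cmod_1, Cmod_opp in Q. unfold D, Cminus. lra. }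
  assert (Hm4 : 0 < / INR m ^ 4) by (apply Rinv_0_lt_compat, pow_lt; lra).
  assert (Hinv : / Cmod (1 - nome w) <= / D) by (apply Rinv_le_contravar; auto).
  split.
  - unfold qterm, Cdiv. rewrite Cmod_mult, Cmod_inv', Cmod_mult.
    assert (A : Cmod (nome w) <= 256 * / al ^ 4 * / INR m ^ 4).
    { eapply Rle_trans; [exact Hn|]. eapply Rle_trans; [apply exp_neg_bound; nra|].
      right. field. split; lra. }
    assert (B : / (Cmod (1 - nome w) * Cmod (1 - nome w)) <= / (D * D)).
    { apply Rinv_le_contravar; [nra|]. apply Rmult_le_compat; lra. }
    apply Rle_trans with (256 * / al ^ 4 * / INR m ^ 4 * / (D * D))%R.
    + apply Rmult_le_compat; auto using Cmod_ge_0. left. apply Rinv_0_lt_compat. nra.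
    + nra.
  - unfold qratio, Cdiv. rewrite Cmod_mult, Cmod_inv'.
    assert (Cmod (1 + nome w) <= 2).
    { eapply Rle_trans; [apply Cmod_triangle|]. rewrite Cmod_1. lra. }
    assert (0 < 256 * / al ^ 4 * / (D * D)) by (repeat apply Rmult_lt_0_compat; lra).
    apply Rle_trans with (2 * / D)%R; [|lra].
    apply Rmult_le_compat; auto using Cmod_ge_0. left. apply Rinv_0_lt_compat. lra.
Qed.

Lemma qpow_decay X z m j : 1 <= X -> (0 < m)%nat -> Cmod (qterm (INR m * z)) <= X * / INR m ^ 4 ->
  Cmod (qpow (S j) (INR m * z)) <= X ^ (S j) * / INR m ^ 4.
Proof.
  intros HX Hm H. assert (H1 : 1 <= INR m) by (apply (le_INR 1); lia).
  assert (H4 : 0 < / INR m ^ 4 <= 1).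
  { split; [apply Rinv_0_lt_compat, pow_lt; lra|]. rewrite <- Rinv_1. apply Rinv_le_contravar; [lra|].
    apply pow_R1_Rle. exact H1. }
  unfold qpow. rewrite Cmod_pow. simpl.
  assert (Cmod (qterm (INR m * z)) <= X) by nra.
  assert (Cmod (qterm (INR m * z)) ^ j <= X ^ j) by (apply pow_incr; split; [apply Cmod_ge_0|auto]).
  apply Rle_trans with (X * / INR m ^ 4 * X ^ j)%R; [|right; simpl; ring].
  apply Rmult_le_compat; auto using Cmod_ge_0. apply pow_le, Cmod_ge_0.
Qed.

Definition qsum (P : nat -> Prop) (j : nat) (z : C) : C := Sum P (fun m => qpow j (INR m * z)).

Lemma inv4_wt m : (0 < m)%nat -> / INR m ^ 4 <= 4 * wt (Z.of_nat m) /\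
  INR m * / INR m ^ 4 <= 4 * wt (Z.of_nat m) /\ INR m * INR m * / INR m ^ 4 <= 4 * wt (Z.of_nat m).
Proof.
  intros Hm. pose proof (inv_sq_wt m Hm) as W. assert (H1 : 1 <= INR m) by (apply (le_INR 1); lia).
  set (a := INR m) in *.
  assert (E : (/ a ^ 2 = a * a * / a ^ 4)%R) by (field; lra).
  assert (H4 : 0 < / a ^ 4) by (apply Rinv_0_lt_compat, pow_lt; lra).
  rewrite E in W.
  assert (1 * / a ^ 4 <= a * a * / a ^ 4) by (apply Rmult_le_compat_r; nra).
  assert (a * / a ^ 4 <= a * a * / a ^ 4) by (apply Rmult_le_compat_r; nra). lra.
Qed.

Lemma qpow_bounds y0 j : 0 < y0 -> exists B, 0 <= B /\ forall z m, y0 <= Im z -> (0 < m)%nat ->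
  Cmod (qpow (S j) (INR m * z)) <= B * / INR m ^ 4 /\
  Cmod (two_pi_i * dqpow (S j) (INR m * z)) <= B * / INR m ^ 4 /\
  Cmod (two_pi_i * (two_pi_i * ddqpow (S j) (INR m * z))) <= B * / INR m ^ 4.
Proof.
  intros H0. destruct (qterm_decay y0 H0) as [X [HX H]].
  set (J := INR (S j)). assert (HJ : 0 < J) by (apply lt_0_INR; lia).
  set (c := Cmod two_pi_i). assert (Hc : 0 <= c) by apply Cmod_ge_0.
  set (A0 := (X ^ S j)%R). set (A1 := (X ^ S (S j))%R).
  assert (P0 : 0 <= A0) by (apply pow_le; lra). assert (P1 : 0 <= A1) by (apply pow_le; lra).
  set (T := (J * J * A0 + (4 * (J * J) + 2 * J) * A1)%R).
  assert (HT : 0 <= T) by (apply Rplus_le_le_0_compat; apply Rmult_le_pos; auto; nra).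
  assert (Q1 : 0 <= c * (J * A1)) by (apply Rmult_le_pos; [|apply Rmult_le_pos]; lra).
  assert (Q2 : 0 <= c * (c * T)) by (apply Rmult_le_pos; [|apply Rmult_le_pos]; lra).
  exists (A0 + c * (J * A1) + c * (c * T))%R. split; [lra|]. intros z m Hz Hm.
  destruct (H z m Hz Hm) as [D1 D2].
  pose proof (qpow_decay X z m j HX Hm D1) as D3. pose proof (qpow_decay X z m (S j) HX Hm D1) as D4.
  fold A0 in D3. fold A1 in D4.
  assert (Hv : 0 < / INR m ^ 4) by (apply Rinv_0_lt_compat, pow_lt, lt_0_INR, Hm).
  set (v := (/ INR m ^ 4)%R) in *. set (w := INR m * z) in *.
  assert (D5 : Cmod (dqpow (S j) w) <= J * A1 * v).
  { unfold dqpow. rewrite !Cmod_mult, (Cmod_RtoC_nonneg (INR (S j))) by apply pos_INR. fold J.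
    rewrite Rmult_assoc. apply Rmult_le_compat_l; [lra|].
    apply Rle_trans with (A0 * v * X)%R; [|right; unfold A0, A1; simpl; ring].
    apply Rmult_le_compat; auto using Cmod_ge_0. }
  assert (D6 : Cmod (ddqpow (S j) w) <= T * v).
  { unfold ddqpow. replace (INR (S j) * INR (S j) * qpow (S j) w + (4 * (INR (S j) * INR (S j)) + 2 * INR (S j)) * qpow (S (S j)) w)
      with (RtoC (J * J)%R * qpow (S j) w + RtoC (4 * (J * J) + 2 * J)%R * qpow (S (S j)) w)
      by (unfold J; rewrite RtoC_plus, !RtoC_mult; ring).
    eapply Rle_trans; [apply Cmod_triangle|].
    rewrite !Cmod_mult, (Cmod_RtoC_nonneg (J * J)), (Cmod_RtoC_nonneg (4 * (J * J) + 2 * J)) by nra.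
    apply Rle_trans with (J * J * (A0 * v) + (4 * (J * J) + 2 * J) * (A1 * v))%R; [|right; unfold T; ring].
    apply Rplus_le_compat; (apply Rmult_le_compat_l; [nra|assumption]). }
  rewrite !(Cmod_mult two_pi_i). fold c.
  assert (D7 : c * Cmod (dqpow (S j) w) <= c * (J * A1 * v)) by (apply Rmult_le_compat_l; auto).
  assert (D8 : c * (c * Cmod (ddqpow (S j) w)) <= c * (c * (T * v))) by (do 2 (apply Rmult_le_compat_l; auto)).
  assert (A0 * v >= 0 /\ c * (J * A1) * v >= 0 /\ c * (c * T) * v >= 0)
    by (split; [|split]; apply Rle_ge, Rmult_le_pos; lra).
  repeat split; lra.
Qed.

Lemma qsum_has_sum (P : nat -> Prop) j z : (forall m, P m -> (0 < m)%nat) -> 0 < Im z ->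
  has_sum P (fun m => qpow (S j) (INR m * z)) (qsum P (S j) z).
Proof.
  intros HP Hz. destruct (qpow_bounds (Im z) j Hz) as [B [HB H]].
  apply Sum_spec. apply summable_has_sum with (B := (B * 4 * 6)%R).
  apply (sums_below_le _ _ (fun m => B * 4 * wt (Z.of_nat m))%R).
  - intros m Hm. specialize (HP m Hm).
    eapply Rle_trans; [apply H; [lra|exact HP]|].
    rewrite Rmult_assoc. apply Rmult_le_compat_l; [lra|]. apply inv4_wt, HP.
  - apply sums_below_scal; [lra|apply wt_nat_summable].
Qed.

Lemma qsum_holomorphic (P : nat -> Prop) j z : (forall m, P m -> (0 < m)%nat) -> 0 < Im z ->
  exists l, qder (qsum P (S j)) z l.
Proof.
  intros HP Hz. destruct (qpow_bounds (Im z / 2) j ltac:(lra)) as [B [HB H]].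
  set (f1 := fun m w => INR m * (two_pi_i * dqpow (S j) (INR m * w))).
  set (f2 := fun m w => INR m * (INR m * (two_pi_i * (two_pi_i * ddqpow (S j) (INR m * w))))).
  assert (S1 : has_sum P (fun m => f1 m z) (Sum P (fun m => f1 m z))).
  { apply Sum_spec. apply summable_has_sum with (B := (B * 4 * 6)%R).
    apply (sums_below_le _ _ (fun m => B * 4 * wt (Z.of_nat m))%R).
    - intros m Hm. specialize (HP m Hm). destruct (H z m ltac:(lra) HP) as [_ [D _]].
      unfold f1. rewrite Cmod_mult, (Cmod_RtoC_nonneg (INR m)) by apply pos_INR.
      apply Rle_trans with (B * (INR m * / INR m ^ 4))%R.
      + pose proof (pos_INR m). apply (Rmult_le_compat_l (INR m)) in D; lra.
      + rewrite Rmult_assoc. apply Rmult_le_compat_l; auto. apply inv4_wt, HP.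
    - apply sums_below_scal; [lra|apply wt_nat_summable]. }
  exists (Sum P (fun m => f1 m z)).
  apply (qder_sum P (fun m w => qpow (S j) (INR m * w)) f1 f2
    (fun m => B * 4 * wt (Z.of_nat m))%R (B * 4 * 6) (Im z / 2)).
  - lra.
  - apply sums_below_scal; [lra|apply wt_nat_summable].
  - lra.
  - intros h Hh. apply qsum_has_sum; auto. pose proof (ball_upper z h Hz Hh). lra.
  - exact S1.
  - intros m h Hm Hh. specialize (HP m Hm). pose proof (ball_upper z h Hz Hh) as [Hw _].
    assert (Hmw : 0 < Im (INR m * (z + h))).
    { rewrite Im_nat_mult. apply Rmult_lt_0_compat; [apply lt_0_INR, HP|lra]. }
    split; [|split].
    + apply qder_dilate, qder_qpow, Hmw.
    + unfold f1, f2. apply qder_scal. apply (qder_dilate (fun w => two_pi_i * dqpow (S j) w)). apply qder_scal, qder_dqpow, Hmw.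
    + destruct (H (z + h) m Hw HP) as [_ [_ D]].
      unfold f2. rewrite !(Cmod_mult (INR m)), !(Cmod_RtoC_nonneg (INR m)) by apply pos_INR.
      apply Rle_trans with (B * (INR m * INR m * / INR m ^ 4))%R.
      * pose proof (pos_INR m). do 2 apply (Rmult_le_compat_l (INR m)) in D; lra.
      * rewrite (Rmult_assoc B 4). apply Rmult_le_compat_l; auto. apply inv4_wt, HP.
Qed.

(** * Telescoping sums over the integers *)

Lemma Csum_snoc {I} (f : I -> C) L a : Csum f (L ++ a :: nil) = Csum f L + f a.
Proof. rewrite Csum_app. simpl. ring. Qed.

Lemma Csum_zlist_tele (F : Z -> C) N :
  Csum (fun m => F (m + 1)%Z - F m) (zlist N) = F (Z.of_nat N) - F (- Z.of_nat N)%Z.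
Proof.
  unfold zlist. rewrite Csum_app, !Csum_map. induction N as [|N IH].
  - simpl. ring.
  - rewrite seq_S, !Csum_snoc, !Nat.add_0_l.
    match goal with |- ?A + ?B + (?D + ?E) = _ => transitivity ((A + D) + (B + E)); [ring|] end.
    rewrite IH.
    replace (- Z.of_nat (S N) + 1)%Z with (- Z.of_nat N)%Z by lia.
    replace (Z.of_nat N + 1)%Z with (Z.of_nat (S N)) by lia. ring.
Qed.

Lemma Clim_tele (F : Z -> C) vp vm (n : nat) :
  Clim (fun N => F (Z.of_nat N)) vp -> Clim (fun N => F (- Z.of_nat N)%Z) vm ->
  Clim (fun N => Csum (fun m => F (m + Z.of_nat n)%Z - F m) (zlist N)) (INR n * (vp - vm)).
Proof.
  intros Hp Hm. induction n as [|n IH].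
  - apply (Clim_ext (fun _ => 0)).
    + intros N. change (Z.of_nat 0) with 0%Z. induction (zlist N) as [|a l IH]; simpl; [reflexivity|]. rewrite <- IH, Z.add_0_r. ring.
    + replace (INR 0 * (vp - vm)) with (RtoC 0) by (simpl; ring). apply Clim_const.
  - rewrite S_INR, RtoC_plus. replace ((INR n + 1) * (vp - vm)) with ((vp - vm) + INR n * (vp - vm)) by ring.
    apply (Clim_ext (fun N => Csum (fun m => (fun m => F (m + Z.of_nat n)%Z) (m + 1)%Z - (fun m => F (m + Z.of_nat n)%Z) m) (zlist N)
      + Csum (fun m => F (m + Z.of_nat n)%Z - F m) (zlist N))).
    + intros N. rewrite <- Csum_plus. apply Csum_ext. intros m _. cbv beta.
      replace (m + Z.of_nat (S n))%Z with (m + 1 + Z.of_nat n)%Z by lia. ring.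
    + apply Clim_plus; [|exact IH].
      apply (Clim_ext (fun N => F (Z.of_nat (N + n)) - F (- Z.of_nat N + Z.of_nat n)%Z)).
      * intros N. rewrite (Csum_zlist_tele (fun m => F (m + Z.of_nat n)%Z)). rewrite Nat2Z.inj_add. reflexivity.
      * apply Clim_minus; [apply (Clim_shift (fun N => F (Z.of_nat N))), Hp|].
        intros eps He. destruct (Hm eps He) as [N0 HN0]. exists (N0 + n)%nat. intros N HN.
        replace (- Z.of_nat N + Z.of_nat n)%Z with (- Z.of_nat (N - n))%Z by lia. apply HN0. lia.
Qed.

Lemma zlist_exhausts : forall m, allZ m -> exists N, forall M, (N <= M)%nat -> In m (zlist M).
Proof. intros m _. exists (S (Z.to_nat (Z.abs m))). intros M HM. apply In_zlist. lia. Qed.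

(** Only limits of partial sums over symmetric intervals enter; [c] shifts at each end
contribute one limit value each. *)
Lemma tele (F : Z -> C) vp vm (c : Z) t :
  Clim (fun N => F (Z.of_nat N)) vp -> Clim (fun N => F (- Z.of_nat N)%Z) vm ->
  has_sum allZ (fun m => F (m + c)%Z - F m) t -> t = IZR c * (vp - vm).
Proof.
  intros Hp Hm.
  assert (P : forall (n : nat) t, has_sum allZ (fun m => F (m + Z.of_nat n)%Z - F m) t -> t = INR n * (vp - vm)).
  { intros n u H. eapply Clim_unique; [|apply (Clim_tele F vp vm n Hp Hm)].
    apply (has_sum_exhaust _ _ _ _ H).
    - intros N. split; [apply NoDup_zlist|]. apply Forall_forall. unfold allZ. auto.
    - apply zlist_exhausts. }
  intros H. destruct (Z_le_gt_dec 0 c) as [L|L].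
  - rewrite <- (Z2Nat.id c L) in H |- *. rewrite <- INR_IZR_INZ. apply P, H.
  - assert (H' : has_sum allZ (fun m => F (m + Z.of_nat (Z.to_nat (- c)))%Z - F m) (- (1) * t)).
    { apply (has_sum_Zshift _ c).
      refine (has_sum_ext _ _ _ _ _ (has_sum_scal _ (- (1)) _ _ H)).
      intros m _. replace (m + c + Z.of_nat (Z.to_nat (- c)))%Z with m by lia. ring. }
    apply P in H'. rewrite INR_IZR_INZ, Z2Nat.id, opp_IZR, RtoC_opp in H' by lia.
    replace t with (- (- (1) * t)) by ring. rewrite H'. ring.
Qed.

Lemma finite_min {I} (f : I -> R) (L : list I) : (forall i, In i L -> 0 < f i) ->
  exists c, 0 < c /\ forall i, In i L -> c <= f i.
Proof.
  induction L as [|a L IH]; intros H.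
  - exists 1%R. split; [lra|]. intros i [].
  - destruct IH as [c [Hc H']]; [intros; apply H; right; auto|].
    exists (Rmin c (f a)). split; [apply Rmin_glb_lt; auto; apply H; left; auto|].
    intros i [<-|Hi]; [apply Rmin_r|]. eapply Rle_trans; [apply Rmin_l|auto].
Qed.

(** Only finitely many translates of [a] come close to [0], and none is [0]. *)
Lemma big1_nonint a : (forall e : Z, a + IZR e <> 0) -> exists K, forall e, big1 K e (a + IZR e).
Proof.
  intros H.
  assert (Hb : exists c, 0 < c /\ forall e, c <= Cmod (a + IZR e)).
  { destruct (finite_min (fun e => Cmod (a + IZR e)) (zlist (Z.to_nat (up (Cmod a)) + 2))) as [c [Hc Hc']].
    { intros e _. apply Cmod_gt_0, H. }
    exists (Rmin c 1). split; [apply Rmin_glb_lt; lra|]. intros e.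
    destruct (in_dec Z.eq_dec e (zlist (Z.to_nat (up (Cmod a)) + 2))) as [Hi|Hi].
    - eapply Rle_trans; [apply Rmin_l|auto].
    - eapply Rle_trans; [apply Rmin_r|]. rewrite In_zlist in Hi.
      destruct (archimed (Cmod a)) as [A1 A2]. pose proof (Cmod_ge_0 a).
      assert (0 <= up (Cmod a))%Z by (apply le_IZR; lra).
      assert (B : IZR (up (Cmod a) + 1) <= IZR (Z.abs e)) by (apply IZR_le; lia).
      rewrite plus_IZR in B. rewrite abs_IZR in B.
      pose proof (Cmod_sub_le (IZR e) a) as Q. rewrite Cmod_R, Cplus_comm in Q. lra. }
  destruct Hb as [c [Hc Hb]]. exists (1 + (1 + Cmod a) / c)%R. intros e. unfold big1.
  specialize (Hb e). pose proof (Cmod_ge_0 a). rewrite abs_IZR.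
  pose proof (Cmod_sub_le (IZR e) a) as Q. rewrite Cmod_R, Cplus_comm in Q.
  pose proof (le_scaled (1 + Cmod a) c _ Hc Hb ltac:(lra)). lra.
Qed.

Lemma pair_has_sum a b : (forall e : Z, a + IZR e <> 0) -> (forall e : Z, b + IZR e <> 0) ->
  exists t, has_sum allZ (fun e => / (a + IZR e) - / (b + IZR e)) t.
Proof.
  intros Ha Hb. destruct (big1_nonint a Ha) as [K1 H1]. destruct (big1_nonint b Hb) as [K2 H2].
  set (K := Rmax K1 K2).
  assert (B1 : forall e, big1 K e (a + IZR e)) by (intros e; apply (big1_mono K1); [apply Rmax_l|auto]).
  assert (B2 : forall e, big1 K e (b + IZR e)) by (intros e; apply (big1_mono K2); [apply Rmax_r|auto]).
  apply summable_has_sum with (B := (Cmod (b - a) * (K ^ 2) * 6)%R).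
  apply (sums_below_le _ _ (fun e => Cmod (b - a) * K ^ 2 * wt e)%R).
  - intros e _. replace (/ (a + IZR e) - / (b + IZR e)) with ((b - a) * / (a + IZR e) * / (b + IZR e)) by (field; auto).
    rewrite !Cmod_mult, !Cmod_inv', !Rmult_assoc. apply Rmult_le_compat_l; [apply Cmod_ge_0|].
    apply (wt_big1 K e); auto.
  - apply sums_below_scal; [|apply wt_summable]. apply Rmult_le_pos; [apply Cmod_ge_0|apply pow2_ge_0].
Qed.

Lemma Clim_0_bound u K : (forall N, Cmod (u N) <= K / (1 + INR N)) -> Clim u 0.
Proof.
  intros H eps He.
  assert (HK : 0 <= K) by (specialize (H O); pose proof (Cmod_ge_0 (u O)); simpl in H; lra).
  destruct (archimed (K / eps)) as [A _].
  assert (HKe : 0 <= K / eps) by (apply Rdiv_le_0_compat; lra).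
  exists (Z.to_nat (up (K / eps))). intros N HN.
  replace (u N - 0) with (u N) by ring. eapply Rle_lt_trans; [apply H|].
  assert (HN' : K / eps < 1 + INR N).
  { apply le_INR in HN. rewrite (INR_IZR_INZ (Z.to_nat _)), Z2Nat.id in HN; [lra|].
    apply le_IZR. lra. }
  apply (Rmult_lt_reg_r (1 + INR N)); [lra|]. unfold Rdiv. rewrite Rmult_assoc, Rinv_l, Rmult_1_r by lra.
  apply (Rmult_lt_compat_l eps) in HN'; [|lra]. replace (eps * (K / eps))%R with K in HN' by (field; lra). lra.
Qed.

(** Within one row, a shift by an integer does not change a sum of simple poles. *)
Lemma tele0 a (c : Z) : (forall e : Z, a + IZR e <> 0) ->
  has_sum allZ (fun e => / (a + IZR c + IZR e) - / (a + IZR e)) 0.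
Proof.
  intros Ha. destruct (pair_has_sum (a + IZR c) a) as [t Ht]; auto.
  { intros e. specialize (Ha (c + e)%Z). rewrite plus_IZR, RtoC_plus in Ha. intros E. apply Ha. rewrite <- E. ring. }
  assert (E : t = IZR c * (0 - 0)).
  { destruct (big1_nonint a Ha) as [K HK].
    assert (HB : forall e, Cmod (/ (a + IZR e)) <= K / (1 + IZR (Z.abs e))).
    { intros e. specialize (HK e). pose proof (big1_nz _ _ _ HK) as Nz. apply Cmod_gt_0 in Nz.
      unfold big1 in HK. pose proof (IZR_abs_ge_0 e). rewrite Cmod_inv'.
      apply (Rmult_le_reg_r (Cmod (a + IZR e) * (1 + IZR (Z.abs e)))); [nra|].
      field_simplify; [|lra|lra]. lra. }
    apply (tele (fun e => / (a + IZR e))).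
    - apply (Clim_0_bound _ K). intros N. eapply Rle_trans; [apply HB|]. rewrite Z.abs_eq, <- INR_IZR_INZ by lia. lra.
    - apply (Clim_0_bound _ K). intros N. eapply Rle_trans; [apply HB|].
      rewrite Z.abs_opp, Z.abs_eq, <- INR_IZR_INZ by lia. lra.
    - refine (has_sum_ext _ _ _ _ _ Ht). intros e _. cbv beta. rewrite plus_IZR, RtoC_plus. do 2 f_equal. ring. }
  replace (RtoC 0) with t; [exact Ht|]. rewrite E. ring.
Qed.

(** * The cotangent and its jump *)

Lemma off_axis_nz a : Im a <> 0%R -> forall e : Z, a + IZR e <> 0.
Proof. intros H e E. apply H. apply (f_equal Im) in E. rewrite Im_plus in E. simpl in E. lra. Qed.

Lemma Im_Ci : Im Ci = 1%R. Proof. reflexivity. Qed.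

(** The difference [pi cot (pi a) - pi cot (pi i)] as an absolutely convergent sum. *)
Definition cotdiff (a : C) : C := Sum allZ (fun e => / (a + IZR e) - / (Ci + IZR e)).

Lemma cotdiff_has_sum a : Im a <> 0%R -> has_sum allZ (fun e => / (a + IZR e) - / (Ci + IZR e)) (cotdiff a).
Proof.
  intros H. apply Sum_spec, pair_has_sum; apply off_axis_nz; auto. rewrite Im_Ci. lra.
Qed.

Lemma cotdiff_sub a b : Im a <> 0%R -> Im b <> 0%R ->
  has_sum allZ (fun e => / (a + IZR e) - / (b + IZR e)) (cotdiff a - cotdiff b).
Proof.
  intros Ha Hb. refine (has_sum_ext _ _ _ _ _ (has_sum_minus _ _ _ _ _ (cotdiff_has_sum a Ha) (cotdiff_has_sum b Hb))).
  intros; ring.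
Qed.

Lemma cotdiff_periodic a (n : Z) : Im a <> 0%R -> cotdiff (a + IZR n) = cotdiff a.
Proof.
  intros H.
  assert (H' : Im (a + IZR n) <> 0%R) by (rewrite Im_plus; simpl; lra).
  pose proof (has_sum_unique _ _ _ _ (cotdiff_sub _ _ H' H) (tele0 a n (off_axis_nz a H))) as E.
  replace (cotdiff (a + IZR n)) with (cotdiff (a + IZR n) - cotdiff a + cotdiff a) by ring. rewrite E. ring.
Qed.

Lemma cotdiff_opp a : Im a <> 0%R -> cotdiff (- a) = - cotdiff a + cotdiff (- Ci).
Proof.
  intros H.
  assert (H' : Im (- a) <> 0%R) by (change (Im (- a)) with (- Im a)%R; lra).
  assert (Hi : Im (- Ci) <> 0%R) by (change (Im (- Ci)) with (- Im Ci)%R; rewrite Im_Ci; lra).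
  assert (E : cotdiff (- a) - cotdiff (- Ci) = - (1) * cotdiff a).
  { apply (has_sum_unique _ _ _ _ (cotdiff_sub _ _ H' Hi)).
    apply has_sum_Zopp. refine (has_sum_ext _ _ _ _ _ (has_sum_scal _ (- (1)) _ _ (cotdiff_has_sum a H))).
    intros e _. cbv beta. rewrite opp_IZR, RtoC_opp.
    replace (- a + - IZR e) with (- (a + IZR e)) by ring.
    replace (- Ci + - IZR e) with (- (Ci + IZR e)) by ring. rewrite !Cinv_opp. ring. }
  replace (cotdiff (- a)) with (cotdiff (- a) - cotdiff (- Ci) + cotdiff (- Ci)) by ring. rewrite E. ring.
Qed.

Lemma qder_cotdiff z : 0 < Im z -> qder cotdiff z (- rowsum 2 z).
Proof.
  intros Hz. destruct (ball_big1 z Hz) as [K [HK0 HK]].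
  apply (qder_sum allZ (fun d w => / (w + IZR d) - / (Ci + IZR d)) (fun d w => - (1) * invpow 2 (w + IZR d))
    (fun d w => - (1) * (- INR 2 * invpow 3 (w + IZR d)))
    (fun d => 2 * K ^ 3 * wt d)%R (2 * K ^ 3 * 6) (Im z / 2)).
  - lra.
  - apply sums_below_scal; [|apply wt_summable]. pose proof (pow_le K 3 HK0). lra.
  - pose proof (pow_le K 3 HK0). lra.
  - intros h Hh. apply cotdiff_has_sum. pose proof (ball_upper z h Hz Hh). lra.
  - replace (- rowsum 2 z) with (- (1) * rowsum 2 z) by ring. apply has_sum_scal. apply (rowsum_has_sum 0). lra.
  - intros d h _ Hh. specialize (HK h d Hh). pose proof (big1_nz _ _ _ HK) as N.
    pose proof (fun j => qder_invpow_translate j (IZR d) (z + h) N) as Q.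
    split; [|split].
    + apply (qder_eq _ _ (- INR 1 * invpow 2 (z + h + IZR d) - 0)); [|simpl; ring].
      apply (qder_minus (fun w => / (w + IZR d)) (fun _ => / (Ci + IZR d))); [|apply qder_const].
      apply (qder_ext (fun w => invpow 1 (w + IZR d)) _ _ _ 1%R); [lra| |apply Q].
      intros h' _. unfold invpow. simpl. ring.
    + apply qder_scal, Q.
    + rewrite !Cmod_mult, !Cmod_opp, (Cmod_RtoC_nonneg (INR 2)), Cmod_1 by apply pos_INR.
      pose proof (invpow_big1 1 K d _ HK) as W. change (2 + 1)%nat with 3%nat in W. simpl INR. lra.
Qed.

(** The function [pi i - pi cot (pi z)], written with the nome. *)
Definition fcot (z : C) : C := two_pi_i * / (1 - nome z).

Lemma qder_fcot z : 0 < Im z -> qder fcot z (rowsum 2 z).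
Proof.
  intros H. pose proof (one_minus_nome z H) as N. rewrite rowsum2_eq_qterm by exact H.
  apply (qder_eq _ _ (two_pi_i * (- - (two_pi_i * nome z) / ((1 - nome z) * (1 - nome z))))).
  - apply qder_scal. apply (qder_inv (fun z => 1 - nome z)); [apply qder_one_minus_nome|exact N].
  - unfold qterm. field. exact N.
Qed.

(** Both sides vanish at [Ci] and have derivative [- rowsum 2]. *)
Lemma cotdiff_fcot z : 0 < Im z -> cotdiff z = fcot Ci - fcot z.
Proof.
  intros Hz.
  assert (Z0 : cotdiff Ci = 0).
  { apply Sum_eq. apply has_sum_0. intros; ring. }
  assert (E : (fun w => cotdiff w + fcot w) (Ci + (z - Ci)) = (fun w => cotdiff w + fcot w) Ci).
  { apply (zero_derivative (fun w => cotdiff w + fcot w)). intros t Ht.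
    assert (Hi : 0 < Im (Ci + t * (z - Ci))).
    { rewrite Im_plus, Im_R_mult, Im_Ci. unfold Cminus. rewrite Im_plus. change (Im (- Ci)) with (- 1)%R. nra. }
    apply (qder_eq _ _ (- rowsum 2 (Ci + t * (z - Ci)) + rowsum 2 (Ci + t * (z - Ci)))); [|ring].
    apply qder_plus; [apply qder_cotdiff|apply qder_fcot]; auto. }
  cbv beta in E. replace (Ci + (z - Ci)) with z in E by ring. rewrite Z0 in E.
  replace (cotdiff z) with (cotdiff z + fcot z - fcot z) by ring. rewrite E. ring.
Qed.

(** The limit of [cotdiff] at [+ i oo]. *)
Definition vplus : C := fcot Ci - two_pi_i.

(** The jump of [pi cot (pi z)] from [- i oo] to [+ i oo], that is [- two_pi_i]; the value at
[- i oo] comes from the one at [+ i oo] by oddness of the cotangent. *)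
Definition kappa : C := 2 * vplus - cotdiff (- Ci).

Lemma fcot_limit y (a : nat -> C) : 0 < y -> (forall N, y * (INR N) <= Im (a N)) ->
  Clim (fun N => fcot (a N)) two_pi_i.
Proof.
  intros Hy Ha. pose proof PI_RGT_0. pose proof (Cmod_ge_0 two_pi_i).
  assert (Hd : 0 < 2 * PI * y) by nra.
  intros eps He.
  (* The distance to the limit is the modulus of [two_pi_i * q / (1 - q)] at [q = nome (a N)]. *)
  set (M := (Cmod two_pi_i * 2 + 1)%R). assert (HM : 0 < M) by (unfold M; lra).
  set (dl := Rmin (1 / 2) (eps / M)).
  assert (Hdl : 0 < dl) by (apply Rmin_glb_lt; [lra|apply Rdiv_lt_0_compat; lra]).
  destruct (archimed (/ dl / (2 * PI * y))) as [A _].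
  assert (Hpos : 0 < / dl / (2 * PI * y)) by (apply Rdiv_lt_0_compat; [apply Rinv_0_lt_compat|]; auto).
  exists (Z.to_nat (up (/ dl / (2 * PI * y)))). intros N HN.
  apply le_INR in HN. rewrite (INR_IZR_INZ (Z.to_nat _)), Z2Nat.id in HN by (apply le_IZR; lra).
  assert (HN1 : / dl < 2 * PI * Im (a N)).
  { apply Rlt_le_trans with (2 * PI * y * INR N)%R.
    - apply (Rmult_lt_reg_r (/ (2 * PI * y))); [apply Rinv_0_lt_compat, Hd|].
      replace (2 * PI * y * INR N * / (2 * PI * y))%R with (INR N) by (field; nra). unfold Rdiv in A, HN. lra.
    - specialize (Ha N). rewrite Rmult_assoc. apply Rmult_le_compat_l; lra. }
  assert (Hq : Cmod (nome (a N)) < dl).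
  { rewrite Cmod_nome, exp_Ropp. pose proof (exp_ineq1_le (2 * PI * Im (a N))).
    pose proof (Rinv_0_lt_compat _ Hdl). rewrite <- (Rinv_inv dl). apply Rinv_lt_contravar; [|lra].
    apply Rmult_lt_0_compat; lra. }
  assert (Hh : dl <= 1 / 2) by apply Rmin_l.
  assert (Hn : 1 - nome (a N) <> 0) by (apply one_minus_nz; lra).
  unfold fcot. replace (two_pi_i * / (1 - nome (a N)) - two_pi_i) with (two_pi_i * nome (a N) * / (1 - nome (a N))) by (field; exact Hn).
  rewrite !Cmod_mult, Cmod_inv'.
  assert (Hb : 1 / 2 <= Cmod (1 - nome (a N))).
  { pose proof (Cmod_sub_le 1 (- nome (a N))) as Q. rewrite Cmod_1, Cmod_opp in Q. unfold Cminus. lra. }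
  assert (Hi : / Cmod (1 - nome (a N)) <= 2).
  { replace 2%R with (/ (1 / 2))%R by field. apply Rinv_le_contravar; lra. }
  assert (Hi0 : 0 < / Cmod (1 - nome (a N))) by (apply Rinv_0_lt_compat; lra).
  assert (Hde : dl * M <= eps).
  { apply Rle_trans with (eps / M * M)%R; [|right; field; lra].
    apply Rmult_le_compat_r; [lra|apply Rmin_r]. }
  pose proof (Cmod_ge_0 (nome (a N))).
  apply Rle_lt_trans with (Cmod two_pi_i * Cmod (nome (a N)) * 2)%R.
  - apply Rmult_le_compat_l; [nra|lra].
  - unfold M in Hde. nra.
Qed.

Lemma cotdiff_limit_up y (a : nat -> C) : 0 < y -> (forall N, y * (INR N) <= Im (a N)) ->
  (forall N, 0 < Im (a N)) -> Clim (fun N => cotdiff (a N)) vplus.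
Proof.
  intros Hy Ha Hp. apply (Clim_ext (fun N => fcot Ci - fcot (a N))).
  - intros N. symmetry. apply cotdiff_fcot, Hp.
  - apply Clim_minus; [apply Clim_const|]. apply (fcot_limit y); auto.
Qed.

Lemma cotdiff_limit_down y (a : nat -> C) : 0 < y -> (forall N, y * (INR N) <= - Im (a N)) ->
  (forall N, Im (a N) < 0) -> Clim (fun N => cotdiff (a N)) (vplus - kappa).
Proof.
  intros Hy Ha Hp. apply (Clim_ext (fun N => (-(1)) * cotdiff (- a N) + cotdiff (- Ci))).
  - intros N. specialize (Hp N). replace (a N) with (- - a N) at 2 by ring.
    rewrite (cotdiff_opp (- a N)); [ring|]. change (Im (- a N)) with (- Im (a N))%R. lra.
  - unfold kappa. replace (vplus - (2 * vplus - cotdiff (- Ci))) with (-(1) * vplus + cotdiff (- Ci)) by ring.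
    apply Clim_plus; [|apply Clim_const]. apply Clim_scal.
    apply (cotdiff_limit_up y); auto; intros N; change (Im (- a N)) with (- Im (a N))%R; auto.
    specialize (Hp N). lra.
Qed.

(** * Eisenstein series of weight at least three *)

Definition lat (tau : C) (p : Z * Z) : C := IZR (fst p) * tau + IZR (snd p).

Definition rows (P : Z -> Prop) : Z * Z -> Prop := fun p => P (fst p) /\ allZ (snd p).

(** The imaginary part of [al tau + be] controls [al], and then its modulus controls
[be]. *)
Lemma big_real tau al be m d e A : 0 < Im tau -> 0 < e -> 0 <= A ->
  e <= Cmod (RtoC al * tau + RtoC be) ->
  Rabs (IZR m) <= Rabs al + A -> Rabs (IZR d) <= Rabs be + A ->
  big (/ Im tau + 1 + Cmod tau / Im tau + (1 + A) / e) m d (RtoC al * tau + RtoC be).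
Proof.
  intros Hy He HA Hw Hm Hd. set (w := RtoC al * tau + RtoC be) in *.
  assert (Hal : Rabs al <= Cmod w / Im tau).
  { pose proof (im_le_Cmod w) as Q. unfold w in Q at 1. rewrite Im_plus, Im_R_mult in Q.
    change (Im (RtoC be)) with 0%R in Q. rewrite Rplus_0_r, Rabs_mult, (Rabs_pos_eq (Im tau)) in Q by lra.
    apply (Rmult_le_reg_r (Im tau)); [lra|]. unfold Rdiv. rewrite Rmult_assoc, Rinv_l by lra. lra. }
  assert (Hbe : Rabs be <= Cmod w + Cmod w / Im tau * Cmod tau).
  { rewrite <- Cmod_R. replace (RtoC be) with (w + - (RtoC al * tau)) by (unfold w; ring).
    eapply Rle_trans; [apply Cmod_triangle|]. rewrite Cmod_opp, Cmod_mult, Cmod_R.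
    apply Rplus_le_compat_l. apply Rmult_le_compat_r; [apply Cmod_ge_0|exact Hal]. }
  pose proof (le_scaled (1 + A) e _ He Hw ltac:(lra)) as H1.
  pose proof (Cmod_ge_0 w). pose proof (Cmod_ge_0 tau).
  assert (0 < / Im tau) by (apply Rinv_0_lt_compat; lra).
  assert (0 <= Cmod w / Im tau) by (apply Rdiv_le_0_compat; lra).
  assert (0 <= Cmod w / Im tau * Cmod tau) by (apply Rmult_le_pos; lra).
  assert (E : ((/ Im tau + 1 + Cmod tau / Im tau + (1 + A) / e) * Cmod w
     = Cmod w / Im tau + Cmod w + Cmod w / Im tau * Cmod tau + (1 + A) / e * Cmod w)%R).
  { unfold Rdiv. ring. }
  split; unfold big1; rewrite E, abs_IZR; lra.
Qed.

Lemma lattice_big tau : 0 < Im tau -> exists K, 0 < K /\ forall m d, (m, d) <> (0, 0)%Z -> big K m d (lat tau (m, d)).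
Proof.
  intros Hy. set (e := Rmin (Im tau) 1). assert (He : 0 < e) by (apply Rmin_glb_lt; lra).
  exists (/ Im tau + 1 + Cmod tau / Im tau + (1 + 0) / e)%R. split.
  { assert (0 < / Im tau) by (apply Rinv_0_lt_compat; lra). pose proof (Cmod_ge_0 tau).
    assert (0 <= Cmod tau / Im tau) by (apply Rdiv_le_0_compat; lra).
    assert (0 <= (1 + 0) / e) by (apply Rdiv_le_0_compat; lra). lra. }
  intros m d H. unfold lat. simpl fst. simpl snd. apply big_real; try lra.
  destruct (Z.eq_dec m 0) as [->|Hm].
  - assert (d <> 0)%Z by congruence. rewrite Cmult_0_l, Cplus_0_l, Cmod_R, <- abs_IZR.
    eapply Rle_trans; [apply Rmin_r|]. apply (IZR_le 1). lia.
  - eapply Rle_trans; [apply Rmin_l|]. eapply Rle_trans; [|apply im_le_Cmod].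
    rewrite Im_plus, Im_R_mult. change (Im (RtoC (IZR d))) with 0%R. rewrite Rplus_0_r, Rabs_mult, (Rabs_pos_eq (Im tau)) by lra.
    rewrite <- abs_IZR. assert (1 <= IZR (Z.abs m)) by (apply (IZR_le 1); lia). nra.
Qed.

(** The half-integral coefficient of [tau] keeps these points off the real axis. *)
Lemma half_lattice_big tau (c d0 : Z) : 0 < Im tau -> exists K, forall m d,
  big K m d (tau / 2 + (IZR c * tau + IZR d0) + lat tau (m, d)).
Proof.
  intros Hy. set (A := (Rabs (IZR c) + 1 + Rabs (IZR d0))%R).
  pose proof (Rabs_pos (IZR c)). pose proof (Rabs_pos (IZR d0)).
  exists (/ Im tau + 1 + Cmod tau / Im tau + (1 + A) / (Im tau / 2))%R. intros m d.
  set (al := (IZR (m + c) + 1 / 2)%R). set (be := IZR (d + d0)).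
  replace (tau / 2 + (IZR c * tau + IZR d0) + lat tau (m, d)) with (RtoC al * tau + RtoC be).
  2:{ unfold lat, al, be. simpl fst. simpl snd. rewrite RtoC_plus, RtoC_half, !plus_IZR, !RtoC_plus. field. }
  apply big_real; unfold A; try lra.
  - eapply Rle_trans; [|apply im_le_Cmod].
    rewrite Im_plus, Im_R_mult. change (Im (RtoC be)) with 0%R. rewrite Rplus_0_r, Rabs_mult, (Rabs_pos_eq (Im tau)) by lra.
    assert (1 / 2 <= Rabs al); [|nra]. unfold al.
    destruct (Z_le_gt_dec 0 (m + c)) as [L|L].
    + apply (IZR_le 0) in L. rewrite Rabs_pos_eq; lra.
    + assert (IZR (m + c) <= -1) by (apply IZR_le; lia). rewrite Rabs_left; lra.
  - replace (IZR m) with (al + - IZR c + - (1 / 2))%R by (unfold al; rewrite plus_IZR; ring).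
    eapply Rle_trans; [apply Rabs_triang|]. eapply Rle_trans; [apply Rplus_le_compat_r, Rabs_triang|].
    rewrite !Rabs_Ropp, (Rabs_pos_eq (1 / 2)) by lra. lra.
  - replace (IZR d) with (be + - IZR d0)%R by (unfold be; rewrite plus_IZR; ring).
    eapply Rle_trans; [apply Rabs_triang|]. rewrite Rabs_Ropp. lra.
Qed.

Lemma row_has_sum k m tau : 0 < Im tau ->
  has_sum allZ (fun d => invpow (2 + k) (lat tau (m, d))) (rowsum (2 + k) (IZR m * tau)).
Proof.
  intros H. unfold lat. simpl fst. simpl snd. destruct (Z.eq_dec m 0) as [->|Hm].
  - replace (IZR 0 * tau) with (RtoC 0) by ring. apply rowsum_has_sum_0.
  - apply rowsum_has_sum. rewrite Im_R_mult. intros E. apply Rmult_integral in E. destruct E as [E|E]; [|lra].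
    apply Hm. apply eq_IZR, E.
Qed.

Lemma lat_00 tau : lat tau (0, 0)%Z = 0.
Proof. unfold lat. simpl. ring. Qed.

Lemma lattice_sum_exists P k tau : 0 < Im tau ->
  exists t, has_sum (rows P) (fun p => invpow (3 + k) (lat tau p)) t.
Proof.
  intros H. destruct (lattice_big tau H) as [K [HK HB]].
  apply summable_has_sum with (B := (K ^ (3 + k) * 36)%R).
  apply (sums_below_le _ _ (fun p => K ^ (3 + k) * wt2 p)%R).
  - intros [m d] _. destruct (excluded_middle_informative ((m, d) = (0, 0)%Z)) as [E|E].
    + rewrite E, lat_00. change (3 + k)%nat with (S (S (S k))). rewrite invpow_0, Cmod_0.
      apply Rmult_le_pos; [apply pow_le; lra|]. unfold wt2. apply Rmult_le_pos; left; apply wt_pos.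
    + apply invpow_big, HB, E.
  - apply sums_below_scal; [apply pow_le; lra|]. apply wt2_summable.
Qed.

Definition eis (k : nat) (P : Z -> Prop) (tau : C) : C := Sum P (fun m => rowsum k (IZR m * tau)).

(** For weight at least three the sum by rows is the absolutely convergent sum over
the lattice. *)
Lemma eis_lattice P k tau : 0 < Im tau ->
  has_sum (rows P) (fun p => invpow (3 + k) (lat tau p)) (eis (3 + k) P tau).
Proof.
  intros H. destruct (lattice_sum_exists P k tau H) as [t Ht].
  assert (E : has_sum P (fun m => rowsum (3 + k) (IZR m * tau)) t).
  { apply (has_sum_fubini P allZ _ _ _ Ht). intros m _. apply (row_has_sum (S k)), H. }
  unfold eis. rewrite (Sum_eq _ _ _ E). exact Ht.
Qed.

(** The row vector [p] times the matrix [g]. *)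
Definition act (g : SL2Z) (p : Z * Z) : Z * Z :=
  (fst p * ma g + snd p * mc g, fst p * mb g + snd p * md g)%Z.

Lemma act_reindex g (P : Z -> Prop) (f : Z * Z -> C) t :
  (forall m d, P (m * ma g + d * mc g)%Z <-> P m) ->
  has_sum (rows P) f t -> has_sum (rows P) (fun p => f (act g p)) t.
Proof.
  intros HP. apply (has_sum_reindex (rows P) (rows P) (act g)).
  - intros [m d] [H _]. split; [|exact I]. apply HP, H.
  - intros [m d] [m' d'] _ _ E. unfold act in E. simpl in E. injection E as E1 E2.
    pose proof (SL2Z_det g) as D.
    assert (m = m' * (ma g * md g - mb g * mc g))%Z.
    { transitivity ((m * ma g + d * mc g) * md g - (m * mb g + d * md g) * mc g)%Z.
      - replace m with (m * 1)%Z at 1 by ring. rewrite <- D. ring.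
      - rewrite E1, E2. ring. }
    assert (d = d' * (ma g * md g - mb g * mc g))%Z.
    { transitivity (- (m * ma g + d * mc g) * mb g + (m * mb g + d * md g) * ma g)%Z.
      - replace d with (d * 1)%Z at 1 by ring. rewrite <- D. ring.
      - rewrite E1, E2. ring. }
    rewrite D in *. f_equal; lia.
  - intros [m d] [H _]. pose proof (SL2Z_det g) as D.
    assert (E1 : ((m * md g - d * mc g) * ma g + (- m * mb g + d * ma g) * mc g = m)%Z).
    { replace m with (m * 1)%Z at 3 by ring. rewrite <- D. ring. }
    assert (E2 : ((m * md g - d * mc g) * mb g + (- m * mb g + d * ma g) * md g = d)%Z).
    { replace d with (d * 1)%Z at 3 by ring. rewrite <- D. ring. }
    exists (m * md g - d * mc g, - m * mb g + d * ma g)%Z. split.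
    + split; [|exact I]. simpl. apply (HP _ (- m * mb g + d * ma g)%Z). rewrite E1. exact H.
    + unfold act. simpl. rewrite E1, E2. reflexivity.
Qed.

Lemma automorphy_nz g tau : 0 < Im tau -> automorphy g tau <> 0.
Proof.
  intros H E. unfold automorphy, ZtoC in E.
  assert (E1 : (IZR (mc g) * Im tau = 0)%R).
  { apply (f_equal Im) in E. rewrite Im_plus, Im_R_mult in E. simpl in E. lra. }
  apply Rmult_integral in E1. destruct E1 as [E1|E1]; [|lra].
  rewrite E1, Cmult_0_l, Cplus_0_l in E. apply RtoC_inj in E.
  apply eq_IZR in E1. apply eq_IZR in E. pose proof (SL2Z_det g). rewrite E, E1 in H0. lia.
Qed.

(** The lattice of the transformed point is, up to the factor of automorphy, the
original lattice with its points permuted by [act g]. *)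
Lemma lat_moebius g tau p : 0 < Im tau ->
  lat (moebius g tau) p = lat tau (act g p) / automorphy g tau.
Proof.
  intros H. pose proof (automorphy_nz g tau H) as N. unfold moebius, lat, act. simpl fst. simpl snd.
  rewrite !plus_IZR, !mult_IZR, !RtoC_plus, !RtoC_mult.
  assert (E : RtoC (IZR (snd p)) = RtoC (IZR (snd p)) * automorphy g tau / automorphy g tau) by (field; exact N).
  rewrite E at 1. unfold automorphy, ZtoC in *. field. exact N.
Qed.

Lemma Im_moebius g tau : 0 < Im tau ->
  Im (moebius g tau) = (Im tau / Cmod (automorphy g tau) ^ 2)%R.
Proof.
  intros H. pose proof (automorphy_nz g tau H) as N. apply Cmod_gt_0 in N.
  rewrite Cmod2_alt in *.
  assert (D : (IZR (ma g) * IZR (md g) - IZR (mb g) * IZR (mc g) = 1)%R).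
  { rewrite <- !mult_IZR, <- minus_IZR, SL2Z_det. reflexivity. }
  assert (N2 : (Re (automorphy g tau) ^ 2 + Im (automorphy g tau) ^ 2 <> 0)%R).
  { rewrite <- Cmod2_alt. apply pow_nonzero. lra. }
  revert N2. unfold moebius, automorphy, ZtoC. destruct tau as [u v]. unfold Re, Im, Cdiv, Cinv, Cmult, Cplus, RtoC. simpl.
  intros N2. set (a := IZR (ma g)) in *. set (b := IZR (mb g)) in *. set (c := IZR (mc g)) in *. set (d := IZR (md g)) in *.
  transitivity ((v * (a * d - b * c)) / ((c * u - 0 * v + d) * ((c * u - 0 * v + d) * 1) + (c * v + 0 * u + 0) * ((c * v + 0 * u + 0) * 1)))%R.
  - field. intros E. apply N2. etransitivity; [|exact E]. ring.
  - rewrite D. f_equal. ring.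
Qed.

Lemma moebius_upper g tau : 0 < Im tau -> 0 < Im (moebius g tau).
Proof.
  intros H. rewrite Im_moebius by exact H. apply Rdiv_lt_0_compat; [exact H|].
  apply pow_lt, Cmod_gt_0, automorphy_nz, H.
Qed.

Lemma invpow_div k (w j : C) : j <> 0 -> invpow k (w / j) = Cpow j k * invpow k w.
Proof.
  intros Hj. unfold invpow. rewrite <- Cpow_mult_l. f_equal.
  destruct (excluded_middle_informative (w = 0)) as [->|Hw].
  - replace (0 / j) with (RtoC 0) by (field; exact Hj). rewrite Cinv_0. ring.
  - field. auto.
Qed.

Lemma eis_modular g P k tau : 0 < Im tau -> (forall m d, P (m * ma g + d * mc g)%Z <-> P m) ->
  eis (3 + k) P (moebius g tau) = Cpow (automorphy g tau) (3 + k) * eis (3 + k) P tau.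
Proof.
  intros H HP. pose proof (eis_lattice P k _ (moebius_upper g tau H)) as A.
  apply (has_sum_unique _ _ _ _ A).
  refine (has_sum_ext _ (fun p => Cpow (automorphy g tau) (3 + k) * invpow (3 + k) (lat tau (act g p))) _ _ _ _).
  - intros p _. rewrite lat_moebius by exact H. symmetry. apply invpow_div, automorphy_nz, H.
  - apply (act_reindex g P (fun p => Cpow (automorphy g tau) (3 + k) * invpow (3 + k) (lat tau p))); [exact HP|].
    apply has_sum_scal. apply eis_lattice, H.
Qed.

(** * The Eisenstein series of weight two *)

(** Over the lattice [w^(-2)] is not absolutely summable. The difference of simple poles
cancels [lam / w^2] to leading order and leaves terms of order [|w|^(-3)]. *)
Definition reg (z lam w : C) : C := lam * invpow 2 w + (/ (z + lam + w) - / (z + w)).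

Lemma reg_bound tau (c d0 : Z) : 0 < Im tau -> exists B, 0 <= B /\ forall p,
  Cmod (reg (tau / 2) (lat tau (c, d0)) (lat tau p)) <= B * wt2 p.
Proof.
  intros H. destruct (lattice_big tau H) as [K1 [HK1 H1]].
  destruct (half_lattice_big tau 0 0 H) as [K2 H2]. destruct (half_lattice_big tau c d0 H) as [K3 H3].
  set (z := tau / 2) in *. set (lam := lat tau (c, d0)).
  set (K := Rmax K1 (Rmax K2 K3)).
  assert (L1 : K1 <= K) by apply Rmax_l.
  assert (L2 : K2 <= K) by (eapply Rle_trans; [apply Rmax_l|apply Rmax_r]).
  assert (L3 : K3 <= K) by (eapply Rle_trans; [apply Rmax_r|apply Rmax_r]).
  set (T0 := Cmod (reg z lam 0)).
  set (C1 := Cmod (lam * (2 * z + lam))). set (C2 := Cmod (lam * (z * (z + lam)))).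
  assert (P1 : 0 <= C1) by apply Cmod_ge_0. assert (P2 : 0 <= C2) by apply Cmod_ge_0.
  assert (P0 : 0 <= T0) by apply Cmod_ge_0.
  assert (HKp : 0 < K) by lra. assert (HK3 : 0 < K ^ 3) by (apply pow_lt; lra).
  exists (T0 + (C1 + C2 * K) * K ^ 3)%R. split.
  { assert (0 <= C2 * K) by nra. nra. }
  intros [m e]. assert (W : 0 <= wt2 (m, e)) by (unfold wt2; apply Rmult_le_pos; left; apply wt_pos).
  assert (HC : 0 <= (C1 + C2 * K) * K ^ 3) by (assert (0 <= C2 * K) by nra; nra).
  destruct (excluded_middle_informative ((m, e) = (0, 0)%Z)) as [E|E].
  - rewrite E, lat_00. fold T0.
    assert (wt2 (0, 0)%Z = 1%R) as ->.
    { unfold wt2, wt. simpl. rewrite Rplus_0_r, sqrt_1. field. }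
    lra.
  - set (w := lat tau (m, e)).
    assert (B1 : big K m e w) by (apply (big_mono K1); auto; apply H1, E).
    assert (B2 : big K m e (z + w)).
    { apply (big_mono K2); auto. replace (z + w) with (z + (IZR 0 * tau + IZR 0) + w) by ring. apply H2. }
    assert (B3 : big K m e (z + lam + w)) by (apply (big_mono K3); auto; apply H3).
    pose proof (big1_nz _ _ _ (proj1 B1)) as N1. pose proof (big1_nz _ _ _ (proj1 B2)) as N2.
    pose proof (big1_nz _ _ _ (proj1 B3)) as N3.
    assert (E2 : reg z lam w = lam * (2 * z + lam) * (/ w * / (z + lam + w) * / (z + w))
       + lam * (z * (z + lam)) * (/ w * (/ w * / (z + lam + w) * / (z + w)))).
    { unfold reg, invpow. simpl. field. auto. }
    rewrite E2. eapply Rle_trans; [apply Cmod_triangle|].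
    rewrite (Cmod_mult (lam * (2 * z + lam))), (Cmod_mult (lam * (z * (z + lam)))). fold C1 C2.
    pose proof (wt_big K m e _ _ _ B1 B3 B2) as V.
    destruct (big1_K _ _ _ (proj1 B1)) as [[Q0 Q] _].
    set (V0 := Cmod (/ w * / (z + lam + w) * / (z + w))).
    assert (HV : V0 <= K ^ 3 * wt2 (m, e)) by (unfold V0; rewrite !Cmod_mult, !Cmod_inv'; exact V).
    assert (HV0 : 0 <= V0) by apply Cmod_ge_0.
    rewrite (Cmod_mult (/ w)). fold V0. rewrite Cmod_inv'.
    assert (S1 : / Cmod w * V0 <= K * (K ^ 3 * wt2 (m, e))) by (apply Rmult_le_compat; auto).
    apply (Rmult_le_compat_l C1) in HV; [|auto]. apply (Rmult_le_compat_l C2) in S1; [|auto].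
    assert (0 <= T0 * wt2 (m, e)) by (apply Rmult_le_pos; auto).
    eapply Rle_trans; [apply Rplus_le_compat; [exact HV|exact S1]|]. lra.
Qed.

Lemma reg_sum_exists P tau (c d0 : Z) : 0 < Im tau ->
  exists t, has_sum (rows P) (fun p => reg (tau / 2) (lat tau (c, d0)) (lat tau p)) t.
Proof.
  intros H. destruct (reg_bound tau c d0 H) as [B [HB HR]].
  apply summable_has_sum with (B := (B * 36)%R).
  apply (sums_below_le _ _ (fun p => B * wt2 p)%R); [intros; apply HR|].
  apply sums_below_scal; [exact HB|apply wt2_summable].
Qed.

(** The value of the cotangent on the [m]-th row of the lattice shifted by [tau / 2]. *)
Definition cotrow (tau : C) (m : Z) : C := cotdiff ((IZR m + 1 / 2) * tau).

Lemma Im_half_row tau m : 0 < Im tau -> Im ((IZR m + 1 / 2) * tau) = ((IZR m + 1 / 2) * Im tau)%R.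
Proof.
  intros H. replace (IZR m + 1 / 2) with (RtoC (IZR m + 1 / 2)%R) by (rewrite RtoC_plus, RtoC_half; reflexivity).
  apply Im_R_mult.
Qed.

Lemma half_int_nz m : (IZR m + 1 / 2)%R <> 0%R.
Proof.
  intros E. assert (E2 : IZR (2 * m + 1) = 0%R) by (rewrite plus_IZR, mult_IZR; lra).
  apply eq_IZR in E2. lia.
Qed.

Lemma reg_rows P tau (c d0 : Z) t : 0 < Im tau ->
  has_sum (rows P) (fun p => reg (tau / 2) (lat tau (c, d0)) (lat tau p)) t ->
  has_sum P (fun m => lat tau (c, d0) * rowsum 2 (IZR m * tau) + (cotrow tau (m + c) - cotrow tau m)) t.
Proof.
  intros H Ht. apply (has_sum_fubini P allZ _ _ _ Ht). intros m _. unfold reg.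
  apply has_sum_plus.
  - apply has_sum_scal. apply (row_has_sum 0), H.
  - assert (I1 : Im ((IZR m + 1 / 2) * tau) <> 0%R).
    { rewrite Im_half_row by exact H. apply Rmult_integral_contrapositive. split; [apply half_int_nz|lra]. }
    assert (I2 : Im ((IZR (m + c) + 1 / 2) * tau) <> 0%R).
    { rewrite Im_half_row by exact H. apply Rmult_integral_contrapositive. split; [apply half_int_nz|lra]. }
    assert (I3 : Im ((IZR (m + c) + 1 / 2) * tau + IZR d0) <> 0%R).
    { rewrite Im_plus. change (Im (RtoC (IZR d0))) with 0%R. rewrite Rplus_0_r. exact I2. }
    unfold cotrow. rewrite <- (cotdiff_periodic _ d0 I2).
    refine (has_sum_ext _ _ _ _ _ (cotdiff_sub _ _ I3 I1)). intros e _. unfold lat. simpl fst. simpl snd.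
    rewrite plus_IZR, RtoC_plus. f_equal; f_equal; field.
Qed.

(** For [lam = 1] the simple poles telescope to zero in every row. *)
Lemma eis2_exists P tau : 0 < Im tau -> has_sum P (fun m => rowsum 2 (IZR m * tau)) (eis 2 P tau).
Proof.
  intros H. apply Sum_spec. destruct (reg_sum_exists P tau 0 1 H) as [t Ht]. exists t.
  refine (has_sum_ext _ _ _ _ _ (reg_rows P tau 0 1 t H Ht)). intros m _. rewrite Z.add_0_r.
  unfold lat. simpl. ring.
Qed.

Definition residue_class (n r m : Z) : Prop := (n | m - r)%Z.

Lemma cotrow_limits tau (n r : Z) : (0 < n)%Z -> (0 <= r < n)%Z -> 0 < Im tau ->
  Clim (fun N => cotrow tau (r + n * Z.of_nat N)) vplus /\
  Clim (fun N => cotrow tau (r + n * (- Z.of_nat N))) (vplus - kappa).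
Proof.
  intros Hn Hr H. split.
  - apply (cotdiff_limit_up (Im tau)); [exact H| |].
    + intros N. rewrite Im_half_row by exact H. rewrite Rmult_comm. apply Rmult_le_compat_r; [lra|].
      rewrite INR_IZR_INZ. assert (IZR (Z.of_nat N) <= IZR (r + n * Z.of_nat N)) by (apply IZR_le; nia). lra.
    + intros N. rewrite Im_half_row by exact H.
      assert (0 <= IZR (r + n * Z.of_nat N)) by (apply IZR_le; nia). nra.
  - assert (S1 : Clim (fun N => cotrow tau (r + n * (- Z.of_nat (N + 1)))) (vplus - kappa)).
    { apply (cotdiff_limit_down (Im tau / 2)); [lra| |].
      + intros N. rewrite Im_half_row by exact H.
        assert (B : IZR (r + n * - Z.of_nat (N + 1)) <= IZR (- Z.of_nat N - 1)) by (apply IZR_le; nia).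
        rewrite minus_IZR, opp_IZR, <- INR_IZR_INZ in B. pose proof (pos_INR N). nra.
      + intros N. rewrite Im_half_row by exact H.
        assert (B : IZR (r + n * - Z.of_nat (N + 1)) <= -1) by (apply IZR_le; nia). nra. }
    intros eps He. destruct (S1 eps He) as [N0 HN0]. exists (N0 + 1)%nat. intros N HN.
    specialize (HN0 (N - 1)%nat ltac:(lia)). replace (N - 1 + 1)%nat with N in HN0 by lia. exact HN0.
Qed.

(** The rows of one residue class telescope; their sum is the defect of modularity in
weight two. *)
Lemma row_differences n r tau (c : Z) t : (0 < n)%Z -> (0 <= r < n)%Z -> 0 < Im tau ->
  has_sum (residue_class n r) (fun m => cotrow tau (m + n * c) - cotrow tau m) t ->
  t = IZR c * kappa.
Proof.
  intros Hn Hr H Ht. destruct (cotrow_limits tau n r Hn Hr H) as [L1 L2].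
  assert (E : has_sum allZ (fun M => (fun M => cotrow tau (r + n * M)) (M + c)%Z - (fun M => cotrow tau (r + n * M)) M) t).
  { apply (has_sum_reindex allZ (residue_class n r) (fun M => (r + n * M)%Z)) in Ht.
    - refine (has_sum_ext _ _ _ _ _ Ht). intros M _. cbv beta. do 2 f_equal. ring.
    - intros M _. exists M. ring.
    - intros M M' _ _. nia.
    - intros m [M HM]. exists M. split; [exact I|]. lia. }
  rewrite (tele (fun M => cotrow tau (r + n * M)) _ _ c t L1 L2 E). ring.
Qed.

(** The regularised sum for [lam = j] over the lattice of [tau] is computed by rows in two
ways. In the lattice of [tau] it is [j * eis 2] plus the telescoping cotangents.
In the lattice of the transformed point, which is [1 / j] times the first, [lam]
becomes [1], the poles cancel in each row, and [eis 2] alone remains. *)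
Lemma eis2_class_transform n r g tau : (0 < n)%Z -> (0 <= r < n)%Z -> 0 < Im tau ->
  (n | ma g - 1)%Z -> (n | mc g)%Z ->
  eis 2 (residue_class n r) (moebius g tau) = automorphy g tau *
   (automorphy g tau * eis 2 (residue_class n r) tau + IZR (mc g / n) * kappa).
Proof.
  intros Hn Hr H Ha Hc. set (P := residue_class n r). set (j := automorphy g tau).
  pose proof (automorphy_nz g tau H) as Nj. fold j in Nj.
  assert (HP : forall m d, P (m * ma g + d * mc g)%Z <-> P m).
  { intros m d. unfold P, residue_class. destruct Ha as [a' Ha]. destruct Hc as [c' Hc].
    replace (ma g) with (a' * n + 1)%Z by lia. rewrite Hc. split; intros [q Hq].
    - exists (q - m * a' - d * c')%Z. nia.
    - exists (q + m * a' + d * c')%Z. nia. }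
  destruct (reg_sum_exists P tau (mc g) (md g) H) as [t Ht].
  assert (Ej : lat tau (mc g, md g) = j) by reflexivity.
  (* Rows of the lattice of [tau]. *)
  assert (T : t = j * eis 2 P tau + IZR (mc g / n) * kappa).
  { pose proof (reg_rows P tau _ _ t H Ht) as R1. rewrite Ej in R1.
    pose proof (has_sum_minus _ _ _ _ _ R1 (has_sum_scal _ j _ _ (eis2_exists P tau H))) as R2.
    assert (R3 : has_sum P (fun m => cotrow tau (m + n * (mc g / n)) - cotrow tau m) (t - j * eis 2 P tau)).
    { refine (has_sum_ext _ _ _ _ _ R2). intros m _. rewrite <- Z_div_exact_full_2.
      - ring.
      - lia.
      - apply Znumtheory.Zdivide_mod, Hc. }
    apply row_differences in R3; auto.
    replace t with (t - j * eis 2 P tau + j * eis 2 P tau) by ring. rewrite R3. ring. }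
  rewrite <- T.
  (* Rows of the lattice of the transformed point. *)
  set (tau' := moebius g tau). set (z := tau / 2) in *.
  assert (A : has_sum (rows P) (fun p => j * reg z j (lat tau (act g p))) (j * t)).
  { apply has_sum_scal. rewrite Ej in Ht.
    apply (act_reindex g P (fun p => reg z j (lat tau p))); [exact HP|exact Ht]. }
  assert (Hnz : forall m e, z / j + lat tau' (m, e) <> 0).
  { intros m e E. destruct (half_lattice_big tau 0 0 H) as [K HK].
    specialize (HK (fst (act g (m, e))) (snd (act g (m, e)))).
    apply (big1_nz _ _ _ (proj1 HK)). rewrite <- surjective_pairing.
    transitivity (j * (z / j + lat tau' (m, e))).
    - unfold tau'. rewrite lat_moebius by exact H. fold j z. field. exact Nj.
    - rewrite E. ring. }
  apply (has_sum_unique P (fun m => rowsum 2 (IZR m * tau'))); [apply eis2_exists, moebius_upper, H|].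
  apply (has_sum_fubini P allZ _ _ _ A). intros m _.
  rewrite <- (Cplus_0_r (rowsum 2 _)).
  assert (Hrow : has_sum allZ (fun e => / (z / j + IZR m * tau' + IZR 1 + IZR e) - / (z / j + IZR m * tau' + IZR e)) 0).
  { apply tele0. intros e. rewrite <- Cplus_assoc. apply (Hnz m e). }
  refine (has_sum_ext _ _ _ _ _ (has_sum_plus _ _ _ _ _ (row_has_sum 0 m tau' (moebius_upper g tau H)) Hrow)).
  intros e _. cbv beta. unfold reg.
  assert (El : lat tau (act g (m, e)) = j * lat tau' (m, e)).
  { unfold tau'. rewrite lat_moebius by exact H. fold j. field. exact Nj. }
  rewrite El.
  replace (z / j + IZR m * tau' + IZR 1 + IZR e) with ((z + j + j * lat tau' (m, e)) / j)
    by (unfold lat; simpl fst; simpl snd; field; exact Nj).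
  replace (z / j + IZR m * tau' + IZR e) with ((z + j * lat tau' (m, e)) / j)
    by (unfold lat; simpl fst; simpl snd; field; exact Nj).
  replace (lat tau' (m, e)) with (j * lat tau' (m, e) / j) at 1 by (field; exact Nj).
  rewrite invpow_div by exact Nj.
  assert (Hd : forall w, / (w / j) = j * / w).
  { intros w. pose proof (invpow_div 1 w j Nj) as Q. unfold invpow in Q. simpl in Q. rewrite !Cmult_1_r in Q. exact Q. }
  rewrite !Hd. simpl Cpow. change (2 + 0)%nat with 2%nat. ring.
Qed.

Lemma has_sum_classes (n : Z) (f : Z -> C) (g : Z -> C) (L : list Z) :
  NoDup L -> (forall r, In r L -> (0 <= r < n)%Z) ->
  (forall r, In r L -> has_sum (residue_class n r) f (g r)) ->
  has_sum (fun m => exists r, In r L /\ residue_class n r m) f (Csum g L).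
Proof.
  induction L as [|a L IH]; intros HN HR HS.
  - simpl. apply (has_sum_pred_ext (fun _ => False)).
    + intros m. split; [tauto|]. intros [r [[] _]].
    + intros eps He. exists nil. split; [constructor|]. intros L HL HF _.
      destruct L as [|b L]; [|inversion HF; tauto]. simpl. replace (0 - 0) with (RtoC 0) by ring.
      rewrite Cmod_0. exact He.
  - inversion HN; subst. simpl.
    apply (has_sum_pred_ext (fun m => residue_class n a m \/ exists r, In r L /\ residue_class n r m)).
    + intros m. split.
      * intros [Hm|[r [Hr Hm]]]; [exists a; split; [left|]; auto|exists r; split; [right|]; auto].
      * intros [r [[->|Hr] Hm]]; [left; auto|right; exists r; auto].
    + apply has_sum_union.
      * intros m [q Hq] [r [Hr [q' Hq']]]. apply H1. replace a with r; [exact Hr|].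
        pose proof (HR a (or_introl eq_refl)). pose proof (HR r (or_intror Hr)).
        assert (q = q')%Z; [|subst; lia].
        destruct (Z.lt_trichotomy q q') as [Q|[Q|Q]]; auto; exfalso; nia.
      * apply HS. left; auto.
      * apply IH; auto; intros; [apply HR|apply HS]; right; auto.
Qed.

(** Sum over the residue classes contained in [P]; [nu] is [kappa] times their number. *)
Lemma eis2_transform (n : Z) (P : Z -> Prop) : (0 < n)%Z ->
  (forall m q, P (m + n * q)%Z <-> P m) ->
  exists nu : C, forall g tau, 0 < Im tau -> (n | ma g - 1)%Z -> (n | mc g)%Z ->
  eis 2 P (moebius g tau) = automorphy g tau *
   (automorphy g tau * eis 2 P tau + IZR (mc g / n) * nu).
Proof.
  intros Hn HP.
  set (p := fun r => if excluded_middle_informative (P r) then true else false).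
  set (L := filter p (map Z.of_nat (seq 0 (Z.to_nat n)))).
  assert (HL : forall r, In r L <-> (0 <= r < n)%Z /\ P r).
  { intros r. unfold L. rewrite filter_In, in_map_iff. unfold p. split.
    - intros [[k [<- Hk]] Hp]. apply in_seq in Hk.
      destruct (excluded_middle_informative (P (Z.of_nat k))); [|congruence]. split; [lia|auto].
    - intros [Hr Hp]. split.
      + exists (Z.to_nat r). rewrite in_seq. lia.
      + destruct (excluded_middle_informative (P r)); tauto. }
  assert (HN : NoDup L).
  { apply NoDup_filter. apply FinFun.Injective_map_NoDup; [|apply seq_NoDup]. intros a b. lia. }
  assert (EP : forall m, (exists r, In r L /\ residue_class n r m) <-> P m).
  { intros m. split.
    - intros [r [Hr [q Hq]]]. apply HL in Hr. replace m with (r + n * q)%Z by lia. apply HP, Hr.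
    - intros Hm. exists (m mod n)%Z. split.
      + apply HL. split; [apply Z.mod_pos_bound; lia|].
        apply (HP _ (m / n)%Z). rewrite Z.add_comm, <- Z.div_mod by lia. exact Hm.
      + exists (m / n)%Z. pose proof (Z.div_mod m n ltac:(lia)). lia. }
  assert (EG : forall tau, 0 < Im tau -> eis 2 P tau = Csum (fun r => eis 2 (residue_class n r) tau) L).
  { intros tau H. apply Sum_eq. apply (has_sum_pred_ext _ _ _ _ EP).
    apply (has_sum_classes n _ (fun r => eis 2 (residue_class n r) tau)); auto.
    - intros r Hr. apply HL, Hr.
    - intros r _. apply eis2_exists, H. }
  exists (INR (length L) * kappa). intros g tau H Ha Hc.
  rewrite !EG by auto using moebius_upper.
  assert (HL' : forall r, In r L -> (0 <= r < n)%Z) by (intros r Hr; apply HL, Hr).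
  clear HL HN EP EG HP. revert HL'. generalize L. clear L p. intros L. induction L as [|r L IH]; intros HL.
  - simpl. ring.
  - cbn [Csum]. rewrite IH by (intros; apply HL; right; auto).
    rewrite eis2_class_transform by (auto; apply HL; left; auto).
    change (length (r :: L)) with (S (length L)). rewrite S_INR, RtoC_plus. ring.
Qed.

(** * Polynomials in the inverse of the imaginary part *)

Definition hol (f : C -> C) : Prop := forall z, 0 < Im z -> exists l, qder f z l.

Lemma hol_ext f g : (forall z, 0 < Im z -> f z = g z) -> hol f -> hol g.
Proof.
  intros E H z Hz. destruct (H z Hz) as [l Hl]. exists l.
  apply (qder_ext f _ _ _ (Im z / 2)%R); [lra| |exact Hl].
  intros h Hh. apply E. pose proof (ball_upper z h Hz Hh). lra.
Qed.

Lemma hol_const c : hol (fun _ => c).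
Proof. intros z _. exists 0. apply qder_const. Qed.

Lemma hol_plus f g : hol f -> hol g -> hol (fun z => f z + g z).
Proof. intros Hf Hg z Hz. destruct (Hf z Hz), (Hg z Hz). eexists. apply qder_plus; eauto. Qed.

Lemma hol_mult f g : hol f -> hol g -> hol (fun z => f z * g z).
Proof. intros Hf Hg z Hz. destruct (Hf z Hz), (Hg z Hz). eexists. apply qder_mult; eauto. Qed.

Lemma hol_Csum {I} (f : I -> C -> C) L : (forall i, In i L -> hol (f i)) -> hol (fun z => Csum (fun i => f i z) L).
Proof.
  induction L as [|i L IH]; intros H; [exact (hol_const 0)|].
  apply (hol_plus (f i)); [apply H; left; auto|apply IH; intros; apply H; right; auto].
Qed.

Definition inv_y (tau : C) : C := RtoC (/ Im tau).

(** [f] is a polynomial in [1 / y] with holomorphic coefficients and constant term [g].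
Allowing every truncation [N >= p] lets polynomials of different degrees be added
coefficientwise. *)
Definition ypoly (f g : C -> C) : Prop := exists p (c : nat -> C -> C),
  (forall r, hol (c r)) /\
  (forall tau N, 0 < Im tau -> (p <= N)%nat -> f tau = Csum (fun r => c r tau * Cpow (inv_y tau) r) (seq 0 (S N))) /\
  (forall tau, 0 < Im tau -> g tau = c 0%nat tau).

Lemma Csum_0 {I} (L : list I) : Csum (fun _ => 0) L = 0.
Proof. induction L as [|i L IH]; simpl; [reflexivity|]. rewrite IH. ring. Qed.

Lemma Csum_head (f : nat -> C) N : Csum f (seq 0 (S N)) = f 0%nat + Csum (fun r => f (S r)) (seq 0 N).
Proof. cbn [seq Csum]. rewrite <- seq_shift, Csum_map. reflexivity. Qed.

Lemma ypoly_ext f g f' g' : (forall z, 0 < Im z -> f z = f' z) -> (forall z, 0 < Im z -> g z = g' z) ->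
  ypoly f g -> ypoly f' g'.
Proof.
  intros E E' [p [c [H1 [H2 H3]]]]. exists p, c. split; [exact H1|]. split.
  - intros. rewrite <- E by auto. auto.
  - intros. rewrite <- E' by auto. auto.
Qed.

Lemma ypoly_hol g : hol g -> ypoly g g.
Proof.
  intros H. exists 0%nat, (fun r => match r with O => g | S _ => fun _ => 0 end). split; [|split].
  - intros [|r]; [exact H|apply hol_const].
  - intros tau N _ _. rewrite Csum_head.
    replace (Csum _ (seq 0 N)) with (Csum (fun _ : nat => 0) (seq 0 N)) by (apply Csum_ext; intros; ring).
    rewrite Csum_0. simpl. ring.
  - reflexivity.
Qed.

Lemma ypoly_plus f g f' g' : ypoly f g -> ypoly f' g' -> ypoly (fun z => f z + f' z) (fun z => g z + g' z).
Proof.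
  intros [p [c [H1 [H2 H3]]]] [p' [c' [H1' [H2' H3']]]].
  exists (max p p'), (fun r z => c r z + c' r z). split; [|split].
  - intros r. apply hol_plus; auto.
  - intros tau N Ht HN. rewrite (H2 tau N), (H2' tau N) by (auto; lia). rewrite <- Csum_plus.
    apply Csum_ext. intros; ring.
  - intros. rewrite H3, H3' by auto. reflexivity.
Qed.

Lemma ypoly_hmult h f g : hol h -> ypoly f g -> ypoly (fun z => h z * f z) (fun z => h z * g z).
Proof.
  intros Hh [p [c [H1 [H2 H3]]]].
  exists p, (fun r z => h z * c r z). split; [|split].
  - intros r. apply hol_mult; auto.
  - intros tau N Ht HN. rewrite (H2 tau N) by auto. rewrite <- Csum_scal.
    apply Csum_ext. intros; ring.
  - intros. rewrite H3 by auto. reflexivity.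
Qed.

Lemma ypoly_shift f g : ypoly f g -> ypoly (fun z => inv_y z * f z) (fun _ => 0).
Proof.
  intros [p [c [H1 [H2 H3]]]].
  exists (S p), (fun r => match r with O => fun _ => RtoC 0 | S r => c r end). split; [|split].
  - intros [|r]; [apply hol_const|apply H1].
  - intros tau N Ht HN. destruct N as [|N]; [lia|]. rewrite (H2 tau N) by (auto; lia).
    rewrite (Csum_head _ (S N)), <- Csum_scal, Cmult_0_l, Cplus_0_l. apply Csum_ext. intros r _. simpl. ring.
  - reflexivity.
Qed.

Lemma ypoly_Csum {I} (f g : I -> C -> C) L : (forall i, In i L -> ypoly (f i) (g i)) ->
  ypoly (fun z => Csum (fun i => f i z) L) (fun z => Csum (fun i => g i z) L).
Proof.
  induction L as [|i L IH]; intros H; [exact (ypoly_hol _ (hol_const 0))|].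
  apply (ypoly_plus (f i) (g i)); [apply H; left; auto|apply IH; intros; apply H; right; auto].
Qed.

(** By linearity in the first factor only multiplication by a power of [1 / y] matters,
and this shifts coefficients. *)
Lemma ypoly_mult f g f' g' : ypoly f g -> ypoly f' g' -> ypoly (fun z => f z * f' z) (fun z => g z * g' z).
Proof.
  intros [p [c [H1 [H2 H3]]]] H'.
  assert (HY : forall r, ypoly (fun z => Cpow (inv_y z) r * f' z) (fun z => match r with O => g' z | S _ => 0 end)).
  { induction r as [|r IH].
    - apply (ypoly_ext f' g'); auto; intros; simpl; ring.
    - apply (ypoly_ext (fun z => inv_y z * (Cpow (inv_y z) r * f' z)) (fun _ => 0)); auto.
      + intros; simpl; ring.
      + eapply ypoly_shift, IH. }
  apply (ypoly_ext (fun z => Csum (fun r => c r z * (Cpow (inv_y z) r * f' z)) (seq 0 (S p)))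
    (fun z => Csum (fun r => c r z * match r with O => g' z | S _ => 0 end) (seq 0 (S p)))).
  - intros z Hz. rewrite (H2 z p) by auto. rewrite Cmult_comm, <- Csum_scal. apply Csum_ext. intros; ring.
  - intros z Hz. rewrite Csum_head, H3 by auto.
    replace (Csum _ (seq 0 p)) with (Csum (fun _ : nat => 0) (seq 0 p)) by (apply Csum_ext; intros; ring).
    rewrite Csum_0. ring.
  - apply (ypoly_Csum (fun r z => c r z * (Cpow (inv_y z) r * f' z)) (fun r z => c r z * match r with O => g' z | S _ => 0 end)).
    intros r _. apply (ypoly_hmult (c r) (fun z => Cpow (inv_y z) r * f' z) (fun z => match r with O => g' z | S _ => 0 end)); auto.
Qed.

(** * Quasi-modular forms and their products *)

Definition weighted (Gam : SL2Z -> Prop) (k : nat) (f : C -> C) : Prop :=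
  forall g tau, Gam g -> 0 < Im tau -> f (moebius g tau) = Cpow (automorphy g tau) k * f tau.

(** A form of [quasi_modular] convenient for computation: the invariance is free of
inverses, and coefficients have quadratic remainders. *)
Definition qm Gam k (g : C -> C) : Prop := exists f, weighted Gam k f /\ ypoly f g.

Lemma sum_n_Csum (f : nat -> C) p : sum_n f p = Csum f (seq 0 (S p)).
Proof.
  induction p as [|p IH].
  - rewrite sum_O. simpl. ring.
  - rewrite sum_Sn, IH. rewrite (seq_S (S p)), Csum_snoc. reflexivity.
Qed.

Lemma Cpow_Z_opp a k : Cpow_Z a (- Z.of_nat k) = / Cpow a k.
Proof.
  destruct k as [|k]; simpl.
  - symmetry. field_simplify. reflexivity.
  - rewrite SuccNat2Pos.id_succ. reflexivity.
Qed.

Lemma qm_quasi_modular Gam k g : qm Gam k g -> quasi_modular Gam (Z.of_nat k) g.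
Proof.
  intros [f [Hw [p [c [H1 [H2 H3]]]]]]. exists f, p, c.
  assert (E : inv_y_expansion f p c).
  { split.
    - intros r _ tau Ht. destruct (H1 r tau Ht) as [l Hl]. eapply qder_ex_derive, Hl.
    - intros tau Ht. rewrite sum_n_Csum. apply H2; auto. }
  split; [|split].
  - split; [|eauto]. intros g0 Hg tau Ht. unfold slash. rewrite Cpow_Z_opp, Hw by auto.
    field. apply Cpow_nz, automorphy_nz, Ht.
  - exact E.
  - exact H3.
Qed.

Lemma qm_ext Gam k g g' : (forall z, 0 < Im z -> g z = g' z) -> qm Gam k g -> qm Gam k g'.
Proof. intros E [f [Hw H]]. exists f. split; auto. apply (ypoly_ext f g); auto. Qed.

Lemma qm_plus Gam k g g' : qm Gam k g -> qm Gam k g' -> qm Gam k (fun z => g z + g' z).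
Proof.
  intros [f [Hw H]] [f' [Hw' H']]. exists (fun z => f z + f' z). split; [|apply ypoly_plus; auto].
  intros g0 tau Hg Ht. rewrite Hw, Hw' by auto. ring.
Qed.

Lemma qm_scal Gam k a g : qm Gam k g -> qm Gam k (fun z => a * g z).
Proof.
  intros [f [Hw H]]. exists (fun z => a * f z). split.
  - intros g0 tau Hg Ht. rewrite Hw by auto. ring.
  - apply ypoly_hmult; [apply hol_const|auto].
Qed.

Lemma qm_0 Gam k : qm Gam k (fun _ => 0).
Proof.
  exists (fun _ => 0). split; [intros g0 tau _ _; ring|]. apply ypoly_hol, hol_const.
Qed.

Lemma qm_const Gam a : qm Gam 0 (fun _ => a).
Proof.
  exists (fun _ => a). split; [intros g0 tau _ _; simpl; ring|]. apply ypoly_hol, hol_const.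
Qed.

Lemma qm_mult Gam k k' g g' : qm Gam k g -> qm Gam k' g' -> qm Gam (k + k') (fun z => g z * g' z).
Proof.
  intros [f [Hw H]] [f' [Hw' H']]. exists (fun z => f z * f' z). split; [|apply ypoly_mult; auto].
  intros g0 tau Hg Ht. rewrite Hw, Hw', Cpow_add_r by auto. ring.
Qed.

Definition qmm Gam K (g : C -> C) : Prop := exists f : nat -> C -> C,
  (forall j, (j <= K)%nat -> qm Gam j (f j)) /\
  forall tau, 0 < Im tau -> g tau = Csum (fun j => f j tau) (seq 0 (S K)).

Lemma qmm_quasi_modular_mixed Gam K g : qmm Gam K g -> quasi_modular_mixed Gam K g.
Proof.
  intros [f [H1 H2]]. exists f. split.
  - intros j Hj. apply qm_quasi_modular; auto.
  - intros tau Ht. rewrite sum_n_Csum. apply H2, Ht.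
Qed.

Lemma qmm_ext Gam K g g' : (forall z, 0 < Im z -> g z = g' z) -> qmm Gam K g -> qmm Gam K g'.
Proof. intros E [f [H1 H2]]. exists f. split; auto. intros. rewrite <- E; auto. Qed.

Lemma qmm_plus Gam K g g' : qmm Gam K g -> qmm Gam K g' -> qmm Gam K (fun z => g z + g' z).
Proof.
  intros [f [H1 H2]] [f' [H1' H2']]. exists (fun j z => f j z + f' j z). split.
  - intros j Hj. apply qm_plus; auto.
  - intros. rewrite H2, H2', <- Csum_plus by auto. reflexivity.
Qed.

Lemma qmm_scal Gam K a g : qmm Gam K g -> qmm Gam K (fun z => a * g z).
Proof.
  intros [f [H1 H2]]. exists (fun j z => a * f j z). split.
  - intros j Hj. apply qm_scal; auto.
  - intros. rewrite H2, <- Csum_scal by auto. reflexivity.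
Qed.

Lemma qmm_single Gam K k g : (k <= K)%nat -> qm Gam k g -> qmm Gam K g.
Proof.
  intros Hk H. exists (fun j z => RtoC (if Nat.eq_dec j k then 1 else 0) * g z). split.
  - intros j Hj. destruct (Nat.eq_dec j k) as [->|Ne].
    + apply qm_scal, H.
    + apply (qm_ext _ _ (fun _ => 0)); [intros; ring|apply qm_0].
  - intros tau _. symmetry. apply (Csum_indicator k (S K) (fun _ => g tau)). lia.
Qed.

Lemma qmm_Csum {I} Gam K (f : I -> C -> C) L : (forall i, In i L -> qmm Gam K (f i)) ->
  qmm Gam K (fun z => Csum (fun i => f i z) L).
Proof.
  induction L as [|i L IH]; intros H.
  - apply (qmm_single _ _ 0); [lia|]. apply (qm_0 Gam 0).
  - apply (qmm_plus _ _ (f i)); [apply H; left; auto|apply IH; intros; apply H; right; auto].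
Qed.

Lemma qmm_mono Gam K K' g : (K <= K')%nat -> qmm Gam K g -> qmm Gam K' g.
Proof.
  intros HK [f [H1 H2]].
  apply (qmm_ext _ _ (fun z => Csum (fun j => f j z) (seq 0 (S K)))); [intros; symmetry; auto|].
  apply qmm_Csum. intros j Hj. apply in_seq in Hj. apply (qmm_single _ _ j); [lia|apply H1; lia].
Qed.

Lemma qmm_mult Gam K K' g g' : qmm Gam K g -> qmm Gam K' g' -> qmm Gam (K + K') (fun z => g z * g' z).
Proof.
  intros [f [H1 H2]] [f' [H1' H2']].
  apply (qmm_ext _ _ (fun z => Csum (fun j => Csum (fun j' => f j z * f' j' z) (seq 0 (S K'))) (seq 0 (S K)))).
  - intros z Hz. rewrite H2, H2' by auto. rewrite Cmult_comm, <- Csum_scal. apply Csum_ext. intros j _.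
    rewrite Csum_scal. ring.
  - apply (qmm_Csum _ _ (fun j z => Csum (fun j' => f j z * f' j' z) (seq 0 (S K')))). intros j Hj. apply in_seq in Hj.
    apply (qmm_Csum _ _ (fun j' z => f j z * f' j' z)). intros j' Hj'. apply in_seq in Hj'.
    apply (qmm_single _ _ (j + j')); [lia|]. apply qm_mult; [apply H1|apply H1']; lia.
Qed.

(** * Eisenstein series are quasi-modular *)

Definition positive_part (P : Z -> Prop) (m : nat) : Prop := (0 < m)%nat /\ P (Z.of_nat m).

Definition chi (P : Z -> Prop) : C := if excluded_middle_informative (P 0%Z) then 1 else 0.

Lemma has_sum_even (P : Z -> Prop) (g : Z -> C) t :
  (forall m, P (- m)%Z <-> P m) -> (forall m, g (- m)%Z = g m) ->
  has_sum (positive_part P) (fun m => g (Z.of_nat m)) t -> has_sum P g (chi P * g 0%Z + (t + t)).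
Proof.
  intros HP Hg Ht.
  assert (T1 : has_sum (fun m => (0 < m)%Z /\ P m) g t).
  { apply (has_sum_reindex (positive_part P) _ Z.of_nat); auto.
    - intros m [H1 H2]. split; [lia|auto].
    - intros; lia.
    - intros m [H1 H2]. exists (Z.to_nat m). unfold positive_part. rewrite Z2Nat.id by lia. repeat split; auto. lia. }
  assert (T2 : has_sum (fun m => (m < 0)%Z /\ P m) g t).
  { apply (has_sum_reindex (fun m => (0 < m)%Z /\ P m) _ Z.opp).
    - intros m [H1 H2]. split; [lia|]. apply HP, H2.
    - intros; lia.
    - intros m [H1 H2]. exists (- m)%Z. repeat split; [lia|apply HP, H2|lia].
    - refine (has_sum_ext _ _ _ _ _ T1). intros m _. symmetry. apply Hg. }
  assert (T3 : has_sum (fun m => m = 0%Z /\ P m) g (chi P * g 0%Z)).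
  { unfold chi. destruct (excluded_middle_informative (P 0%Z)) as [H0|H0].
    - rewrite Cmult_1_l. apply (has_sum_pred_ext (fun m => m = 0%Z)); [|apply has_sum_single].
      intros m. split; [intros ->; auto|tauto].
    - rewrite Cmult_0_l. apply (has_sum_ext _ (fun _ => 0)).
      + intros m [-> Hm]. tauto.
      + apply has_sum_0. auto. }
  apply (has_sum_pred_ext (fun m => (m = 0%Z /\ P m) \/ (((0 < m)%Z /\ P m) \/ ((m < 0)%Z /\ P m)))).
  { intros m. split; [tauto|]. intros Hm. destruct (Z.lt_trichotomy m 0) as [L|[L|L]]; tauto. }
  apply has_sum_union; [intros m [-> _]; lia|exact T3|].
  apply has_sum_union; auto. intros; lia.
Qed.

Lemma has_sum_Csum {I J} (P : I -> Prop) (f : J -> I -> C) (t : J -> C) L :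
  (forall j, In j L -> has_sum P (f j) (t j)) -> has_sum P (fun i => Csum (fun j => f j i) L) (Csum t L).
Proof.
  induction L as [|j L IH]; intros H; [apply has_sum_0; reflexivity|].
  simpl. apply has_sum_plus; [apply H; left; auto|apply IH; intros; apply H; right; auto].
Qed.

Definition posrow (P : nat -> Prop) i (tau : C) : C := Sum P (fun m => evenrow i (INR m * tau)).

Lemma Im_pos_mult m tau : (0 < m)%nat -> 0 < Im tau -> 0 < Im (INR m * tau).
Proof. intros Hm H. rewrite Im_nat_mult. apply Rmult_lt_0_compat; [apply lt_0_INR, Hm|exact H]. Qed.

Lemma posrow_spec (P : nat -> Prop) i : (forall m, P m -> (0 < m)%nat) ->
  exists c : nat -> C, forall tau, 0 < Im tau ->
    has_sum P (fun m => evenrow i (INR m * tau)) (Csum (fun j => c j * qsum P (S j) tau) (seq 0 (S i))).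
Proof.
  intros HP. destruct (rowsum_span i) as [c Hc]. exists c. intros tau Ht.
  apply (has_sum_ext _ (fun m => Csum (fun j => c j * qpow (S j) (INR m * tau)) (seq 0 (S i)))).
  - intros m Hm. symmetry. apply Hc, Im_pos_mult; auto.
  - apply (has_sum_Csum P (fun j m => c j * qpow (S j) (INR m * tau))). intros j _.
    apply has_sum_scal, qsum_has_sum; auto.
Qed.

Lemma posrow_has_sum (P : nat -> Prop) i tau : (forall m, P m -> (0 < m)%nat) -> 0 < Im tau ->
  has_sum P (fun m => evenrow i (INR m * tau)) (posrow P i tau).
Proof. intros HP Ht. destruct (posrow_spec P i HP) as [c Hc]. apply Sum_spec. eauto. Qed.

Lemma hol_posrow (P : nat -> Prop) i : (forall m, P m -> (0 < m)%nat) -> hol (posrow P i).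
Proof.
  intros HP. destruct (posrow_spec P i HP) as [c Hc].
  apply (hol_ext (fun tau => Csum (fun j => c j * qsum P (S j) tau) (seq 0 (S i)))).
  - intros tau Ht. symmetry. apply Sum_eq, Hc, Ht.
  - apply (hol_Csum (fun j tau => c j * qsum P (S j) tau)). intros j _. apply hol_mult; [apply hol_const|].
    intros z Hz. apply qsum_holomorphic; auto.
Qed.

(** Evenness of the row sums in [m tau] doubles the positive half and leaves [m = 0]. *)
Lemma eis_posrow (P : Z -> Prop) i tau : (forall m, P (- m)%Z <-> P m) -> 0 < Im tau ->
  eis (2 + 2 * i) P tau = chi P * evenrow i 0 + 2 * posrow (positive_part P) i tau.
Proof.
  intros HP Ht.
  assert (Hpos : forall m, positive_part P m -> (0 < m)%nat) by (intros m [H _]; exact H).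
  apply Sum_eq.
  replace (2 * posrow (positive_part P) i tau) with (posrow (positive_part P) i tau + posrow (positive_part P) i tau) by ring.
  replace (evenrow i 0) with ((fun m => rowsum (2 + 2 * i) (IZR m * tau)) 0%Z) by (unfold evenrow; f_equal; ring).
  apply (has_sum_even P (fun m => rowsum (2 + 2 * i) (IZR m * tau))); auto.
  - intros m. destruct (Z.eq_dec m 0) as [->|Hm]; [reflexivity|].
    rewrite opp_IZR, RtoC_opp. replace (- IZR m * tau) with (- (IZR m * tau)) by ring.
    replace (2 + 2 * i)%nat with (2 * S i)%nat by lia. apply rowsum_even.
    rewrite Im_R_mult. intros E. apply Rmult_integral in E. destruct E as [E|E]; [|lra]. apply Hm, eq_IZR, E.
  - refine (has_sum_ext _ _ _ _ _ (posrow_has_sum _ i tau Hpos Ht)). intros m _. rewrite INR_IZR_INZ. reflexivity.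
Qed.

(** In weight two, [1 / Im (g tau) = j (j - 2 i c y) / y] with [j = c tau + d], so the term
[nu c j / n] in the transformation of [eis 2] is compensated by a multiple of [1 / y]. *)
Lemma eis_qm (n : nat) (P : Z -> Prop) i : (1 <= n)%nat ->
  (forall m q, P (m + Z.of_nat n * q)%Z <-> P m) -> (forall m, P (- m)%Z <-> P m) ->
  qm (Gamma1 n) (2 + 2 * i) (eis (2 + 2 * i) P).
Proof.
  intros Hn Hper Hsym.
  assert (Hhol : hol (eis (2 + 2 * i) P)).
  { apply (hol_ext (fun tau => chi P * evenrow i 0 + 2 * posrow (positive_part P) i tau)).
    - intros tau Ht. symmetry. apply eis_posrow; auto.
    - apply hol_plus; [apply hol_const|]. apply hol_mult; [apply hol_const|]. apply hol_posrow.
      intros m [H _]; exact H. }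
  destruct i as [|i].
  - destruct (eis2_transform (Z.of_nat n) P ltac:(lia) Hper) as [nu Hnu].
    (* [al * (- 2 i c)] has to cancel [nu * c / n]. *)
    set (al := nu / (2 * Ci * IZR (Z.of_nat n))).
    assert (Nn : RtoC (IZR (Z.of_nat n)) <> 0).
    { rewrite <- INR_IZR_INZ. apply RtoC_pos_nz, lt_0_INR. lia. }
    assert (Ni : Ci <> 0) by (intros E; apply (f_equal Im) in E; simpl in E; lra).
    exists (fun tau => eis 2 P tau + al * inv_y tau). split.
    + intros g tau [Ha [_ Hc]] Ht. rewrite Hnu by auto.
      set (j := automorphy g tau) in *.
      pose proof (automorphy_nz g tau Ht) as Nj. fold j in Nj.
      assert (Nt : RtoC (Im tau) <> 0) by (apply RtoC_pos_nz, Ht).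
      assert (EY : inv_y (moebius g tau) = j * (j - 2 * Ci * IZR (mc g) * Im tau) * inv_y tau).
      { unfold inv_y. rewrite Im_moebius by exact Ht. fold j.
        replace (/ (Im tau / Cmod j ^ 2))%R with (Cmod j ^ 2 / Im tau)%R.
        2:{ field. split; [|lra]. apply Rgt_not_eq, Cmod_gt_0, Nj. }
        rewrite RtoC_div, RtoC_inv, Cmod2_conj by lra.
        replace (j - 2 * Ci * IZR (mc g) * Im tau) with (Cconj j); [reflexivity|].
        unfold j, automorphy, ZtoC. destruct tau as [u v]. unfold Cconj, Ci, Cminus, Cmult, Cplus, Copp, RtoC, Im. simpl.
        f_equal; ring. }
      assert (Ec : RtoC (IZR (mc g)) = IZR (Z.of_nat n) * IZR (mc g / Z.of_nat n)).
      { rewrite <- RtoC_mult, <- mult_IZR. do 2 f_equal. apply Z_div_exact_full_2; [lia|].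
        apply Znumtheory.Zdivide_mod, Hc. }
      rewrite EY, Ec. unfold al, inv_y. rewrite RtoC_inv by lra. simpl Cpow. field. auto.
    + apply (ypoly_ext (fun tau => eis 2 P tau + al * (inv_y tau * 1)) (fun tau => eis 2 P tau + al * 0)).
      * intros; ring.
      * intros; simpl; ring.
      * apply ypoly_plus; [apply ypoly_hol, Hhol|]. apply (ypoly_hmult (fun _ => al)); [apply hol_const|].
        apply (ypoly_shift (fun _ => 1) (fun _ => 1)). apply ypoly_hol, hol_const.
  - exists (eis (2 + 2 * S i) P). split; [|apply ypoly_hol, Hhol].
    intros g tau [Ha [_ Hc]] Ht. replace (2 + 2 * S i)%nat with (3 + S (2 * i))%nat by lia.
    apply eis_modular; [exact Ht|]. intros m d. destruct Ha as [a' Ha]. destruct Hc as [c' Hc].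
    replace (m * ma g + d * mc g)%Z with (m + Z.of_nat n * (m * a' + d * c'))%Z by nia. apply Hper.
Qed.

Lemma qsum_qmm (n : nat) (P : Z -> Prop) j : (1 <= n)%nat ->
  (forall m q, P (m + Z.of_nat n * q)%Z <-> P m) -> (forall m, P (- m)%Z <-> P m) ->
  qmm (Gamma1 n) (2 * S j) (qsum (positive_part P) (S j)).
Proof.
  intros Hn Hper Hsym. destruct (qpow_span j) as [c Hc].
  assert (Hpos : forall m, positive_part P m -> (0 < m)%nat) by (intros m [H _]; exact H).
  apply (qmm_ext _ _ (fun tau => Csum (fun i => c i * posrow (positive_part P) i tau) (seq 0 (S j)))).
  - intros tau Ht. symmetry. apply Sum_eq.
    apply (has_sum_ext _ (fun m => Csum (fun i => c i * evenrow i (INR m * tau)) (seq 0 (S j)))).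
    + intros m Hm. symmetry. apply Hc, Im_pos_mult; auto.
    + apply (has_sum_Csum _ (fun i m => c i * evenrow i (INR m * tau))). intros i _.
      apply has_sum_scal, posrow_has_sum; auto.
  - apply (qmm_Csum _ _ (fun i tau => c i * posrow (positive_part P) i tau)). intros i Hi. apply in_seq in Hi.
    apply qmm_scal.
    apply (qmm_ext _ _ (fun tau => (1 / 2) * eis (2 + 2 * i) P tau + (- (1 / 2) * chi P * evenrow i 0))).
    + intros tau Ht. rewrite eis_posrow by auto. field.
    + apply qmm_plus; [apply qmm_scal|].
      * apply (qmm_single _ _ (2 + 2 * i)); [lia|]. apply eis_qm; auto.
      * apply (qmm_single _ _ 0); [lia|]. apply qm_const.
Qed.

(** * Newton's identities *)

Fixpoint esym (l : list C) (k : nat) : C :=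
  match k, l with
  | O, _ => 1
  | S _, nil => 0
  | S k', a :: l' => esym l' k + a * esym l' k'
  end.

Definition psum (l : list C) (j : nat) : C := Csum (fun a => Cpow a j) l.

Definition sgn (i : nat) : C := Cpow (- (1)) i.

Lemma esym_0 l : esym l 0 = 1.
Proof. destruct l; reflexivity. Qed.

(** Telescopes, since [esym (a :: l) (k + 1)] is [esym l (k + 1) + a * esym l k]. *)
Lemma esym_tail a l k :
  Csum (fun i => sgn i * esym (a :: l) (k - i) * Cpow a (S i)) (seq 0 (S k)) = a * esym l k.
Proof.
  induction k as [|k IH].
  - simpl. unfold sgn. rewrite esym_0. simpl. ring.
  - rewrite Csum_head.
    replace (Csum _ (seq 0 (S k))) with ((- a) * Csum (fun i => sgn i * esym (a :: l) (k - i) * Cpow a (S i)) (seq 0 (S k))).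
    + rewrite IH. unfold sgn. simpl. ring.
    + rewrite <- Csum_scal. apply Csum_ext. intros i _. rewrite Nat.sub_succ. unfold sgn. simpl. ring.
Qed.

(** Induction on the list: adjoining [a] adds to the right-hand side the identity for
[l] one degree lower, times [a], and the telescoping sum of [esym_tail]. *)
Lemma newton l k :
  INR (S k) * esym l (S k) = Csum (fun i => sgn i * esym l (k - i) * psum l (S i)) (seq 0 (S k)).
Proof.
  revert k. induction l as [|a l IH]; intros k.
  - simpl esym at 1. rewrite Cmult_0_r. symmetry. etransitivity; [|apply (Csum_0 (seq 0 (S k)))].
    apply Csum_ext. intros i _. unfold psum. simpl. ring.
  - transitivity (Csum (fun i => sgn i * esym (a :: l) (k - i) * psum l (S i)) (seq 0 (S k)) +
      Csum (fun i => sgn i * esym (a :: l) (k - i) * Cpow a (S i)) (seq 0 (S k))).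
    2:{ rewrite <- Csum_plus. apply Csum_ext. intros i _. unfold psum. cbn [Csum]. ring. }
    rewrite esym_tail.
    assert (E : Csum (fun i => sgn i * esym (a :: l) (k - i) * psum l (S i)) (seq 0 (S k))
       = INR (S k) * esym l (S k) + a * (INR k * esym l k)).
    { destruct k as [|k].
      - rewrite IH. simpl. rewrite !esym_0. ring.
      - rewrite IH. rewrite IH. rewrite (seq_S (S k)), !Csum_snoc.
        replace (Csum (fun i => sgn i * esym (a :: l) (S k - i) * psum l (S i)) (seq 0 (S k))) with
          (Csum (fun i => sgn i * esym l (S k - i) * psum l (S i)) (seq 0 (S k)) +
           a * Csum (fun i => sgn i * esym l (k - i) * psum l (S i)) (seq 0 (S k))).
        + rewrite !Nat.add_0_l, !Nat.sub_diag, !esym_0. ring.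
        + rewrite <- Csum_scal, <- Csum_plus. apply Csum_ext. intros i Hi. apply in_seq in Hi.
          replace (S k - i)%nat with (S (k - i)) by lia. cbn [esym]. ring. }
    rewrite E. rewrite (S_INR k), RtoC_plus. cbn [esym]. ring.
Qed.

(** * Elementary symmetric functions of summable families *)

Fixpoint subs {I} (l : list I) (k : nat) : list (list I) :=
  match k, l with
  | O, _ => nil :: nil
  | S _, nil => nil
  | S k', a :: l' => subs l' k ++ map (cons a) (subs l' k')
  end.

Definition mprod {I} (f : I -> C) (t : list I) : C := Cprod_list (map f t).

Lemma subs_esym {I} (f : I -> C) l k : Csum (mprod f) (subs l k) = esym (map f l) k.
Proof.
  revert k. induction l as [|a l IH]; intros [|k]; try (simpl; unfold mprod; simpl; ring).
  cbn [subs map esym]. rewrite Csum_app, Csum_map, IH. f_equal. rewrite <- IH, <- Csum_scal. reflexivity.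
Qed.

(** Expanding the power gives the product over each sublist at least once. *)
Lemma subs_bound {I} (f : I -> C) l k :
  Rsum (fun t => Cmod (mprod f t)) (subs l k) <= Rsum (fun a => Cmod (f a)) l ^ k.
Proof.
  revert k. induction l as [|a l IH]; intros [|k]; try (simpl; unfold mprod; simpl; rewrite Cmod_1; lra).
  - simpl. lra.
  - simpl subs. rewrite Rsum_app, Rsum_map. cbn [Rsum].
    replace (Rsum (fun i => Cmod (mprod f (a :: i))) (subs l k)) with
      (Cmod (f a) * Rsum (fun t => Cmod (mprod f t)) (subs l k))%R.
    2:{ rewrite <- Rsum_scal. apply Rle_antisym; apply Rsum_le; intros t _; unfold mprod; simpl; rewrite Cmod_mult; lra. }
    set (u := Rsum (fun a => Cmod (f a)) l) in *.
    assert (Hu : 0 <= u) by (apply Rsum_pos; intros; apply Cmod_ge_0).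
    pose proof (Cmod_ge_0 (f a)) as Ha. pose proof (IH k) as I1. pose proof (IH (S k)) as I2.
    assert (P : u ^ k <= (Cmod (f a) + u) ^ k) by (apply pow_incr; lra).
    simpl in I2 |- *.
    apply Rle_trans with (u * u ^ k + Cmod (f a) * u ^ k)%R; [nra|].
    apply Rle_trans with ((Cmod (f a) + u) * u ^ k)%R; [right; ring|]. apply Rmult_le_compat_l; lra.
Qed.

Lemma In_subs (l : list nat) k t : StronglySorted lt l ->
  In t (subs l k) <-> length t = k /\ StronglySorted lt t /\ incl t l.
Proof.
  revert k t. induction l as [|a l IH]; intros k t Hl.
  - destruct k as [|k]; simpl.
    + split.
      * intros [<-|[]]. repeat split; [constructor|intros x []].
      * intros [H [_ _]]. destruct t; [auto|discriminate].
    + split; [tauto|]. intros [H [_ Hi]]. destruct t as [|b t]; [discriminate|]. apply (Hi b). left; auto.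
  - inversion Hl as [|? ? Hl' Ha]; subst. rewrite Forall_forall in Ha.
    destruct k as [|k].
    + simpl. split.
      * intros [<-|[]]. repeat split; [constructor|intros x []].
      * intros [H [_ _]]. destruct t; [auto|discriminate].
    + simpl subs. rewrite in_app_iff, in_map_iff, IH by auto. split.
      * intros [[H1 [H2 H3]]|[t' [<- H]]].
        -- repeat split; auto. intros x Hx. right. auto.
        -- apply IH in H; auto. destruct H as [H1 [H2 H3]]. repeat split.
           ++ simpl. congruence.
           ++ constructor; auto. apply Forall_forall. intros x Hx. apply Ha, H3, Hx.
           ++ intros x [<-|Hx]; [left; auto|right; auto].
      * intros [H1 [H2 H3]]. destruct t as [|b t]; [discriminate|].
        inversion H2 as [|? ? H2' Hb]; subst. rewrite Forall_forall in Hb.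
        assert (Hincl : incl t l).
        { intros x Hx. destruct (H3 x (or_intror Hx)) as [<-|Hx']; auto.
          pose proof (Hb a Hx). destruct (H3 b (or_introl eq_refl)) as [<-|Hb']; [lia|].
          pose proof (Ha b Hb'). lia. }
        destruct (H3 b (or_introl eq_refl)) as [<-|Hb'].
        -- right. exists t. split; [reflexivity|]. apply IH; auto.
        -- left. repeat split; auto. intros x [<-|Hx]; auto.
Qed.

Lemma NoDup_subs (l : list nat) k : StronglySorted lt l -> NoDup (subs l k).
Proof.
  revert k. induction l as [|a l IH]; intros [|k] Hl; simpl; try (repeat constructor; intros []; fail).
  inversion Hl as [|? ? Hl' Ha]; subst. apply NoDup_app; auto.
  - apply FinFun.Injective_map_NoDup; auto. intros x y E. congruence.
  - intros t H1 H2. apply In_subs in H1; auto. apply in_map_iff in H2. destruct H2 as [t' [<- _]].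
    destruct H1 as [_ [_ H1]]. rewrite Forall_forall in Ha.
    pose proof (Ha a (H1 a (or_introl eq_refl))). lia.
Qed.

Definition upto (P : nat -> Prop) (N : nat) : list nat :=
  filter (fun m => if excluded_middle_informative (P m) then true else false) (seq 0 N).

Lemma In_upto P N m : In m (upto P N) <-> (m < N)%nat /\ P m.
Proof.
  unfold upto. rewrite filter_In, in_seq.
  destruct (excluded_middle_informative (P m)); intuition (try lia; try congruence).
Qed.

Lemma sorted_seq a N : StronglySorted lt (seq a N).
Proof.
  revert a. induction N as [|N IH]; intros a; simpl; constructor; auto.
  apply Forall_forall. intros x Hx. apply in_seq in Hx. lia.
Qed.

Lemma sorted_filter p (l : list nat) : StronglySorted lt l -> StronglySorted lt (filter p l).
Proof.
  induction 1 as [|a l Hl IH Ha]; simpl; [constructor|]. destruct (p a); auto.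
  constructor; auto. rewrite Forall_forall in *. intros x Hx. apply filter_In in Hx. apply Ha, Hx.
Qed.

Lemma sorted_upto P N : StronglySorted lt (upto P N).
Proof. apply sorted_filter, sorted_seq. Qed.

Lemma NoDup_upto P N : NoDup (upto P N).
Proof. apply NoDup_filter, seq_NoDup. Qed.

Definition tuples (P : nat -> Prop) (k : nat) (t : list nat) : Prop :=
  length t = k /\ StronglySorted lt t /\ List.Forall P t.

Lemma In_subs_upto P k N t : In t (subs (upto P N) k) <-> tuples P k t /\ List.Forall (fun m => (m < N)%nat) t.
Proof.
  rewrite In_subs by apply sorted_upto. unfold tuples, incl. rewrite !Forall_forall. split.
  - intros [H1 [H2 H3]]. repeat split; auto; intros m Hm; specialize (H3 m Hm); apply In_upto in H3; tauto.
  - intros [[H1 [H2 H3]] H4]. repeat split; auto. intros m Hm. apply In_upto. auto.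
Qed.

Lemma tuple_bounded (t : list nat) : exists N, forall M, (N <= M)%nat -> List.Forall (fun m => (m < M)%nat) t.
Proof.
  induction t as [|a t [N HN]]; [exists 0%nat; constructor|].
  exists (max N (S a)). intros M HM. constructor; [lia|]. apply HN. lia.
Qed.

Lemma tuples_bounded (L : list (list nat)) : exists N, List.Forall (List.Forall (fun m => (m < N)%nat)) L.
Proof.
  assert (exists N, forall M, (N <= M)%nat -> List.Forall (List.Forall (fun m => (m < M)%nat)) L) as [N HN].
  { induction L as [|t L [N HN]]; [exists 0%nat; constructor|].
    destruct (tuple_bounded t) as [N' HN']. exists (max N N'). intros M HM.
    constructor; [apply HN'; lia|apply HN; lia]. }
  exists N. apply HN. lia.
Qed.

(** Finitely many tuples involve finitely many indices, so finite sums bound them. *)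
Lemma tuples_summable (P : nat -> Prop) (f : nat -> C) k B :
  sums_below P (fun m => Cmod (f m)) B -> sums_below (tuples P k) (fun t => Cmod (mprod f t)) (B ^ k).
Proof.
  intros HB L HN HF. destruct (tuples_bounded L) as [N HL].
  apply Rle_trans with (Rsum (fun t => Cmod (mprod f t)) (subs (upto P N) k)).
  - apply Rsum_incl; auto; [intros; apply Cmod_ge_0|]. intros t Ht. apply In_subs_upto.
    rewrite Forall_forall in HF, HL. auto.
  - eapply Rle_trans; [apply subs_bound|]. apply pow_incr. split.
    + apply Rsum_pos. intros; apply Cmod_ge_0.
    + apply HB; [apply NoDup_upto|]. apply Forall_forall. intros m Hm. apply In_upto in Hm. tauto.
Qed.

Lemma tuples_exhaust (P : nat -> Prop) (f : nat -> C) k t :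
  has_sum (tuples P k) (mprod f) t -> Clim (fun N => esym (map f (upto P N)) k) t.
Proof.
  intros H. apply (Clim_ext (fun N => Csum (mprod f) (subs (upto P N) k))); [intros; apply subs_esym|].
  apply (has_sum_exhaust _ _ _ _ H).
  - intros N. split; [apply NoDup_subs, sorted_upto|]. apply Forall_forall. intros u Hu.
    apply In_subs_upto in Hu. tauto.
  - intros u Hu. destruct (tuple_bounded u) as [N HN]. exists N. intros M HM. apply In_subs_upto. auto.
Qed.

Lemma psum_exhaust (P : nat -> Prop) (f : nat -> C) j t :
  has_sum P (fun m => Cpow (f m) j) t -> Clim (fun N => psum (map f (upto P N)) j) t.
Proof.
  intros H. apply (Clim_ext (fun N => Csum (fun m => Cpow (f m) j) (upto P N))).
  - intros N. unfold psum. rewrite Csum_map. reflexivity.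
  - apply (has_sum_exhaust _ _ _ _ H).
    + intros N. split; [apply NoDup_upto|]. apply Forall_forall. intros u Hu. apply In_upto in Hu. tauto.
    + intros m Hm. exists (S m). intros M HM. apply In_upto. split; [lia|auto].
Qed.

Lemma Clim_Csum {I} (u : I -> nat -> C) (s : I -> C) L : (forall i, In i L -> Clim (u i) (s i)) ->
  Clim (fun n => Csum (fun i => u i n) L) (Csum s L).
Proof.
  induction L as [|i L IH]; intros H; [exact (Clim_const 0)|].
  simpl. apply Clim_plus; [apply H; left; auto|apply IH; intros; apply H; right; auto].
Qed.

Definition esum (P : nat -> Prop) (k : nat) (tau : C) : C := Sum (tuples P k) (mprod (fun m => qterm (INR m * tau))).

Lemma qterm_sums_below (P : nat -> Prop) tau : (forall m, P m -> (0 < m)%nat) -> 0 < Im tau ->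
  exists B, sums_below P (fun m => Cmod (qterm (INR m * tau))) B.
Proof.
  intros HP Hz. destruct (qterm_decay (Im tau) Hz) as [X [HX H]]. exists (X * 4 * 6)%R.
  apply (sums_below_le _ _ (fun m => X * 4 * wt (Z.of_nat m))%R).
  - intros m Hm. specialize (HP m Hm). destruct (H tau m ltac:(lra) HP) as [D _].
    eapply Rle_trans; [exact D|]. rewrite (Rmult_assoc X 4). apply Rmult_le_compat_l; [lra|]. apply inv4_wt, HP.
  - apply sums_below_scal; [lra|apply wt_nat_summable].
Qed.

Lemma esum_has_sum (P : nat -> Prop) k tau : (forall m, P m -> (0 < m)%nat) -> 0 < Im tau ->
  has_sum (tuples P k) (mprod (fun m => qterm (INR m * tau))) (esum P k tau).
Proof.
  intros HP Ht. destruct (qterm_sums_below P tau HP Ht) as [B HB].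
  apply Sum_spec. eapply summable_has_sum, tuples_summable, HB.
Qed.

(** Pass to the limit in the finite identities for the truncated families. *)
Lemma esum_newton (P : nat -> Prop) k tau : (forall m, P m -> (0 < m)%nat) -> 0 < Im tau ->
  INR (S k) * esum P (S k) tau =
  Csum (fun i => sgn i * esum P (k - i) tau * qsum P (S i) tau) (seq 0 (S k)).
Proof.
  intros HP Ht. set (f := fun m => qterm (INR m * tau)).
  apply (Clim_unique (fun N => INR (S k) * esym (map f (upto P N)) (S k))).
  - apply Clim_scal. apply tuples_exhaust, esum_has_sum; auto.
  - apply (Clim_ext (fun N => Csum (fun i => sgn i * esym (map f (upto P N)) (k - i) * psum (map f (upto P N)) (S i)) (seq 0 (S k)))).
    { intros N. symmetry. apply newton. }
    apply (Clim_Csum (fun i N => sgn i * esym (map f (upto P N)) (k - i) * psum (map f (upto P N)) (S i))).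
    intros i _. apply Clim_mult.
    + apply Clim_scal. apply tuples_exhaust, esum_has_sum; auto.
    + apply psum_exhaust. apply (qsum_has_sum P i tau HP Ht).
Qed.

Lemma esum_0 P tau : esum P 0 tau = 1.
Proof.
  apply Sum_eq. apply (has_sum_pred_ext (fun t => t = nil)).
  - intros t. unfold tuples. split.
    + intros ->. repeat split; constructor.
    + intros [H _]. destruct t; [auto|discriminate].
  - apply (has_sum_single nil (mprod (fun m => qterm (INR m * tau)))).
Qed.

Lemma esum_qmm (n : nat) (P : Z -> Prop) k : (1 <= n)%nat ->
  (forall m q, P (m + Z.of_nat n * q)%Z <-> P m) -> (forall m, P (- m)%Z <-> P m) ->
  qmm (Gamma1 n) (2 * k) (esum (positive_part P) k).
Proof.
  intros Hn Hper Hsym.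
  assert (Hpos : forall m, positive_part P m -> (0 < m)%nat) by (intros m [H _]; exact H).
  induction k as [k IH] using lt_wf_ind. destruct k as [|k].
  - apply (qmm_ext _ _ (fun _ => 1)); [intros; symmetry; apply esum_0|].
    apply (qmm_single _ _ 0); [lia|]. apply qm_const.
  - apply (qmm_ext _ _ (fun tau => / INR (S k) *
      Csum (fun i => sgn i * (esum (positive_part P) (k - i) tau * qsum (positive_part P) (S i) tau)) (seq 0 (S k)))).
    + intros tau Ht.
      replace (Csum _ (seq 0 (S k))) with (INR (S k) * esum (positive_part P) (S k) tau).
      * field. apply INR_S_nz.
      * rewrite esum_newton by auto. apply Csum_ext. intros; ring.
    + apply qmm_scal.
      apply (qmm_Csum _ _ (fun i tau => sgn i * (esum (positive_part P) (k - i) tau * qsum (positive_part P) (S i) tau))).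
      intros i Hi. apply in_seq in Hi. apply qmm_scal.
      apply (qmm_mono _ (2 * (k - i) + 2 * S i)); [lia|].
      apply qmm_mult; [apply IH; lia|apply qsum_qmm; auto].
Qed.

(** * The series in terms of the nome *)

Lemma A_term_mprod tau t : 0 < Im tau -> List.Forall (fun m => (0 < m)%nat) t ->
  A_term (nome tau) t = mprod (fun m => qterm (INR m * tau)) t.
Proof.
  intros Ht. unfold A_term, mprod. induction 1 as [|m t Hm HF IH].
  - simpl. field.
  - cbn [map]. change (list_sum (m :: t)) with (m + list_sum t)%nat.
    change (Cprod_list (qterm (INR m * tau) :: map (fun m => qterm (INR m * tau)) t)) with
      (qterm (INR m * tau) * Cprod_list (map (fun m => qterm (INR m * tau)) t)).
    rewrite <- IH, Cpow_add_r. unfold qterm.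
    assert (E : nome (INR m * tau) = Cpow (nome tau) m).
    { rewrite !nome_eq, <- Cexp_nat. f_equal. ring. }
    pose proof (one_minus_nome _ (Im_pos_mult m tau Hm Ht)) as N. rewrite E in *.
    change (Cprod_list (Cpow (1 - nome tau ^ m) 2 :: map (fun mi => Cpow (1 - nome tau ^ mi) 2) t)) with
      (Cpow (1 - nome tau ^ m) 2 * Cprod_list (map (fun mi => Cpow (1 - nome tau ^ mi) 2) t)).
    assert (N2 : Cprod_list (map (fun mi => Cpow (1 - nome tau ^ mi) 2) t) <> 0).
    { clear -HF Ht. induction HF as [|m t Hm HF IH].
      - simpl. apply RtoC_pos_nz. lra.
      - change (Cpow (1 - nome tau ^ m) 2 * Cprod_list (map (fun mi => Cpow (1 - nome tau ^ mi) 2) t) <> 0).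
        apply Cmult_neq_0; [|exact IH]. apply Cpow_nz.
        pose proof (one_minus_nome _ (Im_pos_mult m tau Hm Ht)) as N.
        rewrite nome_eq in N. replace (two_pi_i * (INR m * tau)) with (INR m * (two_pi_i * tau)) in N by ring.
        rewrite Cexp_nat, <- nome_eq in N. exact N. }
    revert N N2. generalize (Cprod_list (map (fun mi => Cpow (1 - nome tau ^ mi) 2) t)).
    generalize (Cpow (nome tau) (list_sum t)). generalize (Cpow (nome tau) m). intros a b p N N2. simpl Cpow. field. auto.
Qed.

Definition residues (n : nat) (S : nat -> Prop) (m : Z) : Prop :=
  exists l, S l /\ (Z.of_nat n | m - Z.of_nat l)%Z.

Lemma residue_in_iff n S m : (1 <= n)%nat -> residue_in n S m <-> residues n S (Z.of_nat m).
Proof.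
  intros Hn. unfold residue_in, residues. split; intros [l [Hl H]]; exists l; split; auto.
  - pose proof (Nat.div_mod_eq m n). pose proof (Nat.div_mod_eq l n).
    exists (Z.of_nat (m / n) - Z.of_nat (l / n))%Z. nia.
  - destruct H as [q Hq]. apply Nat2Z.inj. rewrite !Nat2Z.inj_mod.
    replace (Z.of_nat m) with (Z.of_nat l + q * Z.of_nat n)%Z by lia. apply Z.mod_add. lia.
Qed.

Theorem theorem1p1 (n k : nat) (S : nat -> Prop)
  (hn : (1 <= n)%nat) (hk : (1 <= k)%nat)
  (hS : forall l, S l -> (1 <= l <= n)%nat)
  (hsym : symmetric_residues n S) :
  exists A : C -> C,
    is_A S n k A /\ quasi_modular_mixed (Gamma1 n) (2 * k) A.
Proof.
  set (P := residues n S).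
  assert (Hper : forall m q, P (m + Z.of_nat n * q)%Z <-> P m).
  { intros m q. unfold P, residues. split; intros [l [Hl [c Hc]]]; exists l; split; auto.
    - exists (c - q)%Z. lia.
    - exists (c + q)%Z. lia. }
  assert (Hhalf : forall m, P m -> P (- m)%Z).
  { intros m [l [Hl [c Hc]]]. destruct (hsym l Hl) as [l' [Hl' E]]. exists l'. split; auto.
    pose proof (Nat.div_mod_eq (l + l') n) as D. rewrite E in D.
    exists (- c - Z.of_nat ((l + l') / n))%Z. nia. }
  assert (Hsym : forall m, P (- m)%Z <-> P m).
  { intros m. split; [|apply Hhalf]. intros H. apply Hhalf in H. rewrite Z.opp_involutive in H. exact H. }
  assert (Hpos : forall m, positive_part P m -> (0 < m)%nat) by (intros m [H _]; exact H).
  exists (esum (positive_part P) k). split.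
  - intros tau Ht. apply is_sum_has_sum.
    apply (has_sum_pred_ext (tuples (positive_part P) k)).
    { intros t. unfold index_tuple, tuples. rewrite !Forall_forall.
      assert (E : forall m, positive_part P m <-> (0 < m)%nat /\ residue_in n S m).
      { intros m. unfold positive_part. rewrite residue_in_iff by exact hn. reflexivity. }
      split; intros [H1 [H2 H3]]; (split; [exact H1|split; [exact H2|]]); intros m Hm; apply E, H3, Hm. }
    refine (has_sum_ext _ _ _ _ _ (esum_has_sum _ k tau Hpos Ht)).
    intros t [_ [_ HF]]. symmetry. apply A_term_mprod; [exact Ht|].
    rewrite Forall_forall in *. auto.
  - apply qmm_quasi_modular_mixed, esum_qmm; auto.
Qed.
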